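(* Let $N\ge1$, $K\ge0$, $\varphi\in L^1_K$ and $\mathbf F\in C(\mathbf{R}^N\times(0,\infty)\times\mathbf{R}:\mathbf{R}^N)$ satisfy, for some constants $C>0$ and $A>1$, $|\mathbf F(x,t,p)|\le C(1+t)^{-A+1/2}|p|$ for all $(x,t,p)\in\mathbf{R}^N\times(0,\infty)\times\mathbf{R}$. Then there exists $u\in C(\mathbf{R}^N\times(0,\infty))$ such that: (i) for every $q\in[1,\infty]$ and $l\in[0,K]$, $\sup_{t>0}t^{\frac N2(1-\frac1q)}\|u(t)\|_q+\sup_{t>0}(1+t)^{-\frac l2}|||u(t)|||_l<\infty$; (ii) $u(x,t)=(e^{t\Delta}\varphi)(x)+\int_0^t\nabla\cdot e^{(t-s)\Delta}\mathbf F(\cdot,s,u(\cdot,s))\,ds$ for almost all $(x,t)\in\mathbf{R}^N\times(0,\infty)$ (i.e. $u$ is a mild solution of $\partial_tu=\Delta u+\nabla\cdot\mathbf F(x,t,u)$, $u(\cdot,0)=\varphi$); (iii) $\lim_{t\to\infty}t^{\frac N2(1-\frac1q)}\|u(t)-Mg(t)\|_q=0$ for all $q\in[1,\infty]$, where $M=\int_{\mathbf{R}^N}\varphi\,dx$.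
   Context: Notation: $G(x,t)=(4\pi t)^{-N/2}\exp(-|x|^2/(4t))$; $g(x,t)=G(x,1+t)$; $(e^{t\Delta}\varphi)(x)=\int G(x-\xi,t)\varphi(\xi)\,d\xi$ (applied componentwise to vector fields). $\|\cdot\|_q$ is the norm of $L^q(\mathbf{R}^N)$; $|||f|||_m=\int(1+|x|)^m|f|\,dx$; $L^1_K=\{\phi\in L^1(\mathbf{R}^N):|||\phi|||_K<\infty\}$. *)

(* Defs.v *)
From HB Require Import structures.
From mathcomp Require Import all_boot all_order all_algebra.
From mathcomp Require Import all_classical all_reals all_analysis.
Set Implicit Arguments. Unset Strict Implicit. Unset Printing Implicit Defensive.
Import Order.TTheory GRing.Theory Num.Theory.
Import numFieldNormedType.Exports.
Local Open Scope classical_set_scope.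
Local Open Scope ring_scope.

(* Points of R^n are n-tuples of reals; n.-tuple R carries the product
   (Borel) sigma-algebra from MathComp-Analysis. *)

Definition enorm_t (R : realType) (n : nat) (x : n.-tuple R) : R :=
  Num.sqrt (\sum_(i < n) (tnth x i) ^+ 2).

Definition edist_t (R : realType) (n : nat) (x y : n.-tuple R) : R :=
  Num.sqrt (\sum_(i < n) (tnth x i - tnth y i) ^+ 2).

(* Lebesgue integral on R^n of an extended-real function, as the iterated
   one-dimensional Lebesgue integral (for nonnegative measurable functions this
   is the integral w.r.t. n-dimensional Lebesgue measure, by Tonelli).
   R^0 is a point, with unit mass. *)
Fixpoint lebint (R : realType) (n : nat) : (n.-tuple R -> \bar R) -> \bar R :=
  match n with
  | 0 => fun f => f [tuple]
  | m.+1 => fun f =>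
      (\int[@lebesgue_measure R]_(x in [set: R])
          lebint (fun y : m.-tuple R => f [tuple of x :: y]))%E
  end.

Definition lebintR (R : realType) (n : nat) (f : n.-tuple R -> R) : R :=
  fine (lebint (fun x => (Num.max (f x) 0)%:E)) -
  fine (lebint (fun x => (Num.max (- f x) 0)%:E)).

Definition leb_negligible (R : realType) (n : nat) (A : set (n.-tuple R)) : Prop :=
  exists B : set (n.-tuple R),
    measurable B /\ A `<=` B /\ lebint (fun x => (\1_B x)%:E) = 0%E.

Definition leb_esssup (R : realType) (n : nat) (f : n.-tuple R -> R) : \bar R :=
  ereal_inf [set M : \bar R | leb_negligible [set x | M < (`|f x|)%:E]%E].

Definition Lq_norm (R : realType) (n : nat) (q : \bar R) (f : n.-tuple R -> R) : \bar R :=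
  match q with
  | r%:E => (lebint (fun x => (`|f x| `^ r)%:E) `^ r^-1)%E
  | +oo%E => leb_esssup f
  | -oo%E => 0%E
  end.

Definition wL1_norm (R : realType) (n : nat) (m : R) (f : n.-tuple R -> R) : \bar R :=
  lebint (fun x => ((1 + enorm_t x) `^ m * `|f x|)%:E).

Definition decay_exp (R : realType) (n : nat) (q : \bar R) : R :=
  match q with
  | r%:E => (n%:R / 2) * (1 - r^-1)
  | +oo%E => n%:R / 2
  | -oo%E => 0
  end.

Definition heat_kernel (R : realType) (n : nat) (x : n.-tuple R) (t : R) : R :=
  (4 * pi * t) `^ (- (n%:R / 2)) * expR (- (enorm_t x ^+ 2) / (4 * t)).

(* Partial derivative d/dx_i G(x,t) = - x_i/(2t) G(x,t). *)
Definition dheat_kernel (R : realType) (n : nat) (i : 'I_n) (x : n.-tuple R) (t : R) : R :=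
  - (tnth x i / (2 * t)) * heat_kernel x t.

Definition gauss_g (R : realType) (n : nat) (x : n.-tuple R) (t : R) : R :=
  heat_kernel x (1 + t).

Definition tsub (R : realType) (n : nat) (x y : n.-tuple R) : n.-tuple R :=
  [tuple tnth x i - tnth y i | i < n].

Definition heat_sg (R : realType) (n : nat) (t : R) (phi : n.-tuple R -> R)
    (x : n.-tuple R) : R :=
  lebintR (fun xi => heat_kernel (tsub x xi) t * phi xi).

Definition duhamel_integrand (R : realType) (n : nat)
    (F : n.-tuple R -> R -> R -> n.-tuple R) (u : n.-tuple R -> R -> R)
    (i : 'I_n) (x : n.-tuple R) (t s : R) (xi : n.-tuple R) : R :=
  dheat_kernel i (tsub x xi) (t - s) * tnth (F xi s (u xi s)) i.

Definition div_heat (R : realType) (n : nat)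
    (F : n.-tuple R -> R -> R -> n.-tuple R) (u : n.-tuple R -> R -> R)
    (x : n.-tuple R) (t s : R) : R :=
  \sum_(i < n) lebintR (duhamel_integrand F u i x t s).

(* Main.v *)
Require Import Defs.
From HB Require Import structures.
From mathcomp Require Import all_boot all_order all_algebra.
From mathcomp Require Import all_classical all_reals all_analysis.
From mathcomp Require Import measurable_realfun lebesgue_integral_fubini.
From mathcomp Require Import ring lra.
Set Implicit Arguments. Unset Strict Implicit. Unset Printing Implicit Defensive.
Import Order.TTheory GRing.Theory Num.Theory.
Import numFieldNormedType.Exports.
Local Open Scope classical_set_scope.
Local Open Scope ring_scope.

(** Write [G] for the heat kernel. The pointwise bound
    [|d_i G(x,t)| <= 2^(N/2) t^(-1/2) G(x,2t)] and the semigroup law make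
    [E(x,t) := (G(.,2t) * |phi|)(x)] a majorant for the whole problem: if
    [|f(s)| <= b(s) E(s)], the Duhamel term of [f] is at most
    [N 2^(N/2) (int_0^t (t-s)^(-1/2) b(s) ds) E(t)]. With
    [b(s) = C (1+s)^(1/2-A) h(s)], a bounded supersolution [h] of the resulting
    scalar Volterra inequality gives a set of source terms [f] that is invariant
    under [f |-> F(u_f)], where [u_f] is the mild formula with source [f]. The
    functions [u_f] are equicontinuous at every point, so Tonelli's delayed
    approximations have a pointwise limit along a subsequence, and dominated
    convergence turns the limit into a mild solution with [|u| <= H E]; this gives
    (i) and (ii). For (iii), [int_0^t (t-s)^(-1/2) (1+s)^(1/2-A) ds] tends to [0]
    because [A > 1], hence the Duhamel term is negligible, and
    [e^{t Delta} phi - M g(t)] is the integral of [(G(.-y,t) - G(.,1+t)) phi(y)],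
    to which dominated convergence in [y] applies. *)

(** * Lebesgue measure on tuples *)

(** [F] is only continuous in [p], so the Duhamel map need not be a contraction and existence has to
    come from compactness. As [phi] is merely integrable, the solution may be as large as t^(-N/2)
    near t = 0. Measuring everything against E removes this singularity: the ratio |u|/E stays
    bounded, and the only singularity left in the scalar problem is the integrable (t-s)^(-1/2). The
    sources carry no modulus of continuity of their own, whereas the functions u_f have one that
    depends only on the bound on f. The subsequence is therefore extracted for the u_f, and the
    convergence of the sources is recovered from the continuity of [F] once the delay error is known
    to vanish. *)

Section product_measure.
Context d1 d2 (T1 : measurableType d1) (T2 : measurableType d2) (R : realType).
Variable m1 : {sigma_finite_measure set T1 -> \bar R}.
Variable m2 : {sigma_finite_measure set T2 -> \bar R}.

(* The canonical sigma-finite structure of [m1 \x m2] is shadowed in the library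
   by the instance for products of probability measures. *)
Lemma sigma_finite_product : sigma_finite setT (m1 \x m2)%E.
Proof.
by case: (lebesgue_integral_fubini.measure_function_Measure_isSigmaFinite__to__measure_function_isSigmaFinite m1 m2).
Qed.

Definition prodm_measure : {measure set (T1 * T2)%type -> \bar R} :=
  ((m1 \x m2)%E : set (T1 * T2) -> \bar R).

Definition prodm : {sigma_finite_measure set (T1 * T2)%type -> \bar R} :=
  HB.pack_for {sigma_finite_measure set (T1 * T2)%type -> \bar R}
    (Measure.sort prodm_measure)
    (Measure_isSigmaFinite.Build _ _ _ (Measure.sort prodm_measure)
      sigma_finite_product).

End product_measure.

Section tuple_measure.
Context {R : realType}.

Let TR : measurableType _ := measurableTypeR R.
Let leb : {sigma_finite_measure set TR -> \bar R} := @lebesgue_measure R.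

Lemma measurable_fst_TR d (X : measurableType d) :
  measurable_fun [set: TR * X] (fst : TR * X -> R).
Proof. exact: (@measurable_fst _ _ TR X). Qed.

Definition cons_pair n (z : TR * n.-tuple R) : n.+1.-tuple R := [tuple of z.1 :: z.2].

Lemma measurable_cons_pair n : measurable_fun [set: TR * n.-tuple R] (@cons_pair n).
Proof. by apply: measurable_cons => //; exact: measurable_fst_TR. Qed.

Lemma measurable_consl n (x : R) :
  measurable_fun [set: n.-tuple R] (fun y : n.-tuple R => [tuple of x :: y]).
Proof. by apply: (@measurable_cons _ _ _ _ (cst x)) => //; exact: measurable_cst. Qed.

Lemma cons_pairK n (z : TR * n.-tuple R) :
  (thead (cons_pair z), [tuple of behead (cons_pair z)]) = z.
Proof. by case: z => x y; congr pair; exact: val_inj. Qed.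

(** Induction on the dimension: the measure in dimension n+1 is the image under [cons_pair] of the
    product of Lebesgue measure with the previous one, and Tonelli turns its integral into the
    iterated one. This brings [lebint] within reach of the convergence theorems. *)
Lemma lebint_integral n :
  exists mu : {sigma_finite_measure set (n.-tuple R) -> \bar R},
  forall f : n.-tuple R -> \bar R, measurable_fun [set: n.-tuple R] f ->
    (forall x, 0 <= f x)%E -> lebint f = (\int[mu]_x f x)%E.
Proof.
elim: n => [|n [m IH]].
  exists (@dirac _ (0.-tuple R) [tuple] R : {sigma_finite_measure set _ -> \bar R}).
  by move=> f mf f0; rewrite integral_dirac// diracT mul1e.
have mc := @measurable_cons_pair n.
pose prd := prodm leb m.
pose nu := pushforward prd (@cons_pair n).
(* Sigma-finiteness survives this pushforward because [cons_pair] has a measurable inverse: [uncons]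
   transports an exhaustion. *)
have nu_sf : sigma_finite setT nu.
  have [A TA Aoo] := sigma_finiteT prd.
  pose uncons (y : n.+1.-tuple R) : TR * n.-tuple R := (thead y, [tuple of behead y]).
  have muncons : measurable_fun [set: n.+1.-tuple R] uncons.
    apply/measurable_fun_pairP; split; [exact: measurable_tnth|exact: measurable_behead].
  exists (fun k => uncons @^-1` (A k)).
    by rewrite -preimage_bigcup -TA preimage_setT.
  move=> k; have [mAk Ak] := Aoo k; split.
    by rewrite -[X in measurable X]setTI; exact: muncons.
  rewrite /nu /= /pushforward -comp_preimage (_ : uncons \o _ = id) ?preimage_id//.
  by apply/funext => z; exact: cons_pairK.
pose nu1 : {measure set (n.+1.-tuple R) -> \bar R} :=
   (measure_function_pushforward__canonical__measure_function_Measure prd mc).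
pose nu' : {sigma_finite_measure set (n.+1.-tuple R) -> \bar R} :=
  HB.pack_for {sigma_finite_measure set (n.+1.-tuple R) -> \bar R} (Measure.sort nu1)
   (Measure_isSigmaFinite.Build _ _ _ (Measure.sort nu1) nu_sf).
exists nu' => f mf f0 /=.
transitivity (\int[nu1]_x f x)%E => //.
rewrite ge0_integral_pushforward// preimage_setT.
have mfc : measurable_fun [set: TR * n.-tuple R] (f \o @cons_pair n).
  exact: measurableT_comp.
rewrite (fubini_tonelli1 _ mfc) => [|z]; last exact: f0.
apply: eq_integral => x _; rewrite /fubini_F IH//.
by apply: measurableT_comp => //; exact: measurable_consl.
Qed.

(** Obtained by choice: apart from sigma-finiteness, everything known about this measure comes
    through [lebintE]. *)
Definition tuple_leb n : {sigma_finite_measure set (n.-tuple R) -> \bar R} :=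
  projT1 (cid (@lebint_integral n)).

Lemma lebintE n (f : n.-tuple R -> \bar R) : measurable_fun [set: n.-tuple R] f ->
  (forall x, 0 <= f x)%E -> lebint f = (\int[tuple_leb n]_x f x)%E.
Proof. exact: (projT2 (cid (@lebint_integral n))). Qed.

Lemma integral_tuple_cons n (f : n.+1.-tuple R -> \bar R) :
  measurable_fun [set: n.+1.-tuple R] f -> (forall x, 0 <= f x)%E ->
  (\int[tuple_leb n.+1]_x f x =
   \int[@lebesgue_measure R]_x \int[tuple_leb n]_y f [tuple of x :: y])%E.
Proof.
move=> mf f0; rewrite -lebintE//=; apply: eq_integral => x _; rewrite lebintE//.
by apply: measurableT_comp => //; exact: measurable_consl.
Qed.

Lemma integral_tuple0 (f : 0.-tuple R -> \bar R) :
  measurable_fun [set: 0.-tuple R] f -> (forall x, 0 <= f x)%E ->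
  (\int[tuple_leb 0]_x f x = f [tuple])%E.
Proof. by move=> mf f0; rewrite -lebintE. Qed.

End tuple_measure.

(** * The heat kernel *)

Section heat_kernel.
Context {R : realType}.
Implicit Types (n : nat) (t a b : R).

Definition sqd n (x y : n.-tuple R) : R := \sum_(i < n) (tnth x i - tnth y i) ^+ 2.

Definition hk n (x y : n.-tuple R) t : R := heat_kernel (tsub x y) t.

Lemma sqr_enorm_t n (x : n.-tuple R) : enorm_t x ^+ 2 = \sum_(i < n) tnth x i ^+ 2.
Proof. by rewrite /enorm_t sqr_sqrtr// sumr_ge0// => i _; exact: sqr_ge0. Qed.

Lemma sqr_enorm_tsub n (x y : n.-tuple R) : enorm_t (tsub x y) ^+ 2 = sqd x y.
Proof. by rewrite sqr_enorm_t; apply: eq_bigr => i _; rewrite tnth_mktuple. Qed.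

Lemma enorm_t_ge0 n (x : n.-tuple R) : 0 <= enorm_t x.
Proof. exact: sqrtr_ge0. Qed.

Lemma sqd_ge0 n (x y : n.-tuple R) : 0 <= sqd x y.
Proof. by apply: sumr_ge0 => i _; exact: sqr_ge0. Qed.

Lemma hkE n (x y : n.-tuple R) t :
  hk x y t = (4 * pi * t) `^ (- (n%:R / 2)) * expR (- sqd x y / (4 * t)).
Proof. by rewrite /hk /heat_kernel sqr_enorm_tsub. Qed.

Lemma pi4_gt0 t : 0 < t -> 0 < 4 * pi * t.
Proof. by move=> t0; rewrite !mulr_gt0// pi_gt0. Qed.

Lemma hk_ge0 n (x y : n.-tuple R) t : 0 <= hk x y t.
Proof. by rewrite hkE mulr_ge0 ?powR_ge0 ?expR_ge0. Qed.

Lemma hk_le n (x y : n.-tuple R) t : 0 < t -> hk x y t <= (4 * pi * t) `^ (- (n%:R / 2)).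
Proof.
move=> t0; rewrite hkE ler_piMr ?powR_ge0// -expR0 ler_expR.
by rewrite mulNr oppr_le0 divr_ge0 ?sqd_ge0// mulr_ge0// ltW.
Qed.

(** Only the prefactor of the kernel decreases in time; the exponential factor increases. *)
Lemma hk_le_wider n (x y : n.-tuple R) t s : 0 < t -> t <= s ->
  hk x y t <= (s / t) `^ (n%:R / 2) * hk x y s.
Proof.
move=> t0 ts; have s0 := lt_le_trans t0 ts.
rewrite !hkE mulrA.
have -> : (s / t) `^ (n%:R / 2) * (4 * pi * s) `^ (- (n%:R / 2)) =
    (4 * pi * t) `^ (- (n%:R / 2)) :> R.
  have -> : 4 * pi * s = s / t * (4 * pi * t) by field; rewrite gt_eqF.
  rewrite [X in _ * X]powRM ?divr_ge0// ?ltW ?pi4_gt0// mulrA -powRD ?subrr ?powRr0 ?mul1r//.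
  by rewrite (gt_eqF (divr_gt0 s0 t0)) implybT.
rewrite ler_wpM2l ?powR_ge0// ler_expR !mulNr lerN2.
apply: ler_wpM2l; first exact: sqd_ge0.
by rewrite lef_pV2 ?posrE ?mulr_gt0// ler_pM2l.
Qed.

Definition g1 (x y t : R) : R := (4 * pi * t) `^ (- 2^-1) * expR (- (x - y) ^+ 2 / (4 * t)).

(** The kernel is the normal density of variance 2t, from which its unit mass is inherited. *)
Lemma g1E (x y t : R) : 0 < t -> g1 x y t = normal_pdf y (Num.sqrt (2 * t)) x.
Proof.
move=> t0; have s0 : Num.sqrt (2 * t) != 0 by rewrite gt_eqF// sqrtr_gt0 mulr_gt0.
rewrite normal_pdfE// /normal_peak /normal_fun sqr_sqrtr ?mulr_ge0 ?ltW// /g1.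
rewrite powRN powR12_sqrt ?ltW ?pi4_gt0//.
congr (_^-1 * expR (_ / _)); last by ring.
by congr Num.sqrt; ring.
Qed.

Lemma integral_g1 (y t : R) : 0 < t -> (\int[@lebesgue_measure R]_x (g1 x y t)%:E = 1)%E.
Proof.
move=> t0; rewrite -(integral_normal_pdf y (Num.sqrt (2 * t))).
by apply: eq_integral => x _; rewrite g1E.
Qed.

(** Completing the square in y: the y-dependent factor is again a Gaussian, centred at a weighted
    mean of x and z. Integrating it out yields the semigroup law. *)
Lemma g1_mul (x y z a b : R) : 0 < a -> 0 < b ->
  g1 x y a * g1 y z b = g1 x z (a + b) * g1 y ((b * x + a * z) / (a + b)) (a * b / (a + b)).
Proof.
move=> a0 b0; have ab0 : 0 < a + b by rewrite addr_gt0.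
rewrite /g1 mulrACA [RHS]mulrACA; congr (_ * _).
- rewrite !powRN -!invfM; congr (_^-1); rewrite !powR12_sqrt ?ltW ?pi4_gt0 ?divr_gt0 ?mulr_gt0//.
  rewrite -!sqrtrM ?ltW ?pi4_gt0 ?divr_gt0 ?mulr_gt0//; congr Num.sqrt; field.
  by rewrite gt_eqF.
- rewrite -!expRD; congr expR; field.
  by rewrite !gt_eqF.
Qed.

Lemma measurable_g1 (y t : R) : measurable_fun [set: R] (fun x => g1 x y t).
Proof.
apply: measurable_funM => //; apply: measurableT_comp => //.
apply: measurable_funM => //; apply: measurableT_comp => //.
by apply: measurable_funX; exact: measurable_funB.
Qed.

Lemma g1_ge0 (x y t : R) : 0 <= g1 x y t.
Proof. by rewrite mulr_ge0 ?powR_ge0 ?expR_ge0. Qed.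

Lemma integral_g1M (x z a b : R) : 0 < a -> 0 < b ->
  (\int[@lebesgue_measure R]_y (g1 x y a * g1 y z b)%:E = (g1 x z (a + b))%:E)%E.
Proof.
move=> a0 b0; under eq_integral do rewrite g1_mul// EFinM.
rewrite ge0_integralZl//=.
- by rewrite integral_g1 ?mule1// divr_gt0 ?mulr_gt0 ?addr_gt0.
- by apply/measurable_EFinP; exact: measurable_g1.
- by move=> y _; rewrite lee_fin g1_ge0.
- by rewrite lee_fin g1_ge0.
Qed.

Lemma sqd_cons n (x y : R) (u v : n.-tuple R) :
  sqd [tuple of x :: u] [tuple of y :: v] = (x - y) ^+ 2 + sqd u v.
Proof. by rewrite /sqd big_ord_recl; congr +%R; apply: eq_bigr => i _; rewrite !tnthS. Qed.

Lemma hk_cons n (x y t : R) (u v : n.-tuple R) : 0 < t ->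
  hk [tuple of x :: u] [tuple of y :: v] t = g1 x y t * hk u v t.
Proof.
move=> t0; rewrite !hkE sqd_cons /g1 (opprD ((x - y) ^+ 2)) (mulrDl (- (x - y) ^+ 2)) expRD.
rewrite mulrACA -powRD; last by rewrite (gt_eqF (pi4_gt0 t0)) implybT.
by congr (_ `^ _ * _); rewrite -natr1; field.
Qed.

Lemma hk0 (x y : 0.-tuple R) t : hk x y t = 1.
Proof. by rewrite hkE /sqd big_ord0 !mul0r !oppr0 powRr0 !mul0r expR0 mulr1. Qed.

(** The identity 1/x = x |x|^(-2), whose two sides vanish at x = 0, reduces the claim to powers. *)
Lemma measurable_invr : measurable_fun [set: R] (fun x : R => x^-1).
Proof.
rewrite (_ : (fun _ => _) = fun x : R => x * `|x| `^ (- 2)).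
  apply: measurable_funM => //.
  by apply: (measurableT_comp (measurable_powR _)); exact: normr_measurable.
apply/funext => x; rewrite powRN powR_mulrn// real_normK ?num_real// expr2 invfM.
by have [->|x0] := eqVneq x 0; [rewrite invr0 !mul0r|rewrite mulVKf].
Qed.

Section measurability.
Context d (T : measurableType d) (n : nat) (x y : T -> n.-tuple R) (t : T -> R).
Hypotheses (mx : measurable_fun [set: T] x) (my : measurable_fun [set: T] y)
  (mt : measurable_fun [set: T] t).

Lemma measurable_sqd : measurable_fun [set: T] (fun w => sqd (x w) (y w)).
Proof.
apply: measurable_sum => i; apply: measurable_funX; apply: measurable_funB.
- exact: (measurable_fun_tnthP _).1.
- exact: (measurable_fun_tnthP _).1.
Qed.

Lemma measurable_hk : measurable_fun [set: T] (fun w => hk (x w) (y w) (t w)).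
Proof.
have m4 (c : R) : measurable_fun [set: T] (fun w => c * t w) by exact: measurable_funM.
under eq_fun do rewrite hkE.
apply: measurable_funM.
  by apply: (measurableT_comp (measurable_powR _)).
apply: measurableT_comp => //; apply: measurable_funM.
  by apply: measurableT_comp => //; exact: measurable_sqd.
exact: (measurableT_comp measurable_invr (m4 _)).
Qed.

Lemma measurable_dhk (i : 'I_n) :
  measurable_fun [set: T] (fun w => dheat_kernel i (tsub (x w) (y w)) (t w)).
Proof.
have m2 (c : R) : measurable_fun [set: T] (fun w => c * t w) by exact: measurable_funM.
apply: measurable_funM; last exact: measurable_hk.
apply: measurableT_comp => //; apply: measurable_funM.
  under eq_fun do rewrite tnth_mktuple.
  by apply: measurable_funB; exact: (measurable_fun_tnthP _).1.
exact: (measurableT_comp measurable_invr (m2 _)).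
Qed.

End measurability.

Lemma measurable_enorm n : measurable_fun [set: n.-tuple R] (@enorm_t R n).
Proof.
rewrite (_ : @enorm_t R n = fun x => (\sum_(i < n) tnth x i ^+ 2) `^ 2^-1).
  apply: (measurableT_comp (measurable_powR _)); apply: measurable_sum => i.
  by apply: measurable_funX; exact: measurable_tnth.
by apply/funext => w; rewrite powR12_sqrt// sumr_ge0// => i _; exact: sqr_ge0.
Qed.

Lemma measurable_hkl n (y : n.-tuple R) t :
  measurable_fun [set: n.-tuple R] (fun x => (hk x y t)%:E).
Proof. by apply/measurable_EFinP; exact: measurable_hk. Qed.

Lemma integral_hk n (y : n.-tuple R) t : 0 < t ->
  (\int[tuple_leb n]_x (hk x y t)%:E = 1)%E.
Proof.
move=> t0; elim: n y => [y|n IH y].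
  rewrite integral_tuple0 ?hk0//; first exact: measurable_hkl.
  by move=> x; rewrite lee_fin hk_ge0.
rewrite integral_tuple_cons; [|exact: measurable_hkl|by move=> x; rewrite lee_fin hk_ge0].
case/tupleP: y => a y; under eq_integral => x _.
  under eq_integral do rewrite hk_cons// EFinM.
  rewrite ge0_integralZl//; last 3 first.
  - exact: measurable_hkl.
  - by move=> z _; rewrite lee_fin hk_ge0.
  - by rewrite lee_fin g1_ge0.
  rewrite IH mule1; over.
exact: integral_g1.
Qed.

Lemma integral_hkM n (x z : n.-tuple R) a b : 0 < a -> 0 < b ->
  (\int[tuple_leb n]_y (hk x y a * hk y z b)%:E = (hk x z (a + b))%:E)%E.
Proof.
move=> a0 b0.
have mh k (u v : k.-tuple R) : measurable_fun [set: k.-tuple R] (fun y => (hk u y a * hk y v b)%:E).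
  by apply/measurable_EFinP; apply: measurable_funM; exact: measurable_hk.
have h0 k (u y v : k.-tuple R) : (0 <= (hk u y a * hk y v b)%:E)%E.
  by rewrite lee_fin mulr_ge0 ?hk_ge0.
elim: n x z => [x z|n IH x z].
  by rewrite integral_tuple0// !hk0 mulr1.
rewrite integral_tuple_cons//.
case/tupleP: x => u x; case/tupleP: z => v z; under eq_integral => y _.
  under eq_integral do rewrite !hk_cons// mulrACA EFinM.
  rewrite ge0_integralZl//; [|exact: mh|by rewrite lee_fin mulr_ge0 ?g1_ge0].
  rewrite IH; over.
rewrite hk_cons ?addr_gt0// [RHS]EFinM -integral_g1M//.
rewrite ge0_integralZr//=.
- apply/measurable_EFinP; apply: measurable_funM; last exact: measurable_g1.
  rewrite (_ : (fun y => g1 u y a) = (fun y => g1 y u a)); first exact: measurable_g1.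
  by apply/funext => y; rewrite /g1 -sqrrN opprB.
- by move=> y _; rewrite lee_fin mulr_ge0 ?g1_ge0.
- by rewrite lee_fin hk_ge0.
Qed.

End heat_kernel.

(** * Kernel estimates *)

Section nonneg_real_integral.
Context d (T : measurableType d) (R : realType) (mu : {measure set T -> \bar R}).
Implicit Types f g : T -> R.

Lemma le_int0 f g : measurable_fun [set: T] f -> measurable_fun [set: T] g ->
  (forall x, 0 <= f x) -> (forall x, f x <= g x) ->
  (\int[mu]_x (f x)%:E <= \int[mu]_x (g x)%:E)%E.
Proof.
move=> mf mg f0 fg; apply: ge0_le_integral => //.
- by move=> x _; rewrite lee_fin.
- exact/measurable_EFinP.
- exact/measurable_EFinP.
- by move=> x _; rewrite lee_fin.
Qed.

Lemma int0D f g : measurable_fun [set: T] f -> measurable_fun [set: T] g ->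
  (forall x, 0 <= f x) -> (forall x, 0 <= g x) ->
  (\int[mu]_x (f x + g x)%:E = \int[mu]_x (f x)%:E + \int[mu]_x (g x)%:E)%E.
Proof.
move=> mf mg f0 g0; under eq_integral do rewrite EFinD.
rewrite ge0_integralD//.
- by move=> x _; rewrite lee_fin.
- exact/measurable_EFinP.
- by move=> x _; rewrite lee_fin.
- exact/measurable_EFinP.
Qed.

Lemma int0Z f (c : R) : measurable_fun [set: T] f -> (forall x, 0 <= f x) -> 0 <= c ->
  (\int[mu]_x (c * f x)%:E = c%:E * \int[mu]_x (f x)%:E)%E.
Proof.
move=> mf f0 c0; under eq_integral do rewrite EFinM.
rewrite ge0_integralZl//.
- exact/measurable_EFinP.
- by move=> x _; rewrite lee_fin.
Qed.

Lemma int0_ge0 f : (forall x, 0 <= f x) -> (0 <= \int[mu]_x (f x)%:E)%E.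
Proof. by move=> f0; apply: integral_ge0 => x _; rewrite lee_fin. Qed.

End nonneg_real_integral.

(** * Pointwise and L^1 estimates for the heat kernel *)

Section kernel_bounds.
Context {R : realType}.
Implicit Types (n : nat) (t s : R).

(** Lets half of the Gaussian exponent absorb the linear factor of the gradient. *)
Lemma le_expR_sqr (y : R) : y / 2 <= expR (y ^+ 2 / 8).
Proof.
apply: le_trans (expR_ge1Dx _); rewrite -subr_ge0.
rewrite (_ : _ - _ = ((y - 2) ^+ 2 + 4) / 8); last by field.
by rewrite divr_ge0// addr_ge0// sqr_ge0.
Qed.

Lemma sqr_tnth_le_sqd n (x y : n.-tuple R) (i : 'I_n) :
  (tnth x i - tnth y i) ^+ 2 <= sqd x y.
Proof.
rewrite /sqd (bigD1 i)//= lerDl sumr_ge0// => j _; exact: sqr_ge0.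
Qed.

Lemma hk_double n (x y : n.-tuple R) t : 0 < t ->
  hk x y t = 2 `^ (n%:R / 2) * expR (- (sqd x y / (8 * t))) * hk x y (2 * t).
Proof.
move=> t0; rewrite !hkE [RHS]mulrACA; congr (_ * _).
  rewrite (_ : 4 * pi * (2 * t) = 2 * (4 * pi * t)); last by ring.
  rewrite [X in _ = _ * X]powRM ?ltW ?pi4_gt0// mulrA -powRD ?subrr ?powRr0 ?mul1r//.
  by rewrite pnatr_eq0 implybT.
by rewrite -expRD; congr expR; field; rewrite gt_eqF.
Qed.

Lemma hk_le_double n (x y : n.-tuple R) t : 0 < t ->
  hk x y t <= 2 `^ (n%:R / 2) * hk x y (2 * t).
Proof.
move=> t0; rewrite hk_double// mulrAC ler_piMr ?mulr_ge0 ?powR_ge0 ?hk_ge0//.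
by rewrite -expR0 ler_expR oppr_le0 divr_ge0 ?sqd_ge0// mulr_ge0// ltW.
Qed.

(** With y = |x_i - y_i| / sqrt t, the gradient contributes t^(-1/2) y/2, and y/2 is absorbed by the
    factor exp(-|x-y|^2/(8t)) that [hk_double] splits off. *)
Lemma dheat_kernel_le n (i : 'I_n) (x y : n.-tuple R) t : 0 < t ->
  `|dheat_kernel i (tsub x y) t| <=
  2 `^ (n%:R / 2) * ((Num.sqrt t)^-1 * hk x y (2 * t)).
Proof.
move=> t0; rewrite /dheat_kernel -/(hk x y t) tnth_mktuple.
set z := tnth x i - tnth y i.
have st0 : 0 < Num.sqrt t by rewrite sqrtr_gt0.
have tE : t = Num.sqrt t ^+ 2 by rewrite sqr_sqrtr// ltW.
rewrite normrM (ger0_norm (hk_ge0 _ _ _)) hk_double// normrN.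
rewrite [_ * expR _]mulrC -!mulrA [leLHS]mulrA.
have -> : `|z / (2 * t)| = (Num.sqrt t)^-1 * ((`|z| / Num.sqrt t) / 2).
  rewrite normrM normfV [`|2 * t|]gtr0_norm ?mulr_gt0// {1}tE; field.
  by rewrite gt_eqF.
have h : (`|z| / Num.sqrt t) / 2 * expR (- (sqd x y / (8 * t))) <= 1.
  rewrite expRN ler_pdivrMr ?expR_gt0// mul1r (le_trans (le_expR_sqr _))// ler_expR.
  rewrite exprMn exprVn -tE real_normK ?num_real// -mulrA -invfM [t * 8]mulrC.
  apply: ler_wpM2r; first by rewrite invr_ge0 mulr_ge0// ltW.
  exact: sqr_tnth_le_sqd.
have key (a b e c H : R) : 0 <= c -> 0 <= a -> 0 <= H -> b * e <= 1 ->
    a * b * e * (c * H) <= c * (a * H).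
  move=> c0 a0 H0 be; rewrite (_ : _ * _ = c * (a * H) * (b * e)); last by ring.
  by rewrite ler_piMr// !mulr_ge0.
by apply: key => //; rewrite ?powR_ge0 ?hk_ge0 ?invr_ge0 ?ltW.
Qed.

(** Cauchy-Schwarz in a form adapted to Gaussian exponents: distances add when the times do. *)
Lemma sqr_add_le (p q t s : R) : 0 < t -> 0 < s ->
  (p + q) ^+ 2 / (t + s) <= p ^+ 2 / t + q ^+ 2 / s.
Proof.
move=> t0 s0; have ts0 : 0 < t + s by rewrite addr_gt0.
rewrite -subr_ge0 (_ : _ - _ = (s * p - t * q) ^+ 2 / (t * s * (t + s))); last first.
  by field; rewrite !gt_eqF.
by rewrite divr_ge0 ?sqr_ge0// ltW// !mulr_gt0.
Qed.

Lemma sqd_add_le n (x y z : n.-tuple R) t s : 0 < t -> 0 < s ->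
  sqd x z / (t + s) <= sqd x y / t + sqd y z / s.
Proof.
move=> t0 s0; rewrite /sqd !mulr_suml -big_split/=; apply: ler_sum => i _.
rewrite (_ : tnth x i - tnth z i = (tnth x i - tnth y i) + (tnth y i - tnth z i)).
  exact: sqr_add_le.
by ring.
Qed.

(** Moving the centre from y to z is paid for by widening from t to t + s. The loss factor is close
    to 1 when s is small against t and large against |y-z|^2. *)
Lemma hk_translate_le n (x y z : n.-tuple R) t s : 0 < t -> 0 < s ->
  (t / (t + s)) `^ (n%:R / 2) * expR (- (sqd y z / (4 * s))) * hk x y t <=
  hk x z (t + s).
Proof.
move=> t0 s0; have ts0 : 0 < t + s by rewrite addr_gt0.
rewrite !hkE mulrACA -expRD.
have -> : (t / (t + s)) `^ (n%:R / 2) * (4 * pi * t) `^ (- (n%:R / 2)) =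
    (4 * pi * (t + s)) `^ (- (n%:R / 2)) :> R.
  rewrite (_ : 4 * pi * t = t / (t + s) * (4 * pi * (t + s))); last first.
    by field; rewrite gt_eqF.
  rewrite [X in _ * X = _]powRM ?divr_ge0// ?ltW ?pi4_gt0// mulrA.
  rewrite -powRD ?subrr ?powRr0 ?mul1r//.
  by rewrite (gt_eqF (divr_gt0 t0 ts0)) implybT.
rewrite ler_wpM2l ?powR_ge0// ler_expR mulNr -opprD mulNr lerN2.
have := sqd_add_le x y z t0 s0; rewrite !invfM.
set a := sqd x z; set b := sqd x y; set c := sqd y z; lra.
Qed.

(** Both densities dominate c p, so |p - q| <= p + q - 2 c p pointwise; the rest is the unit
    mass. *)
Lemma integral_dist_le n (p q : n.-tuple R -> R) (c : R) :
  measurable_fun [set: n.-tuple R] p -> measurable_fun [set: n.-tuple R] q ->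
  (forall x, 0 <= p x) -> (forall x, 0 <= q x) -> 0 <= c -> c <= 1 ->
  (\int[tuple_leb n]_x (p x)%:E = 1)%E -> (\int[tuple_leb n]_x (q x)%:E = 1)%E ->
  (forall x, c * p x <= q x) ->
  (\int[tuple_leb n]_x (`|p x - q x|)%:E <= (2 - 2 * c)%:E)%E.
Proof.
move=> mp mq p0 q0 c0 c1 ip iq cpq.
have mpq : measurable_fun [set: n.-tuple R] (fun x => `|p x - q x|).
  by apply: measurableT_comp => //; exact: measurable_funB.
rewrite EFinB leeBrDr// -[X in (_ + X <= _)%E]mule1 -ip -int0Z//; last by rewrite mulr_ge0.
rewrite -int0D//; [|exact: measurable_funM|by move=> x; rewrite !mulr_ge0].
rewrite (_ : 2%:E = 1 + 1)%E// -{1}ip -iq -int0D//; apply: le_int0.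
- by apply: measurable_funD => //; exact: measurable_funM.
- exact: measurable_funD.
- by move=> x; rewrite addr_ge0// !mulr_ge0.
- move=> x.
  have := cpq x; have := p0 x; have : c * p x <= p x by rewrite ler_piMl.
  by have [h|h] := leP 0 (p x - q x); [rewrite ger0_norm//|rewrite ltr0_norm//]; lra.
Qed.

Definition origin n : n.-tuple R := [tuple 0 | i < n].

Lemma hk_origin n (x : n.-tuple R) t : heat_kernel x t = hk x (origin n) t.
Proof.
by congr heat_kernel; apply: eq_from_tnth => i; rewrite !tnth_mktuple subr0.
Qed.

Lemma sqd_origin n (x : n.-tuple R) : sqd x (origin n) = enorm_t x ^+ 2.
Proof.
by rewrite sqr_enorm_t; apply: eq_bigr => i _; rewrite tnth_mktuple subr0.
Qed.

(* Bounds the L^1 distance between [G(. - y, t)] and [G(., 1 + t)]: both are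
   compared with the wider kernel [G(., t + sqrt t + 1)]. *)
Definition theta n (y : n.-tuple R) t : R :=
  4 - 4 * ((t / (t + (Num.sqrt t + 1))) `^ (n%:R / 2) *
           expR (- (sqd y (origin n) / (4 * (Num.sqrt t + 1))))).

Let thetac n (y : n.-tuple R) t : R := (t / (t + (Num.sqrt t + 1))) `^ (n%:R / 2) *
           expR (- (sqd y (origin n) / (4 * (Num.sqrt t + 1)))).

Let thetac_ge0 n (y : n.-tuple R) t : 0 <= thetac y t.
Proof. by rewrite mulr_ge0 ?powR_ge0 ?expR_ge0. Qed.

Let s1_gt0 t : 0 < Num.sqrt t + 1.
Proof. by rewrite ltr_wpDl// sqrtr_ge0. Qed.

Let powR1r (a : R) : 1 `^ a = 1 :> R.
Proof. by rewrite powR1. Qed.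

Let powR_inv (x a : R) : 0 < x -> x^-1 `^ a = (x `^ a)^-1.
Proof.
by move=> x0; rewrite -(powR_inv1 (ltW x0)) -powRrM mulN1r powRN.
Qed.

Let powR_le1 (x a : R) : 0 <= x -> x <= 1 -> 0 <= a -> x `^ a <= 1.
Proof.
by move=> x0 x1 a0; rewrite -(powR1r a) ge0_ler_powR// nnegrE.
Qed.

Let expRN_le1 (x : R) : 0 <= x -> expR (- x) <= 1.
Proof. by move=> x0; rewrite -expR0 ler_expR oppr_le0. Qed.

Let exparg_ge0 n (y : n.-tuple R) t : 0 <= sqd y (origin n) / (4 * (Num.sqrt t + 1)).
Proof. by rewrite divr_ge0 ?sqd_ge0// mulr_ge0// ltW. Qed.

Let thetac_le1 n (y : n.-tuple R) t : 0 < t -> thetac y t <= 1.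
Proof.
move=> t0; rewrite mulr_ile1 ?powR_ge0 ?expR_ge0 ?expRN_le1//.
have ts0 : 0 < t + (Num.sqrt t + 1) by rewrite addr_gt0.
by rewrite powR_le1 ?divr_ge0 ?(ltW t0) ?(ltW ts0)// ler_pdivrMr// mul1r lerDl ltW.
Qed.

Lemma theta_ge0 n (y : n.-tuple R) t : 0 < t -> 0 <= theta y t.
Proof. by move=> t0; have := thetac_le1 y t0; rewrite /theta -/(thetac y t); lra. Qed.

Lemma theta_le n (y : n.-tuple R) t : theta y t <= 4.
Proof. by have := thetac_ge0 y t; rewrite /theta -/(thetac y t); lra. Qed.

(** The increment s = sqrt t + 1 tends to infinity, which makes the shift by y harmless, has s/t ->
    0, which makes the widening harmless, and satisfies s >= 1, so that G(., t + s) is at least as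
    wide as G(., 1 + t). *)
Lemma integral_hk_diff n (y : n.-tuple R) t : 0 < t ->
  (\int[tuple_leb n]_x (`|hk x y t - hk x (origin n) (1 + t)|)%:E <= (theta y t)%:E)%E.
Proof.
move=> t0; have t1 : 0 < 1 + t by rewrite addr_gt0.
set s := Num.sqrt t + 1; have s0 : 0 < s by exact: s1_gt0.
have ts0 : 0 < t + s by rewrite addr_gt0.
set T := t + s; have mk (z : n.-tuple R) (r : R) :
  measurable_fun [set: n.-tuple R] (fun x => hk x z r) by exact: measurable_hk.
have mn (z w : n.-tuple R) (r q : R) :
  measurable_fun [set: n.-tuple R] (fun x => `|hk x z r - hk x w q|).
  by apply: measurableT_comp => //; exact: measurable_funB.
have h1 : (\int[tuple_leb n]_x (`|hk x y t - hk x (origin n) T|)%:E <=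
    (2 - 2 * thetac y t)%:E)%E.
  apply: integral_dist_le => //; rewrite ?integral_hk//.
  - by move=> x; exact: hk_ge0.
  - by move=> x; exact: hk_ge0.
  - exact: thetac_le1.
  - by move=> x; exact: hk_translate_le.
have h2 : (\int[tuple_leb n]_x (`|hk x (origin n) (1 + t) - hk x (origin n) T|)%:E <=
    (2 - 2 * thetac y t)%:E)%E.
  apply: integral_dist_le => //; rewrite ?integral_hk//.
  - by move=> x; exact: hk_ge0.
  - by move=> x; exact: hk_ge0.
  - exact: thetac_le1.
  (* Both kernels are centred at the origin, so only the widening costs: the prefactor ratio
     ((1+t)/T)^(n/2) is at least (t/T)^(n/2), hence at least [thetac y t]. *)
  - move=> x.
    have T1 : 1 + t <= T by rewrite /T /s addrC lerD2l lerDr sqrtr_ge0.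
    have := hk_le_wider x (origin n) t1 T1.
    have r0 : 0 < T / (1 + t) by rewrite divr_gt0.
    rewrite -ler_pdivrMl ?powR_gt0//; apply: le_trans.
    rewrite ler_wpM2r ?hk_ge0// -powRN.
    rewrite (@le_trans _ _ ((t / T) `^ (n%:R / 2)))//.
      by rewrite ler_piMr ?powR_ge0// expRN_le1.
    rewrite powRN -powR_inv// invf_div.
    by rewrite ge0_ler_powR ?nnegrE ?divr_ge0 ?(ltW t0) ?(ltW t1) ?(ltW ts0)// ler_pM2r ?invr_gt0// lerDr.
apply: (@le_trans _ _ (\int[tuple_leb n]_x (`|hk x y t - hk x (origin n) T| +
   `|hk x (origin n) (1 + t) - hk x (origin n) T|)%:E)%E).
  apply: le_int0 => //; first exact: measurable_funD.
  by move=> x; rewrite [X in _ <= _ + X]distrC; exact: ler_distD.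
rewrite int0D// (le_trans (leeD h1 h2))// -EFinD lee_fin /theta -/(thetac y t); lra.
Qed.

(** Both kernels are convolutions with the same G(., t/2), by t = t/2 + t/2 and 1 + t = t/2 + (1 +
    t/2). The supremum of that common factor, of order t^(-n/2), multiplies the L^1 distance of the
    other factors, which is at most [theta y (t / 2)]. *)
Lemma hk_diff_le n (x y : n.-tuple R) t : 0 < t ->
  t `^ (n%:R / 2) * `|hk x y t - hk x (origin n) (1 + t)| <= theta y (t / 2).
Proof.
move=> t0; set h := t / 2; have h0 : 0 < h by rewrite divr_gt0.
set M : R := (4 * pi * h) `^ (- (n%:R / 2)).
have tM : t `^ (n%:R / 2) * M <= 1.
  rewrite /M (_ : 4 * pi * h = (2 * pi) * t); last by rewrite /h; field.
  rewrite powRM ?mulr_ge0 ?pi_ge0 ?(ltW t0)// mulrCA -powRD ?subrr ?powRr0 ?mulr1; last first.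
    by rewrite (gt_eqF t0) implybT.
  rewrite powRN invf_le1; last by rewrite powR_gt0// mulr_gt0// pi_gt0.
  rewrite -[leLHS](powR1r (n%:R / 2)) ge0_ler_powR ?nnegrE ?mulr_ge0 ?pi_ge0//.
  by have := @pi_ge2 R; lra.
have mk (z : n.-tuple R) (r : R) :
  measurable_fun [set: n.-tuple R] (fun x => hk x z r) by exact: measurable_hk.
have mk' (z : n.-tuple R) (r : R) :
  measurable_fun [set: n.-tuple R] (fun x => hk z x r) by exact: measurable_hk.
have mn (z w : n.-tuple R) (r q : R) :
  measurable_fun [set: n.-tuple R] (fun x => `|hk x z r - hk x w q|).
  by apply: measurableT_comp => //; exact: measurable_funB.
have M0 : 0 <= M by exact: powR_ge0.
(* A one-sided bound with additive error: it applies with the two kernels in either order and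
   involves nonnegative integrals only. *)
have key (u v : n.-tuple R) (a b : R) : 0 < a -> 0 < b ->
    (\int[tuple_leb n]_z (`|hk z u a - hk z v b|)%:E <= (theta y h)%:E)%E ->
    hk x u (h + a) <= hk x v (h + b) + M * theta y h.
  move=> a0 b0 ab; rewrite -lee_fin EFinD -!integral_hkM//.
  apply: (@le_trans _ _ (\int[tuple_leb n]_z (hk x z h * hk z v b +
      M * `|hk z u a - hk z v b|)%:E)%E).
    apply: le_int0 => //.
    - exact: measurable_funM.
    - by apply: measurable_funD; apply: measurable_funM.
    - by move=> z; rewrite mulr_ge0 ?hk_ge0.
    - move=> z; rewrite -lerBlDl -mulrBr (le_trans (ler_norm _))// normrM ger0_norm ?hk_ge0//.
      by rewrite ler_wpM2r// hk_le.
  rewrite int0D//.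
  - rewrite leeD2l// int0Z// EFinM lee_wpmul2l// lee_fin//.
  - exact: measurable_funM.
  - exact: measurable_funM.
  - by move=> z; rewrite mulr_ge0 ?hk_ge0.
  - by move=> z; rewrite mulr_ge0.
have hh : h + h = t by rewrite /h; field.
have hh1 : h + (1 + h) = 1 + t by rewrite addrCA hh.
have d : `|hk x y t - hk x (origin n) (1 + t)| <= M * theta y h.
  have k1 := key y (origin n) h (1 + h) h0 (addr_gt0 ltr01 h0) (integral_hk_diff y h0).
  have k2 : hk x (origin n) (h + (1 + h)) <= hk x y (h + h) + M * theta y h.
    apply: key => //; first by rewrite addr_gt0.
    by under eq_integral do rewrite distrC; exact: integral_hk_diff.
  rewrite hh hh1 in k1 k2; rewrite ler_norml; apply/andP; split; lra.
apply: (le_trans (ler_wpM2l _ d)); first exact: powR_ge0.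
by rewrite mulrA ler_piMl ?theta_ge0.
Qed.

Lemma powR_expRN_bounded (b : R) : 0 <= b ->
  exists C, forall y : R, 0 <= y -> (1 + y) `^ b * expR (- (y / 16)) <= C.
Proof.
(* The bound 1 + z <= e^z at z = (1+y)/c is raised to the power b; the choice of c keeps b/c <=
   1/16, the decay rate available. *)
move=> b0; pose c := 16 * (b + 1); have c0 : 0 < c by rewrite mulr_gt0// ltr_wpDl.
exists (c `^ b * expR (16^-1)) => y y0; have y1 : 0 <= 1 + y by rewrite addr_ge0.
have h : 1 + y <= c * expR ((1 + y) / c).
  rewrite -ler_pdivrMl// mulrC (le_trans _ (expR_ge1Dx _))// lerDr//.
have h1 : (1 + y) `^ b <= c `^ b * expR ((1 + y) / 16).
  have ce0 : 0 <= c * expR ((1 + y) / c) by rewrite mulr_ge0 ?expR_ge0// ltW.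
  apply: (@le_trans _ _ ((c * expR ((1 + y) / c)) `^ b)).
    by apply: ge0_ler_powR; rewrite ?nnegrE.
  rewrite powRM ?expR_ge0// ?(ltW c0)// ler_wpM2l ?powR_ge0// -expRM ler_expR.
  rewrite -mulrA ler_wpM2l// /c invfM -mulrA ler_piMr// mulrC.
  by rewrite ler_pdivrMr ?ltr_wpDl// mul1r lerDl.
apply: (le_trans (ler_wpM2r _ h1)); first exact: expR_ge0.
rewrite -mulrA -expRD ler_wpM2l ?powR_ge0// ler_expR; lra.
Qed.

(** From |x|^2 <= 2|x-y|^2 + 2|y|^2. The factor 1 + t trades |x-y|^2 for the parabolically scaled
    |x-y|^2/t, which a Gaussian can absorb. *)
Lemma sqr_1enorm_le n (x y : n.-tuple R) t : 0 < t ->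
  (1 + enorm_t x) ^+ 2 <= 4 * (1 + t) * (1 + sqd x y / t) * (1 + enorm_t y) ^+ 2.
Proof.
move=> t0; set a := enorm_t x; set b := enorm_t y; set D := sqd x y.
have a0 : 0 <= a by exact: enorm_t_ge0.
have b0 : 0 <= b by exact: enorm_t_ge0.
have D0 : 0 <= D by exact: sqd_ge0.
have h : a ^+ 2 / 2 <= D + b ^+ 2.
  have := @sqd_add_le n x y (origin n) 1 1 ltr01 ltr01.
  by rewrite !sqd_origin !divr1.
have h1 : 1 + D <= (1 + t) * (1 + D / t).
  rewrite (_ : _ * _ = 1 + D + (t + D / t)); last by field; rewrite gt_eqF.
  by rewrite lerDl addr_ge0 ?divr_ge0// (ltW t0).
have h2 : (1 + a) ^+ 2 <= 4 * (1 + D) * (1 + b) ^+ 2.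
  have : 0 <= D * b by rewrite mulr_ge0.
  have : 0 <= D * b ^+ 2 by rewrite mulr_ge0// sqr_ge0.
  have : 0 <= (a - 1) ^+ 2 by exact: sqr_ge0.
  nra.
apply: (le_trans h2); rewrite ler_wpM2r ?sqr_ge0// -mulrA ler_wpM2l//.
Qed.

(** The weight moves from x to y. A further doubling of time, from 2t to 4t, frees a factor
    exp(-|x-y|^2/(16t)) that absorbs the polynomial growth in |x-y|^2/t. *)
Lemma weighted_hk_le n (l : R) : 0 <= l -> exists C, 0 <= C /\
  forall (x y : n.-tuple R) t, 0 < t ->
  (1 + enorm_t x) `^ l * hk x y (2 * t) <=
  C * (1 + t) `^ (l / 2) * ((1 + enorm_t y) `^ l * hk x y (4 * t)).
Proof.
move=> l0; have l20 : 0 <= l / 2 by rewrite divr_ge0.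
have [B HB] := powR_expRN_bounded l20.
exists (4 `^ (l / 2) * (2 `^ (n%:R / 2) * `|B|)); split.
  by rewrite !mulr_ge0 ?powR_ge0.
move=> x y t t0.
set D := sqd x y / t; have D0 : 0 <= D by rewrite divr_ge0 ?sqd_ge0// ltW.
have e1 (z : n.-tuple R) : 0 <= 1 + enorm_t z by rewrite addr_ge0 ?enorm_t_ge0.
have sqE (a : R) : 0 <= a -> a `^ l = (a ^+ 2) `^ (l / 2).
  by move=> a0; rewrite -powR_mulrn// -powRrM mulrC divfK// pnatr_eq0.
have t1 : 0 <= 1 + t by rewrite addr_ge0// ltW.
have D1 : 0 <= 1 + D by rewrite addr_ge0.
have h : (1 + enorm_t x) `^ l <=
    4 `^ (l / 2) * (1 + t) `^ (l / 2) * (1 + D) `^ (l / 2) * (1 + enorm_t y) `^ l.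
  rewrite !sqE// -!powRM ?mulr_ge0 ?sqr_ge0//.
  by apply: (ge0_ler_powR l20); rewrite ?nnegrE ?mulr_ge0 ?sqr_ge0//; exact: sqr_1enorm_le.
have t2 : 0 < 2 * t by rewrite mulr_gt0.
rewrite (hk_double _ _ t2).
have -> : 2 * (2 * t) = 4 * t by ring.
have -> : sqd x y / (8 * (2 * t)) = D / 16.
  by rewrite /D; field; rewrite gt_eqF.
have hB : (1 + D) `^ (l / 2) * expR (- (D / 16)) <= `|B|.
  by rewrite (le_trans (HB _ D0))// ler_norm.
apply: (le_trans (ler_wpM2r _ h)); first by rewrite !mulr_ge0 ?powR_ge0 ?expR_ge0 ?hk_ge0.
set p := 4 `^ _; set q := (1 + t) `^ _; set r := (1 + D) `^ _ in hB *.
set w := (1 + enorm_t y) `^ l; set m := 2 `^ _; set e := expR _ in hB *; set H := hk _ _ _.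
have -> : p * q * r * w * (m * e * H) = (p * q * w * m * H) * (r * e) by ring.
have -> : p * (m * `|B|) * q * (w * H) = (p * q * w * m * H) * `|B| by ring.
by apply: ler_wpM2l => //; rewrite !mulr_ge0 ?powR_ge0 ?hk_ge0.
Qed.

End kernel_bounds.

(** * Convergence of integrals *)

Section dominated.
Context d (T : measurableType d) (R : realType) (mu : {measure set T -> \bar R}).
Implicit Types f g : T -> R.

Lemma integrable_le f g : measurable_fun [set: T] f -> measurable_fun [set: T] g ->
  (forall x, `|f x| <= g x) -> (\int[mu]_x (g x)%:E < +oo)%E ->
  mu.-integrable [set: T] (EFin \o f).
Proof.
move=> mf mg fg goo; apply/integrableP; split; first exact/measurable_EFinP.
apply: le_lt_trans goo; apply: (@le_int0 _ _ _ mu (fun x => `|f x|)) => //.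
exact: measurableT_comp.
Qed.

Lemma norm_fine_integral_le f g : measurable_fun [set: T] f -> measurable_fun [set: T] g ->
  (forall x, `|f x| <= g x) -> (\int[mu]_x (g x)%:E < +oo)%E ->
  (`|fine (\int[mu]_x (f x)%:E)|%:E <= \int[mu]_x (g x)%:E)%E.
Proof.
move=> mf mg fg goo.
have fi := integrable_le mf mg fg goo.
have ffin := integrable_fin_num measurableT fi.
rewrite -fine_abse// fineK ?abse_fin_num//.
apply: le_trans (le_abse_integral _ _ _) _ => //; first exact/measurable_EFinP.
by apply: (@le_int0 _ _ _ mu (fun x => `|f x|)) => //; exact: measurableT_comp.
Qed.

Lemma fine_integralB f g : mu.-integrable [set: T] (EFin \o f) ->
  mu.-integrable [set: T] (EFin \o g) ->
  fine (\int[mu]_x (f x - g x)%:E) =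
  fine (\int[mu]_x (f x)%:E) - fine (\int[mu]_x (g x)%:E).
Proof.
move=> fi gi; under eq_integral do rewrite EFinB.
rewrite (integralB measurableT fi gi) fineB//; exact: (integrable_fin_num measurableT).
Qed.

Lemma dct0 (f_ : nat -> T -> R) g :
  (forall k, measurable_fun [set: T] (f_ k)) -> measurable_fun [set: T] g ->
  (forall k x, 0 <= f_ k x <= g x) -> (\int[mu]_x (g x)%:E < +oo)%E ->
  {ae mu, forall x, f_ ^~ x @ \oo --> 0} ->
  (\int[mu]_x (f_ k x)%:E @[k --> \oo] --> 0)%E.
Proof.
move=> mf mg fg goo f0.
have gi : mu.-integrable [set: T] (EFin \o g).
  apply: (integrable_le mg mg) => // x.
  by rewrite ger0_norm//; have /andP[a b] := fg 0 x; exact: le_trans b.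
have f0' : {ae mu, forall x, setT x -> (f_ k x)%:E @[k --> \oo] --> (cst 0%E x : \bar R)}.
  by apply: filterS f0 => x h _; apply/cvg_EFin; [exact: nearW|exact: h].
have fg' : {ae mu, forall x k, setT x -> (`|(f_ k x)%:E| <= (EFin \o g) x)%E}.
  by apply: aeW => /= x k _; rewrite lee_fin; have /andP[a b] := fg k x; rewrite ger0_norm.
have [_ _] := dominated_convergence measurableT
  (fun k => (measurable_EFinP _ _).2 (mf k)) (measurable_cst _) f0' gi fg'.
by rewrite integral0.
Qed.

Lemma dct (f_ : nat -> T -> R) f g :
  (forall k, measurable_fun [set: T] (f_ k)) -> measurable_fun [set: T] f ->
  measurable_fun [set: T] g ->
  (forall k x, `|f_ k x| <= g x) -> (\int[mu]_x (g x)%:E < +oo)%E ->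
  {ae mu, forall x, f_ ^~ x @ \oo --> f x} ->
  fine (\int[mu]_x (f_ k x)%:E) @[k --> \oo] --> fine (\int[mu]_x (f x)%:E).
Proof.
move=> mf_ mf mg fg goo f0.
have gi : mu.-integrable [set: T] (EFin \o g).
  apply: (integrable_le mg mg) => // x.
  by rewrite ger0_norm// (le_trans _ (fg 0 x)).
have f0' : {ae mu, forall x, setT x -> (f_ k x)%:E @[k --> \oo] --> ((EFin \o f) x : \bar R)}.
  by apply: filterS f0 => x h _; apply/cvg_EFin; [exact: nearW|exact: h].
have fg' : {ae mu, forall x k, setT x -> (`|(f_ k x)%:E| <= (EFin \o g) x)%E}.
  by apply: aeW => /= x k _; rewrite lee_fin; exact: fg.
have [fi _ h] := dominated_convergence measurableT
  (fun k => (measurable_EFinP _ _).2 (mf_ k)) ((measurable_EFinP _ _).2 mf) f0' gi fg'.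
by apply: fine_cvg; rewrite fineK //; exact: (integrable_fin_num measurableT fi).
Qed.

(** Dominated convergence with a varying majorant, needed because the singularity at s = t_k moves
    with k. Below 2g the plain theorem applies to [r_]; the excess of d_k over 2g is at most (g_k -
    g)^+, whose integral tends to 0 by Scheffé's argument, since (g - g_k)^+ <= g. *)
Lemma gdct0 (d_ g_ : nat -> T -> R) g :
  (forall k, measurable_fun [set: T] (d_ k)) -> (forall k, measurable_fun [set: T] (g_ k)) ->
  measurable_fun [set: T] g ->
  (forall k x, 0 <= d_ k x <= g_ k x + g x) -> (forall k x, 0 <= g_ k x) -> (forall x, 0 <= g x) ->
  (\int[mu]_x (g x)%:E < +oo)%E -> (forall k, (\int[mu]_x (g_ k x)%:E < +oo)%E) ->
  {ae mu, forall x, d_ ^~ x @ \oo --> 0} ->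
  {ae mu, forall x, g_ ^~ x @ \oo --> g x} ->
  fine (\int[mu]_x (g_ k x)%:E) @[k --> \oo] --> fine (\int[mu]_x (g x)%:E) ->
  fine (\int[mu]_x (d_ k x)%:E) @[k --> \oo] --> 0.
Proof.
move=> md mg_ mg dg g_0 g0 goo g_oo d0 g_g ig.
pose p_ k x := Num.max (g x - g_ k x) 0; pose q_ k x := Num.max (g_ k x - g x) 0.
pose r_ k x := Num.min (d_ k x) (2 * g x).
have mp k : measurable_fun [set: T] (p_ k).
  by apply: measurable_maxr => //; exact: measurable_funB.
have mq k : measurable_fun [set: T] (q_ k).
  by apply: measurable_maxr => //; exact: measurable_funB.
have mr k : measurable_fun [set: T] (r_ k).
  by apply: measurable_minr => //; exact: measurable_funM.
have p0 k x : 0 <= p_ k x by rewrite le_max lexx orbT.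
have q0 k x : 0 <= q_ k x by rewrite le_max lexx orbT.
have dk0 k x : 0 <= d_ k x by case/andP: (dg k x).
have r0 k x : 0 <= r_ k x by rewrite le_min dk0 mulr_ge0.
have ip : (\int[mu]_x (p_ k x)%:E @[k --> \oo] --> 0)%E.
  apply: (@dct0 p_ g) => //.
  - by move=> k x; rewrite p0/= ge_max g0 andbT lerBlDr lerDl.
  - apply: filterS g_g => x h; have h' : `|g x - g_ k x| @[k --> \oo] --> 0.
      rewrite [X in _ --> X](_ : 0 = `|g x - g x|); last by rewrite subrr normr0.
      by apply: cvg_norm; apply: cvgB => //; exact: cvg_cst.
    apply: (squeeze_cvgr _ (cvg_cst 0) h'); apply: nearW => k.
    by rewrite p0/= ge_max ler_norm normr_ge0.
have ir : (\int[mu]_x (r_ k x)%:E @[k --> \oo] --> 0)%E.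
  apply: (@dct0 r_ (fun x => 2 * g x)) => //.
  - exact: measurable_funM.
  - by move=> k x; rewrite r0/= ge_min lexx orbT.
  - by rewrite int0Z// lte_mul_pinfty.
  - apply: filterS d0 => x h; apply: (squeeze_cvgr _ (cvg_cst 0) h); apply: nearW => k.
    by rewrite r0/= ge_min lexx.
have qE k : (\int[mu]_x (q_ k x)%:E + \int[mu]_x (g x)%:E =
             \int[mu]_x (g_ k x)%:E + \int[mu]_x (p_ k x)%:E)%E.
  rewrite -!int0D//; apply: eq_integral => x _; congr EFin; rewrite /q_ /p_.
  case: (leP (g x) (g_ k x)) => h.
    by rewrite (max_idPl _) ?subr_ge0// (max_idPr _) ?subr_le0// subrK addr0.
  by rewrite (max_idPr _) ?subr_le0 ?ltW// (max_idPl _) ?subr_ge0 ?ltW// add0r addrC subrK.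
have fin f : (forall x, 0 <= f x) -> (\int[mu]_x (f x)%:E < +oo)%E ->
    (\int[mu]_x (f x)%:E)%E \is a fin_num.
  by move=> f0 foo; rewrite ge0_fin_numE// int0_ge0.
have poo k : (\int[mu]_x (p_ k x)%:E < +oo)%E.
  apply: le_lt_trans goo; apply: le_int0 => // x.
  by rewrite ge_max g0 andbT lerBlDr lerDl.
have qoo k : (\int[mu]_x (q_ k x)%:E < +oo)%E.
  apply: le_lt_trans (g_oo k); apply: le_int0 => // x.
  by rewrite ge_max g_0 andbT lerBlDr lerDl.
have roo k : (\int[mu]_x (r_ k x)%:E < +oo)%E.
  apply: (@le_lt_trans _ _ (\int[mu]_x (2 * g x)%:E)%E).
    apply: le_int0 => //; first exact: measurable_funM.
    by move=> x; rewrite ge_min lexx orbT.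
  by rewrite int0Z// lte_mul_pinfty.
have iq : fine (\int[mu]_x (q_ k x)%:E) @[k --> \oo] --> 0.
  have -> : (fun k => fine (\int[mu]_x (q_ k x)%:E)) =
     (fun k => fine (\int[mu]_x (g_ k x)%:E) + fine (\int[mu]_x (p_ k x)%:E) -
        fine (\int[mu]_x (g x)%:E)).
    apply/funext => k; have := congr1 fine (qE k).
    rewrite (fineD (fin _ (q0 k) (qoo k)) (fin _ g0 goo)).
    rewrite (fineD (fin _ (g_0 k) (g_oo k)) (fin _ (p0 k) (poo k))) => <-.
    by rewrite addrK.
  rewrite [X in _ --> X](_ : 0 = fine (\int[mu]_x (g x)%:E) + 0 - fine (\int[mu]_x (g x)%:E)).
    by apply: cvgB; [apply: cvgD => //; exact: fine_cvg ip|exact: cvg_cst].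
  by rewrite addr0 subrr.
apply: (@squeeze_cvgr _ _ _ _ (cst 0) (fun k => fine (\int[mu]_x (r_ k x)%:E) +
   fine (\int[mu]_x (q_ k x)%:E))).
- apply: nearW => k; rewrite fine_ge0 ?int0_ge0//=.
  have le : (\int[mu]_x (d_ k x)%:E <= \int[mu]_x (r_ k x)%:E + \int[mu]_x (q_ k x)%:E)%E.
    rewrite -int0D//; apply: le_int0 => //; first exact: measurable_funD.
    move=> x; rewrite /r_ /q_; have /andP[_] := dg k x.
    case: (leP (d_ k x) (2 * g x)) => h1.
      by rewrite lerDl q0.
    case: (leP (g_ k x - g x) 0); lra.
  rewrite -(fineD (fin _ (r0 k) (roo k)) (fin _ (q0 k) (qoo k))).
  have rqoo := lte_add_pinfty (roo k) (qoo k).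
  apply: fine_le => //; first by apply: fin => //; exact: (le_lt_trans le rqoo).
  by rewrite fin_numD !fin.
- exact: cvg_cst.
- rewrite [X in _ --> X](_ : 0 = 0 + 0); last by rewrite addr0.
  by apply: cvgD => //; exact: fine_cvg ir.
Qed.

End dominated.

(** * Measurability of integrals depending on a parameter *)

Section param_integral.
Context d1 d2 (T1 : measurableType d1) (T2 : measurableType d2) (R : realType).
Variable m2 : {sigma_finite_measure set T2 -> \bar R}.

(** No integrability is assumed: Tonelli is applied to the positive and negative parts
    separately. *)
Lemma measurable_param_integral (f : T1 -> T2 -> R) :
  measurable_fun [set: T1 * T2] (fun z => f z.1 z.2) ->
  measurable_fun [set: T1] (fun x => fine (\int[m2]_y (f x y)%:E)).
Proof.
move=> mf; pose g (z : T1 * T2) := (f z.1 z.2)%:E.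
have mg : measurable_fun [set: T1 * T2] g by exact/measurable_EFinP.
apply: measurableT_comp; first exact: fine_measurable.
under eq_fun do rewrite integralE.
apply: emeasurable_funB.
  have h := measurable_fun_fubini_tonelli_F (m2 := m2) _ (measurable_funepos mg)
    (fun z => funepos_ge0 g z).
  apply: eq_measurable_fun h => x _; rewrite /fubini_F.
  by apply: eq_integral => y _; rewrite !funeposE.
have h := measurable_fun_fubini_tonelli_F (m2 := m2) _ (measurable_funeneg mg)
  (fun z => funeneg_ge0 g z).
apply: eq_measurable_fun h => x _; rewrite /fubini_F.
by apply: eq_integral => y _; rewrite !funenegE.
Qed.

End param_integral.

(** * A singular Volterra inequality *)

Section time_integrals.
Context {R : realType}.
Notation leb := (@lebesgue_measure R).
Implicit Types (a b t : R) (f F : R -> R).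

(** The integrand may blow up at the endpoints: the fundamental theorem is used on compact
    subintervals, then monotone convergence. *)
Lemma ge0_continuous_FTC2oo f F a b : a < b ->
  (forall x, a < x < b -> 0 <= f x) -> (forall x, a < x < b -> {for x, continuous f}) ->
  (forall x : R, a < x < b -> derivable F x 1 /\ 'D_1 F x = f x) -> continuous F ->
  (\int[leb]_(x in `]a, b[) (f x)%:E = (F b - F a)%:E)%E.
Proof.
move=> ab f0 cf dF cF.
(* The denominator n + 3 ensures 2 e_n < b - a already for n = 0, so every subinterval is
   nondegenerate. *)
pose e n : R := (b - a) / n.+3%:R.
have ba0 : 0 < b - a by rewrite subr_gt0.
have e0 n : 0 < e n by rewrite divr_gt0.
have e_lt n : e n *+ 2 < b - a.
  by rewrite -mulr_natr mulrAC -mulrA gtr_pMr// ltr_pdivrMr// mul1r ltr_nat.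
have en n : a + e n < b - e n by rewrite ltrBrDr -addrA -ltrBrDl -mulr2n.
pose D n := `[a + e n, b - e n]%classic : set R.
have Dab n x : D n x -> a < x < b.
  rewrite /D/= in_itv/= => /andP[h1 h2]; apply/andP; split.
    by apply: lt_le_trans h1; rewrite ltrDl.
  by apply: (le_lt_trans h2); rewrite ltrBlDr ltrDl.
have e_cvg : e n @[n --> \oo] --> 0.
  rewrite [X in _ --> X](_ : 0 = (b - a) * 0); last by rewrite mulr0.
  apply: cvgM; first exact: cvg_cst.
  rewrite (cvg_shiftS (fun n => n.+2%:R^-1 : R)) (cvg_shiftS (fun n => n.+1%:R^-1 : R)).
  exact: cvg_harmonic.
have UD : \bigcup_n D n = `]a, b[%classic.
  apply/seteqP; split => [x [n _ /Dab]|x /=]; first by rewrite /= in_itv.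
  rewrite in_itv/= => /andP[ax xb].
  have m0 : 0 < Num.min (x - a) (b - x) by rewrite lt_min !subr_gt0 ax.
  have [n _ /(_ _ (leqnn _))] := cvgr0_norm_lt _ e_cvg _ m0.
  rewrite gtr0_norm// lt_min => /andP[h1 h2]; exists n => //.
  rewrite /D/= in_itv/=; apply/andP; split; lra.
have cfD n : {within D n, continuous f}.
  by apply: continuous_in_subspaceT => x; rewrite inE => /Dab; exact: cf.
have mf n : measurable_fun (D n) (EFin \o f).
  by apply/measurable_EFinP; apply: subspace_continuous_measurable_fun; [exact: measurable_itv|exact: cfD].
have e_noninc m n : (m <= n)%N -> e n <= e m.
  by move=> mn; rewrite ler_pM2l// lef_pV2 ?posrE// ler_nat !ltnS.
have ndD : nondecreasing_seq D.
  move=> m n mn; apply/subsetPset => x; rewrite /D/= !in_itv/= => /andP[h1 h2].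
  have := e_noninc _ _ mn; move=> h; apply/andP; split; lra.
have FD n : (\int[leb]_(x in D n) (f x)%:E = (F (b - e n) - F (a + e n))%:E)%E.
  rewrite EFinB; apply: continuous_FTC2 => //.
  - exact: cfD.
  - split.
    + move=> x; rewrite in_itv/= => /andP[h1 h2].
      have xab : a < x < b by have := e0 n; move=> h; apply/andP; split; lra.
      by have [] := dF x xab.
    + by apply: cvg_at_right_filter; exact: cF.
    + by apply: cvg_at_left_filter; exact: cF.
  - move=> x; rewrite in_itv/= => /andP[h1 h2].
    have xab : a < x < b by have := e0 n; move=> h; apply/andP; split; lra.
    by rewrite derive1E; have [_ ->] := dF x xab.
have h1 : (\int[leb]_(x in D n) (f x)%:E @[n --> \oo] --> \int[leb]_(x in `]a, b[) (f x)%:E)%E.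
  rewrite -UD; apply: ge0_nondecreasing_set_cvg_integral => //.
  - by move=> n; exact: measurable_itv.
  - by move=> n x /Dab xab; rewrite lee_fin f0.
have h2 : (\int[leb]_(x in D n) (f x)%:E @[n --> \oo] --> (F b - F a)%:E)%E.
  under eq_fun do rewrite FD.
  apply/cvg_EFin; first exact: nearW.
  apply: cvgB.
  - apply: (cvg_comp _ F); last exact: cF.
    have h : b - e n @[n --> \oo] --> b - 0 by apply: cvgB => //; exact: cvg_cst.
    by rewrite subr0 in h; exact: h.
  - apply: (cvg_comp _ F); last exact: cF.
    have h : a + e n @[n --> \oo] --> a + 0 by apply: cvgD => //; exact: cvg_cst.
    by rewrite addr0 in h; exact: h.
exact: (cvg_unique _ h1 h2).
Qed.

(** A real-valued indicator of the open interval keeps all time integrals on the whole line and is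
    jointly measurable in the endpoints, which later vary. *)
Definition ind a b (s : R) : R := if a < s < b then 1 else 0.

Lemma ind1 a b s : a < s -> s < b -> ind a b s = 1.
Proof. by rewrite /ind => -> ->. Qed.

Lemma ind0 a b s : b <= s -> ind a b s = 0.
Proof. by rewrite /ind leNgt => /negbTE ->; rewrite andbF. Qed.

Lemma ind_ge0 a b s : 0 <= ind a b s.
Proof. by rewrite /ind; case: ifP. Qed.

Lemma ind_le1 a b s : ind a b s <= 1.
Proof. by rewrite /ind; case: ifP. Qed.

Lemma measurable_ind d (T : measurableType d) (x y z : T -> R) :
  measurable_fun [set: T] x -> measurable_fun [set: T] y -> measurable_fun [set: T] z ->
  measurable_fun [set: T] (fun w => ind (x w) (y w) (z w)).
Proof.
move=> mx my mz; apply: measurable_fun_ifT; [|exact: measurable_cst|exact: measurable_cst].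
by apply: measurable_and; exact: measurable_fun_ltr.
Qed.

Definition isqrt t : R := (Num.sqrt t)^-1.

Lemma isqrt_ge0 t : 0 <= isqrt t.
Proof. by rewrite invr_ge0 sqrtr_ge0. Qed.

Lemma isqrt_le0 t : t <= 0 -> isqrt t = 0.
Proof. by move=> t0; rewrite /isqrt ler0_sqrtr// invr0. Qed.

Lemma measurable_isqrt : measurable_fun [set: R] isqrt.
Proof.
apply: (measurableT_comp measurable_invr).
by apply: continuous_measurable_fun; exact: sqrt_continuous.
Qed.

Lemma integral_ind a b f : (\int[leb]_s (ind a b s * f s)%:E =
  \int[leb]_(s in `]a, b[) (f s)%:E)%E.
Proof.
rewrite [RHS]integral_mkcond; apply: eq_integral => s _.
rewrite patchE; case: ifPn => [|].
  by rewrite inE/= in_itv/= /ind => ->; rewrite mul1r.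
by rewrite notin_setE/= in_itv/= /ind => /negP/negbTE ->; rewrite mul0r.
Qed.

Lemma continuous_isqrt t : 0 < t -> {for t, continuous isqrt}.
Proof.
move=> t0; apply: (cvg_comp Num.sqrt (fun x => x^-1)); first exact: sqrt_continuous.
by apply: inv_continuous; rewrite gt_eqF// sqrtr_gt0.
Qed.

Lemma integral_isqrt a t : a <= t ->
  (\int[leb]_s (ind a t s * isqrt (t - s))%:E = (2 * Num.sqrt (t - a))%:E)%E.
Proof.
rewrite le_eqVlt => /orP[/eqP ->|at0].
  rewrite integral_ind set_itvoo0 ?integral_set0 ?subrr ?sqrtr0 ?mulr0//.
rewrite integral_ind (@ge0_continuous_FTC2oo _ (fun s => - (2 * Num.sqrt (t - s))))//.
- by rewrite subrr sqrtr0 mulr0 oppr0 add0r opprK.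
- by move=> s _; exact: isqrt_ge0.
- move=> s /andP[_ st].
  apply: (cvg_comp (fun s => t - s) isqrt); last by apply: continuous_isqrt; rewrite subr_gt0.
  by apply: cvgB; [exact: cvg_cst|exact: cvg_id].
- move=> s /andP[_ st]; have ts : 0 < t - s by rewrite subr_gt0.
  have h1 : is_derive (t - s) 1 Num.sqrt (2 * Num.sqrt (t - s))^-1 by exact: is_derive1_sqrt.
  have h2 : is_derive s 1 (fun s : R => t - s) (- 1).
    by rewrite -[X in is_derive _ _ _ X]add0r; apply: is_deriveB.
  have h3 := @is_derive1_comp _ Num.sqrt (fun s : R => t - s) s _ _ h1 h2.
  have h4 := @is_deriveZ _ _ _ _ (-2) s 1 _ h3.
  rewrite (_ : (fun _ => _) = -2 \*: (Num.sqrt \o (fun s : R => t - s))); last first.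
    by apply/funext => z /=; rewrite -mulNr.
  split; first exact: ex_derive.
  rewrite derive_val /isqrt /GRing.scale/=; field.
  by rewrite gt_eqF// sqrtr_gt0.
- move=> s; apply: cvgN; apply: cvgM; first exact: cvg_cst.
  apply: (cvg_comp (fun s => t - s) Num.sqrt); last exact: sqrt_continuous.
  by apply: cvgB; [exact: cvg_cst|exact: cvg_id].
Qed.

Lemma integral_isqrt0 t : 0 <= t ->
  (\int[leb]_s (ind 0 t s * isqrt s)%:E = (2 * Num.sqrt t)%:E)%E.
Proof.
rewrite le_eqVlt => /orP[/eqP <-|t0].
  by rewrite integral_ind set_itvoo0 ?integral_set0 ?sqrtr0 ?mulr0.
rewrite integral_ind (@ge0_continuous_FTC2oo _ (fun s => (2 * Num.sqrt s)))//.
- by rewrite sqrtr0 mulr0 subr0.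
- by move=> s _; exact: isqrt_ge0.
- by move=> s /andP[s0 _]; exact: continuous_isqrt.
- move=> s /andP[s0 _].
  have h1 : is_derive s 1 Num.sqrt (2 * Num.sqrt s)^-1 by exact: is_derive1_sqrt.
  have h2 := @is_deriveZ _ _ _ _ 2 s 1 _ h1.
  split; first exact: ex_derive.
  rewrite (derive_val (is_derive := h2)) /isqrt /GRing.scale/=; field.
  by rewrite gt_eqF// sqrtr_gt0.
- move=> s; apply: cvgM; first exact: cvg_cst.
  exact: sqrt_continuous.
Qed.

Lemma integral_ind_cst (T c : R) : 0 <= T -> 0 <= c ->
  (\int[leb]_s (ind 0 T s * c)%:E = (c * T)%:E)%E.
Proof.
move=> T0 c0; rewrite integral_ind integral_cst//= lebesgue_measure_itv/= lte_fin.
rewrite EFinM; congr (_ * _)%E.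
by case: ltP => [_|h]; [rewrite oppr0 adde0|congr EFin; apply/eqP; rewrite eq_le T0].
Qed.

Lemma isqrt_le (x y : R) : 0 < x -> x <= y -> isqrt y <= isqrt x.
Proof.
move=> x0 xy; rewrite lef_pV2 ?posrE ?sqrtr_gt0 ?(lt_le_trans x0 xy)//.
exact: ler_wsqrtr.
Qed.

(** One of s and t - s is at least t/2, so its inverse root is at most that of t/4, namely 2
    t^(-1/2). The Beta integral is thus reduced to two one-sided singularities. *)
Lemma isqrtM_le (s t : R) : 0 < s < t ->
  isqrt (t - s) * isqrt s <= 2 * isqrt t * (isqrt (t - s) + isqrt s).
Proof.
move=> /andP[s0 st].
have t0 : 0 < t by exact: lt_trans st.
have e4 : isqrt (t / 4) = 2 * isqrt t.
  rewrite /isqrt sqrtrM ?(ltW t0)// invfM mulrC; congr (_ * _).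
  rewrite sqrtrV// (_ : 4 = 2 ^+ 2) ?sqrtr_sqr ?ger0_norm ?invrK//.
  by rewrite -natrX.
have ts : 0 < t - s by rewrite subr_gt0.
have [h|h] := leP s (t / 2).
  have h1 : isqrt (t - s) <= 2 * isqrt t.
    by rewrite -e4; apply: isqrt_le; lra.
  rewrite (le_trans (ler_wpM2r (isqrt_ge0 _) h1))// ler_wpM2l ?mulr_ge0 ?isqrt_ge0//.
  by rewrite lerDr isqrt_ge0.
have h1 : isqrt s <= 2 * isqrt t.
  by rewrite -e4; apply: isqrt_le; lra.
rewrite (le_trans (ler_wpM2l (isqrt_ge0 _) h1))// mulrC ler_wpM2l ?mulr_ge0 ?isqrt_ge0//.
by rewrite lerDl isqrt_ge0.
Qed.

Lemma measurable_itv_isqrt (a t : R) (g : R -> R) : measurable_fun [set: R] g ->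
  measurable_fun [set: R] (fun s => ind a t s * (isqrt (t - s) * g s)).
Proof.
move=> mg; apply: measurable_funM; first exact: measurable_ind.
apply: measurable_funM => //; apply: (measurableT_comp measurable_isqrt).
exact: measurable_funB.
Qed.

Definition wkappa (gam t : R) : \bar R :=
  (\int[leb]_s (ind 0 t s * (isqrt (t - s) * (1 + s) `^ (- gam)))%:E)%E.

Lemma measurable_1DpowR (gam : R) : measurable_fun [set: R] (fun s : R => (1 + s) `^ (- gam)).
Proof. by apply: (measurableT_comp (measurable_powR _)); exact: measurable_funD. Qed.

(** Split at a fixed T1. Before T1 the integral is at most T1 (t-T1)^(-1/2), which tends to 0. After
    T1 the weight is at most (1+T1)^(-del) s^(-1/2), and the integral of (t-s)^(-1/2) s^(-1/2) over
    ]0,t[ is bounded uniformly in t. *)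
Lemma wkappa_small (gam e : R) : 2^-1 < gam -> 0 < e ->
  exists2 T, 0 < T & forall t, T <= t -> (wkappa gam t <= e%:E)%E.
Proof.
move=> g2 e0; pose del := gam - 2^-1; have del0 : 0 < del by rewrite subr_gt0.
(* [T1] solves (1+T1)^(-del) = 1/m <= e/16; m >= 1 makes it nonnegative. *)
pose m := Num.max 1 (16 / e); have m1 : 1 <= m by rewrite le_max lexx.
pose T1 := m `^ del^-1 - 1.
have T10 : 0 <= T1.
  by rewrite subr_ge0 -[leLHS](powRr0 m) ler_powR// invr_ge0 ltW.
have hT1 : (1 + T1) `^ (- del) <= e / 16.
  rewrite /T1 addrCA subrr addr0 powRN -powRrM mulVf ?gt_eqF// powRr1; last exact: le_trans m1.
  rewrite -[leRHS]invf_div lef_pV2 ?posrE ?divr_gt0//; last exact: lt_le_trans m1.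
  by rewrite le_max lexx orbT.
(* The square forces T1 (t-T1)^(-1/2) <= e/2, and the final 1 gives T1 < t. *)
exists (T1 + (2 * T1 / e) ^+ 2 + 1); first by rewrite ltr_wpDl// addr_ge0// sqr_ge0.
move=> t tT; have tT1 : T1 < t.
  by apply: lt_le_trans tT; rewrite -addrA ltrDl ltr_wpDl// sqr_ge0.
have t0 : 0 < t by exact: le_lt_trans tT1.
have hs : T1 * isqrt (t - T1) <= e / 2.
  have q0 : 0 <= 2 * T1 / e by rewrite divr_ge0 ?mulr_ge0 ?(ltW e0).
  have h : 2 * T1 / e <= Num.sqrt (t - T1).
    rewrite -[leLHS]ger0_norm// -sqrtr_sqr ler_wsqrtr//; lra.
  rewrite /isqrt ler_pdivrMr ?sqrtr_gt0 ?subr_gt0//.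
  rewrite [leLHS](_ : T1 = e / 2 * (2 * T1 / e)); last by field; rewrite gt_eqF.
  by rewrite ler_wpM2l// divr_ge0// (ltW e0).
(* e/16 bounds the weight and 2 t^(-1/2) comes from [isqrtM_le]. Each of the two integrals equals 2
   sqrt t, so each contributes e/4, beside e/2 from the early times. *)
pose c := e / 16 * (2 * isqrt t).
have c0 : 0 <= c by rewrite !mulr_ge0 ?isqrt_ge0// (ltW e0).
pose bd s := ind 0 T1 s * isqrt (t - T1) +
   (c * (ind 0 t s * isqrt (t - s)) + c * (ind 0 t s * isqrt s)).
have i0 (a b s x : R) : 0 <= ind a b s * isqrt x by rewrite mulr_ge0 ?ind_ge0 ?isqrt_ge0.
have bd0 s : 0 <= bd s by rewrite /bd addr_ge0 ?i0// addr_ge0// mulr_ge0 ?i0.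
have le_bd s : ind 0 t s * (isqrt (t - s) * (1 + s) `^ (- gam)) <= bd s.
  rewrite {1}/ind; case: ifP => [/andP[s0 st]|_]; last by rewrite mul0r.
  rewrite mul1r; have s1 : 1 <= 1 + s by rewrite lerDl ltW.
  have rest0 : 0 <= c * (ind 0 t s * isqrt (t - s)) + c * (ind 0 t s * isqrt s).
    by rewrite addr_ge0// mulr_ge0 ?i0//.
  have [sT|sT] := ltP s T1.
    rewrite /bd (ind1 s0 sT) mul1r (@le_trans _ _ (isqrt (t - T1)))//; last by rewrite lerDl.
    rewrite -[leRHS]mulr1 ler_pM ?isqrt_ge0 ?powR_ge0//.
      by apply: isqrt_le; lra.
    by rewrite -[leRHS](powRr0 (1 + s)) ler_powR//; rewrite /del in del0; lra.
  rewrite /bd (ind0 _ sT) mul0r add0r -mulrDr (ind1 s0 st) !mul1r.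
  have h1 : (1 + s) `^ (- gam) <= e / 16 * isqrt s.
    have -> : - gam = - del - 2^-1 by rewrite /del; lra.
    rewrite powRD; last by rewrite (gt_eqF (lt_le_trans ltr01 s1)) implybT.
    rewrite ler_pM ?powR_ge0//.
      apply: le_trans hT1; rewrite !powRN lef_pV2 ?posrE ?powR_gt0 ?(lt_le_trans ltr01 s1)//; last first.
        by rewrite ltr_wpDr.
      apply: (ge0_ler_powR (ltW del0)); rewrite ?nnegrE ?lerD2l//.
        exact: (addr_ge0 ler01 T10).
      exact: (addr_ge0 ler01 (ltW s0)).
    rewrite powRN powR12_sqrt ?(le_trans ler01 s1)//; apply: isqrt_le => //.
    by rewrite lerDr.
  rewrite (le_trans (ler_wpM2l (isqrt_ge0 _) h1))// mulrCA /c -mulrA ler_wpM2l//.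
    by rewrite divr_ge0// ltW.
  by apply: isqrtM_le; rewrite s0.
have ms : measurable_fun [set: R] (fun s => isqrt (t - s)).
  by apply: (measurableT_comp measurable_isqrt); exact: measurable_funB.
have mi (a b : R) : measurable_fun [set: R] (ind a b) by exact: measurable_ind.
have mis := measurable_isqrt.
have mA : measurable_fun [set: R] (fun s => ind 0 T1 s * isqrt (t - T1)).
  exact: measurable_funM.
have m2 : measurable_fun [set: R] (fun s => c * (ind 0 t s * isqrt (t - s))).
  by apply: measurable_funM => //; exact: measurable_funM.
have m3 : measurable_fun [set: R] (fun s => c * (ind 0 t s * isqrt s)).
  by apply: measurable_funM => //; exact: measurable_funM.
have m23 : measurable_fun [set: R] (fun s =>
  c * (ind 0 t s * isqrt (t - s)) + c * (ind 0 t s * isqrt s)) by exact: measurable_funD.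
have mbd : measurable_fun [set: R] bd by exact: measurable_funD.
apply: (@le_trans _ _ (\int[leb]_s (bd s)%:E)%E).
  apply: le_int0 => //.
  - by apply: measurable_itv_isqrt; exact: measurable_1DpowR.
  - by move=> s; rewrite !mulr_ge0 ?ind_ge0 ?isqrt_ge0 ?powR_ge0.
have m2' : measurable_fun [set: R] (fun s => ind 0 t s * isqrt (t - s)).
  exact: measurable_funM.
have m3' : measurable_fun [set: R] (fun s => ind 0 t s * isqrt s) by exact: measurable_funM.
rewrite int0D//; last by move=> s; rewrite addr_ge0// mulr_ge0.
rewrite int0D//; [|by move=> s; rewrite mulr_ge0|by move=> s; rewrite mulr_ge0].
rewrite !int0Z// integral_ind_cst ?isqrt_ge0// integral_isqrt ?(ltW t0)//.
rewrite integral_isqrt0 ?(ltW t0)// subr0 -!EFinM -!EFinD lee_fin [isqrt _ * T1]mulrC.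
have -> : c * (2 * Num.sqrt t) = e / 4.
  by rewrite /c /isqrt; field; rewrite gt_eqF// sqrtr_gt0.
lra.
Qed.

(* The exponential weight makes the singular kernel a contraction up to the time
   [T] after which the decay of [(1 + s) ^ (- gam)] does. *)
Lemma volterra_majorant (c0 c gam : R) : 0 <= c0 -> 0 <= c -> 2^-1 < gam ->
  exists (h : R -> R) (H : R), [/\ measurable_fun [set: R] h,
    forall s, 0 <= h s <= H &
    forall t, 0 < t -> (c0%:E + c%:E * \int[leb]_s
      (ind 0 t s * (isqrt (t - s) * ((1 + s) `^ (- gam) * h s)))%:E <= (h t)%:E)%E].
Proof.
move=> c00 cge0 g2.
have cc0 : 0 < 8 * c + 8 by rewrite ltr_wpDl// mulr_ge0.
have [T T0 HT] : exists2 T, 0 < T & forall t, T <= t -> (wkappa gam t <= ((2 * c + 2)^-1)%:E)%E.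
  by apply: wkappa_small => //; rewrite invr_gt0 ltr_wpDl// mulr_ge0.
(* On the window of width [del] before t the singular kernel has mass 2/(8c+8), half of the target
   1/(2c+2). Earlier times gain exp(-lam del); since lam * del = (8c+8) sqrt T, they also contribute
   at most 2/(8c+8). *)
pose del := (8 * c + 8)^-1 ^+ 2.
have del0 : 0 < del by rewrite exprn_gt0// invr_gt0.
have sdel : Num.sqrt del = (8 * c + 8)^-1 by rewrite sqrtr_sqr gtr0_norm// invr_gt0.
pose lam := (8 * c + 8) * Num.sqrt T / del.
have lam0 : 0 <= lam by rewrite divr_ge0 ?(ltW del0)// mulr_ge0 ?(ltW cc0)// sqrtr_ge0.
(* The factor 2 secures c0 <= h/2, and stopping the growth at T keeps h bounded. *)
pose h s := 2 * c0 * expR (lam * Num.min s T).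
have h0 s : 0 <= h s by rewrite !mulr_ge0// expR_ge0.
have h_nd s t : s <= t -> h s <= h t.
  move=> st; rewrite ler_wpM2l ?mulr_ge0// ler_expR ler_wpM2l// le_min !ge_min lexx orbT andbT.
  by rewrite st.
have mh : measurable_fun [set: R] h.
  apply: measurable_funM => //; apply: measurableT_comp => //; apply: measurable_funM => //.
  exact: measurable_minr.
exists h, (h T); split => // [s|t t0].
  by rewrite h0/= ler_wpM2l ?mulr_ge0// ler_expR ler_wpM2l// minxx ge_min lexx orbT.
have h2 : c0 <= h t / 2.
  rewrite /h mulrAC [2 * c0]mulrC mulfK ?pnatr_eq0// ler_peMr//.
  rewrite -expR0 ler_expR mulr_ge0// le_min (ltW t0) (ltW T0)//.
have p0 s : 0 <= (1 + s) `^ (- gam) by exact: powR_ge0.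
have p1 s : 0 < s -> (1 + s) `^ (- gam) <= 1.
  move=> s0; rewrite -[leRHS](powRr0 (1 + s)) ler_powR ?lerDl ?(ltW s0)//.
  by rewrite oppr_le0 (le_trans _ (ltW g2))// invr_ge0.
have mp := measurable_1DpowR gam.
have m1 : measurable_fun [set: R] (fun s => ind 0 t s * (isqrt (t - s) * ((1 + s) `^ (- gam) * h s))).
  by apply: measurable_itv_isqrt; exact: measurable_funM.
have i0 (a b s x : R) : 0 <= ind a b s * isqrt x by rewrite mulr_ge0 ?ind_ge0 ?isqrt_ge0.
have n1 s : 0 <= ind 0 t s * (isqrt (t - s) * ((1 + s) `^ (- gam) * h s)).
  by rewrite !mulr_ge0 ?ind_ge0 ?isqrt_ge0.
(* Half of h t pays for c0, and c/(2c+2) <= 1/2 leaves the other half for the integral. *)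
suff I : (\int[leb]_s (ind 0 t s * (isqrt (t - s) * ((1 + s) `^ (- gam) * h s)))%:E <=
    (h t * (2 * c + 2)^-1)%:E)%E.
  apply: (@le_trans _ _ (c0%:E + c%:E * (h t * (2 * c + 2)^-1)%:E)%E).
    by rewrite leeD2l// lee_wpmul2l// lee_fin.
  rewrite -EFinM -EFinD lee_fin.
  have : c * (h t * (2 * c + 2)^-1) <= h t / 2.
    rewrite mulrCA ler_wpM2l// ler_pdivrMr ?ltr_wpDl ?mulr_ge0//; lra.
  move: h2; lra.
have [Tt|tT] := leP T t.
  apply: (@le_trans _ _ (\int[leb]_s (h t * (ind 0 t s * (isqrt (t - s) * (1 + s) `^ (- gam))))%:E)%E).
    apply: le_int0 => //.
    - by apply: measurable_funM => //; exact: measurable_itv_isqrt.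
    - move=> s; rewrite /ind; case: ifP => [/andP[_ st]|_]; last by rewrite !mul0r mulr0.
      rewrite !mul1r [leRHS]mulrC -mulrA ler_wpM2l ?isqrt_ge0// ler_wpM2l//.
      by rewrite h_nd// ltW.
  rewrite int0Z//; [|exact: measurable_itv_isqrt|by move=> s; rewrite !mulr_ge0 ?ind_ge0 ?isqrt_ge0].
  by rewrite [X in (_ <= X)%E]EFinM lee_wpmul2l ?lee_fin// HT.
pose bd s := h t * (ind (t - del) t s * isqrt (t - s)) +
             (h t * expR (- (lam * del))) * (ind 0 t s * isqrt (t - s)).
have e0 : 0 <= h t * expR (- (lam * del)) by rewrite mulr_ge0 ?expR_ge0.
have ms : measurable_fun [set: R] (fun s => isqrt (t - s)).
  by apply: (measurableT_comp measurable_isqrt); exact: measurable_funB.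
have mi (a b : R) : measurable_fun [set: R] (ind a b) by exact: measurable_ind.
have m2 (a : R) : measurable_fun [set: R] (fun s => ind a t s * isqrt (t - s)).
  exact: measurable_funM.
have m3 (a k : R) : measurable_fun [set: R] (fun s => k * (ind a t s * isqrt (t - s))).
  exact: measurable_funM.
have mbd : measurable_fun [set: R] bd by exact: measurable_funD.
apply: (@le_trans _ _ (\int[leb]_s (bd s)%:E)%E).
  apply: le_int0 => //.
  move=> s; rewrite {1}/ind; case: ifP => [/andP[s0 st]|_]; last by rewrite mul0r /bd addr_ge0// mulr_ge0 ?i0//.
  rewrite mul1r; have [ds|sd] := ltP (t - del) s.
    rewrite /bd (ind1 ds st) mul1r ler_wpDr//; first by rewrite mulr_ge0 ?i0.
    rewrite [leRHS]mulrC ler_wpM2l ?isqrt_ge0//.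
    by rewrite -[leRHS]mul1r ler_pM ?p1 ?h_nd ?(ltW st).
  rewrite /bd (ind1 s0 st) mul1r ler_wpDl//; first by rewrite mulr_ge0 ?i0.
  rewrite [leRHS]mulrC ler_wpM2l ?isqrt_ge0//.
  rewrite -[leRHS]mul1r ler_pM ?p1//.
  rewrite /h -[leRHS]mulrA -expRD ler_wpM2l ?mulr_ge0// ler_expR -mulrN -mulrDr ler_wpM2l//.
  rewrite (min_idPl (ltW tT)) ge_min; apply/orP; left; lra.
rewrite int0D//; [|exact: m3|exact: m3|by move=> s; rewrite mulr_ge0|by move=> s; rewrite mulr_ge0].
rewrite !int0Z//; [|exact: m2|exact: m2].
rewrite !integral_isqrt ?(ltW t0)//; last by rewrite lerBlDr lerDl ltW.
rewrite -!EFinM -EFinD lee_fin subr0 subKr -[X in _ + X <= _]mulrA -[leLHS]mulrDr ler_wpM2l// sdel.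
have sT : Num.sqrt t <= Num.sqrt T by rewrite ler_wsqrtr// ltW.
have sT0 : 0 <= (8 * c + 8) * Num.sqrt T by rewrite mulr_ge0 ?(ltW cc0)// sqrtr_ge0.
have eb : expR (- (lam * del)) <= (1 + (8 * c + 8) * Num.sqrt T)^-1.
  rewrite expRN lef_pV2 ?posrE ?expR_gt0//; last by rewrite ltr_wpDr.
  by rewrite /lam divfK ?gt_eqF// expR_ge1Dx.
have key : expR (- (lam * del)) * (2 * Num.sqrt t) <= 2 * (8 * c + 8)^-1.
  rewrite (@le_trans _ _ ((1 + (8 * c + 8) * Num.sqrt T)^-1 * (2 * Num.sqrt T)))//.
    by rewrite ler_pM ?expR_ge0 ?mulr_ge0 ?sqrtr_ge0// ler_pM2l.
  rewrite ler_pdivrMl ?ltr_wpDr// mulrA ler_pdivlMr//; move: sT0; lra.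
rewrite (_ : (2 * c + 2)^-1 = 2 * (8 * c + 8)^-1 + 2 * (8 * c + 8)^-1); last first.
  by field; rewrite gt_eqF// gt_eqF// ltr_wpDl// mulr_ge0.
by rewrite lerD2l.
Qed.

End time_integrals.

(** * The heat majorant *)

Lemma hk_le_unif (R : realType) n (x y : n.-tuple R) (s t : R) : 0 < s -> s <= t ->
  hk x y t <= (4 * pi * s) `^ (- (n%:R / 2)).
Proof.
move=> s0 st; have t0 := lt_le_trans s0 st; rewrite (le_trans (hk_le _ _ t0))//.
rewrite !powRN lef_pV2 ?posrE ?powR_gt0 ?pi4_gt0//.
rewrite ge0_ler_powR ?nnegrE ?(ltW (pi4_gt0 t0)) ?(ltW (pi4_gt0 s0))//.
by rewrite ler_pM2l// mulr_gt0// pi_gt0.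
Qed.

(** * Continuity of the kernels along sequences of points and times *)

Section kernel_continuity.
Context {R : realType} {N : nat}.
Variables (x_ : nat -> N.-tuple R) (x : N.-tuple R).
Hypothesis x_cvg : forall i, tnth (x_ k) i @[k --> \oo] --> tnth x i.

Lemma cvg_powR (u_ : nat -> R) (l a : R) : 0 < l -> u_ @ \oo --> l ->
  u_ k `^ a @[k --> \oo] --> l `^ a.
Proof.
move=> l0 ul; apply: (cvg_comp u_ (fun z => z `^ a) ul).
have : {for l, continuous (fun z : R => z `^ a)}.
  apply: differentiable_continuous; apply/derivable1_diffP.
  by apply: derivable_powR; rewrite in_itv/= l0.
exact.
Qed.

Lemma cvg_bigsum (I : Type) (r : seq I) (f : I -> nat -> R) (l : I -> R) :
  (forall i, f i @ \oo --> l i) ->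
  (\sum_(i <- r) f i k) @[k --> \oo] --> \sum_(i <- r) l i.
Proof.
move=> fl; elim: r => [|i r IH].
  by rewrite big_nil; under eq_fun do rewrite big_nil; exact: cvg_cst.
by rewrite big_cons; under eq_fun do rewrite big_cons; apply: cvgD.
Qed.

Lemma cvg_sqd (y : N.-tuple R) : sqd (x_ k) y @[k --> \oo] --> sqd x y.
Proof.
apply: cvg_bigsum => i; rewrite expr2; under eq_fun do rewrite expr2.
by apply: cvgM; apply: cvgB => //; exact: cvg_cst.
Qed.

Lemma cvg_hk (y : N.-tuple R) (t_ : nat -> R) (t : R) : 0 < t -> t_ @ \oo --> t ->
  hk (x_ k) y (t_ k) @[k --> \oo] --> hk x y t.
Proof.
move=> t0 tt; have t4 (c : R) : c * t_ k @[k --> \oo] --> c * t.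
  by apply: cvgM => //; exact: cvg_cst.
rewrite hkE; under eq_fun do rewrite hkE; apply: cvgM.
  by apply: cvg_powR => //; exact: pi4_gt0.
apply: (cvg_comp _ expR); last exact: continuous_expR.
apply: cvgM.
  by apply: cvgN; exact: cvg_sqd.
by apply: cvgV => //; rewrite gt_eqF// mulr_gt0.
Qed.

Lemma cvg_dhk (y : N.-tuple R) (t_ : nat -> R) (t : R) (i : 'I_N) : 0 < t -> t_ @ \oo --> t ->
  dheat_kernel i (tsub (x_ k) y) (t_ k) @[k --> \oo] --> dheat_kernel i (tsub x y) t.
Proof.
move=> t0 tt; have t4 (c : R) : c * t_ k @[k --> \oo] --> c * t.
  by apply: cvgM => //; exact: cvg_cst.
apply: cvgM; last exact: cvg_hk.
apply: cvgN; apply: cvgM.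
  rewrite tnth_mktuple; under eq_fun do rewrite tnth_mktuple.
  by apply: cvgB => //; exact: cvg_cst.
by apply: cvgV => //; rewrite gt_eqF// mulr_gt0.
Qed.

Lemma cvg_isqrt (t_ : nat -> R) (t : R) : t != 0 -> t_ @ \oo --> t ->
  isqrt (t_ k) @[k --> \oo] --> isqrt t.
Proof.
move=> t0 tt; have [tp|tn] := ltP 0 t.
  by apply: (cvg_comp t_ isqrt tt); exact: continuous_isqrt.
have tlt : t < 0 by rewrite lt_neqAle t0.
apply: cvg_near_cst; rewrite isqrt_le0//.
by apply: filterS (cvgr_lt _ tt _ tlt) => k tk; rewrite isqrt_le0// ltW.
Qed.

End kernel_continuity.

(** * The signed iterated integral as a Lebesgue integral *)

Section lebintR_integral.
Context {R : realType} {N : nat}.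

Lemma lebintRE (f : N.-tuple R -> R) : (tuple_leb N).-integrable [set: N.-tuple R] (EFin \o f) ->
  lebintR f = fine (\int[tuple_leb N]_x (f x)%:E).
Proof.
move=> fi; have mf : measurable_fun [set: N.-tuple R] f.
  by apply/measurable_EFinP; exact: measurable_int fi.
rewrite /lebintR !lebintE.
- have fp := integrable_fin_num measurableT (integrable_funepos measurableT fi).
  have fn := integrable_fin_num measurableT (integrable_funeneg measurableT fi).
  have -> := integralE (tuple_leb N) setT (EFin \o f).
  rewrite (fineB fp fn); congr (fine _ - fine _).
  + by apply: eq_integral => x _; rewrite funeposE /= EFin_max.
  + by apply: eq_integral => x _; rewrite funenegE /= EFin_max.
- by apply/measurable_EFinP; apply: measurable_maxr => //; exact: measurable_funN.
- by move=> x; rewrite lee_fin le_max lexx orbT.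
- by apply/measurable_EFinP; apply: measurable_maxr.
- by move=> x; rewrite lee_fin le_max lexx orbT.
Qed.

End lebintR_integral.

(** * Mass, decay, semigroup law and continuity of the majorant *)

Section heat_majorant.
Context {R : realType} {N : nat} (phi : N.-tuple R -> R).
Hypothesis mphi : measurable_fun [set: N.-tuple R] phi.
Hypothesis iphi : (\int[tuple_leb N]_x (`|phi x|)%:E < +oo)%E.
Notation X := (N.-tuple R).
Notation mu := (tuple_leb N).
Implicit Types (x y : X) (s t : R).

Definition heat_maj x t : R := fine (\int[mu]_y (hk x y (2 * t) * `|phi y|)%:E).

Let E := heat_maj.

Definition phi1 : R := fine (\int[mu]_x (`|phi x|)%:E).

Let mnphi : measurable_fun [set: X] (fun x => `|phi x|).
Proof. exact: measurableT_comp. Qed.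

Lemma phi1E : (\int[mu]_x (`|phi x|)%:E)%E = phi1%:E.
Proof. by rewrite fineK// ge0_fin_numE// int0_ge0. Qed.

Lemma phi1_ge0 : 0 <= phi1.
Proof. by rewrite fine_ge0// int0_ge0. Qed.

Let mhphi x t : measurable_fun [set: X] (fun y => hk x y (2 * t) * `|phi y|).
Proof. by apply: measurable_funM => //; exact: measurable_hk. Qed.

Let hphi0 x t y : 0 <= hk x y (2 * t) * `|phi y|.
Proof. by rewrite mulr_ge0 ?hk_ge0. Qed.

Lemma heat_maj_ge0 x t : 0 <= E x t.
Proof. by rewrite fine_ge0// int0_ge0. Qed.

Let int_le x t : 0 < t -> (\int[mu]_y (hk x y (2 * t) * `|phi y|)%:E <=
  ((4 * pi * (2 * t)) `^ (- (N%:R / 2)) * phi1)%:E)%E.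
Proof.
move=> t0; rewrite EFinM -phi1E -int0Z ?powR_ge0//; apply: le_int0 => //.
  exact: measurable_funM.
by move=> y; rewrite ler_wpM2r// hk_le// mulr_gt0.
Qed.

Lemma heat_majE x t : 0 < t ->
  (\int[mu]_y (hk x y (2 * t) * `|phi y|)%:E)%E = (E x t)%:E.
Proof.
move=> t0; rewrite fineK// ge0_fin_numE ?int0_ge0//.
by rewrite (le_lt_trans (int_le _ t0))// ltry.
Qed.

Lemma heat_maj_le x t : 0 < t -> t `^ (N%:R / 2) * E x t <= phi1.
Proof.
move=> t0; have := int_le x t0; rewrite heat_majE// lee_fin => h.
apply: (le_trans (ler_wpM2l (powR_ge0 _ _) h)).
rewrite [leLHS]mulrA ler_piMl ?phi1_ge0//.
rewrite (_ : 4 * pi * (2 * t) = (8 * pi) * t); last by ring.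
have pi8 : 1 <= 8 * pi :> R by have := @pi_ge2 R; lra.
rewrite powRM ?(le_trans ler01 pi8) ?(ltW t0)// mulrCA -powRD ?subrr ?powRr0 ?mulr1; last first.
  by rewrite (gt_eqF t0) implybT.
rewrite -[leRHS](powRr0 (8 * pi)) ler_powR// oppr_le0 divr_ge0//.
Qed.

Lemma measurable_heat_maj d (T : measurableType d) (a : T -> X) (b : T -> R) :
  measurable_fun [set: T] a -> measurable_fun [set: T] b ->
  measurable_fun [set: T] (fun w => E (a w) (b w)).
Proof.
move=> ma mb; apply: measurable_param_integral; apply: measurable_funM.
  apply: measurable_hk => //.
  - exact: (measurableT_comp ma).
  - by apply: measurable_funM => //; exact: (measurableT_comp mb).
exact: (measurableT_comp mnphi).
Qed.

Lemma integral_heat_maj t : 0 < t -> (\int[mu]_x (E x t)%:E = phi1%:E)%E.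
Proof.
move=> t0; under eq_integral do rewrite -heat_majE//.
have t2 : 0 < 2 * t by rewrite mulr_gt0.
rewrite (fubini_tonelli (fun z : X * X => (hk z.1 z.2 (2 * t) * `|phi z.2|)%:E)); last 2 first.
- apply/measurable_EFinP; apply: measurable_funM; first exact: measurable_hk.
  exact: (measurableT_comp mnphi).
- by move=> z; rewrite lee_fin.
rewrite -phi1E; apply: eq_integral => y _ /=.
under eq_integral do rewrite mulrC.
by rewrite int0Z ?integral_hk ?mule1//; [exact: measurable_hk|move=> x; exact: hk_ge0].
Qed.

(** This is why E carries the time 2t: the gradient bound turns G(., t-s) into G(., 2(t-s)), and
    2(t-s) + 2s = 2t, so Duhamel's integral reproduces E with no further widening. *)
Lemma heat_maj_semigroup x s t : 0 < s -> 0 < t ->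
  (\int[mu]_y (hk x y (2 * t) * E y s)%:E = (E x (t + s))%:E)%E.
Proof.
move=> s0 t0; have t2 : 0 < 2 * t by rewrite mulr_gt0.
have s2 : 0 < 2 * s by rewrite mulr_gt0.
under eq_integral do rewrite EFinM -heat_majE// -int0Z ?hk_ge0//.
rewrite (fubini_tonelli (fun z : X * X =>
    (hk x z.1 (2 * t) * (hk z.1 z.2 (2 * s) * `|phi z.2|))%:E)); last 2 first.
- apply/measurable_EFinP; apply: measurable_funM; first exact: measurable_hk.
  apply: measurable_funM; first exact: measurable_hk.
  exact: (measurableT_comp mnphi).
- by move=> z; rewrite lee_fin mulr_ge0 ?hk_ge0.
rewrite -heat_majE ?addr_gt0//; apply: eq_integral => z _ /=.
rewrite mulrDr EFinM -(integral_hkM x z t2 s2) muleC -int0Z//.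
- by apply: eq_integral => y _; congr EFin; ring.
- by apply: measurable_funM; exact: measurable_hk.
- by move=> y; rewrite mulr_ge0 ?hk_ge0.
Qed.

Lemma cvg_heat_maj (x_ : nat -> X) x (t_ : nat -> R) (t : R) : 0 < t ->
  (forall i, tnth (x_ k) i @[k --> \oo] --> tnth x i) -> t_ @ \oo --> t ->
  (forall k, t / 2 <= t_ k) ->
  E (x_ k) (t_ k) @[k --> \oo] --> E x t.
Proof.
move=> t0 xx tt tk.
pose M := (4 * pi * t) `^ (- (N%:R / 2)).
apply: (@dct _ _ _ mu _ _ (fun y => M * `|phi y|)) => //.
- exact: measurable_funM.
- move=> k y; rewrite ger0_norm// ler_wpM2r//.
  have t2 : t <= 2 * t_ k by have := tk k; lra.
  exact: hk_le_unif.
- by rewrite int0Z ?powR_ge0// lte_mul_pinfty// lee_fin powR_ge0.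
- apply: aeW => y; apply: cvgM; last exact: cvg_cst.
  apply: cvg_hk => //; first by rewrite mulr_gt0.
  by apply: cvgM => //; exact: cvg_cst.
Qed.

Let mhp x t : measurable_fun [set: X] (fun y => hk x y t * phi y).
Proof. by apply: measurable_funM => //; exact: measurable_hk. Qed.

Let heat_dom x t y : 0 < t -> `|hk x y t * phi y| <= 2 `^ (N%:R / 2) * (hk x y (2 * t) * `|phi y|).
Proof.
by move=> t0; rewrite normrM ger0_norm ?hk_ge0// mulrA ler_wpM2r// hk_le_double.
Qed.

Let heat_int x t : 0 < t ->
  (\int[mu]_y (2 `^ (N%:R / 2) * (hk x y (2 * t) * `|phi y|))%:E < +oo)%E.
Proof. by move=> t0; rewrite int0Z ?powR_ge0// heat_majE// -EFinM ltry. Qed.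

Lemma integrable_heat x t : 0 < t -> mu.-integrable [set: X] (EFin \o (fun y => hk x y t * phi y)).
Proof.
move=> t0; apply: (integrable_le _ _ (fun y => heat_dom x y t0)) => //; last exact: heat_int.
exact: measurable_funM.
Qed.

Lemma heat_sgE x t : 0 < t -> heat_sg t phi x = fine (\int[mu]_y (hk x y t * phi y)%:E).
Proof. by move=> t0; rewrite /heat_sg lebintRE//; exact: integrable_heat. Qed.

Lemma heat_sg_le x t : 0 < t -> `|heat_sg t phi x| <= 2 `^ (N%:R / 2) * E x t.
Proof.
move=> t0; rewrite heat_sgE// -lee_fin EFinM -heat_majE// -int0Z ?powR_ge0//.
apply: norm_fine_integral_le => //; [exact: measurable_funM| |exact: heat_int].
by move=> y; exact: heat_dom.
Qed.

Lemma cvg_heat_sg (x_ : nat -> X) x (t_ : nat -> R) (t : R) : 0 < t ->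
  (forall i, tnth (x_ k) i @[k --> \oo] --> tnth x i) -> t_ @ \oo --> t ->
  (forall k, t / 2 <= t_ k) ->
  heat_sg (t_ k) phi (x_ k) @[k --> \oo] --> heat_sg t phi x.
Proof.
move=> t0 xx tt tk; have tk0 k : 0 < t_ k by apply: lt_le_trans (tk k); rewrite divr_gt0.
rewrite heat_sgE//; under eq_fun do rewrite heat_sgE//.
pose M := (4 * pi * (t / 2)) `^ (- (N%:R / 2)).
apply: (@dct _ _ _ mu _ _ (fun y => M * `|phi y|)) => //.
- exact: measurable_funM.
- move=> k y; rewrite normrM ger0_norm ?hk_ge0// ler_wpM2r//.
  by apply: hk_le_unif => //; rewrite divr_gt0.
- by rewrite int0Z ?powR_ge0// lte_mul_pinfty// lee_fin powR_ge0.
- by apply: aeW => y; apply: cvgM; [exact: cvg_hk|exact: cvg_cst].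
Qed.

End heat_majorant.

(** * The Duhamel term *)

Section duhamel.
Context {R : realType} {N : nat} (phi : N.-tuple R -> R).
Hypothesis mphi : measurable_fun [set: N.-tuple R] phi.
Hypothesis iphi : (\int[tuple_leb N]_x (`|phi x|)%:E < +oo)%E.
Notation X := (N.-tuple R).
Notation mu := (tuple_leb N).
Notation TR := (measurableTypeR R).
Notation E := (heat_maj phi).
Implicit Types (x y : X) (s t eps : R) (z : TR * X).

Definition leb_time : {sigma_finite_measure set TR -> \bar R} := @lebesgue_measure R.

Definition spacetime : {sigma_finite_measure set (TR * X)%type -> \bar R} :=
  prodm leb_time mu.

Let mfst : measurable_fun [set: TR * X] (fun z => z.1 : R).
Proof. exact: measurable_fst_TR. Qed.

Let msnd : measurable_fun [set: TR * X] (fun z => z.2).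
Proof. exact: measurable_snd. Qed.

Let mtime (g : R -> R) : measurable_fun [set: R] g ->
  measurable_fun [set: TR * X] (fun z => g z.1).
Proof. by move=> mg; exact: (measurableT_comp mg mfst). Qed.

Definition dom x t (w : R -> R) z : R :=
  ind 0 t z.1 * w z.1 * (hk x z.2 (2 * (t - z.1)) * E z.2 z.1).

Lemma measurable_dom x t (w : R -> R) : measurable_fun [set: R] w ->
  measurable_fun [set: TR * X] (dom x t w).
Proof.
move=> mw; apply: measurable_funM.
  by apply: measurable_funM; [apply: measurable_ind|exact: mtime].
apply: measurable_funM; last exact: measurable_heat_maj.
apply: measurable_hk => //; apply: measurable_funM => //.
exact: measurable_funB.
Qed.

Lemma dom_ge0 x t (w : R -> R) z : (forall s, 0 <= w s) -> 0 <= dom x t w z.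
Proof.
move=> w0; apply: mulr_ge0; apply: mulr_ge0 => //.
- exact: ind_ge0.
- exact: hk_ge0.
- exact: heat_maj_ge0.
Qed.

Lemma integral_dom x t (w : R -> R) : 0 < t -> measurable_fun [set: R] w -> (forall s, 0 <= w s) ->
  (\int[spacetime]_z (dom x t w z)%:E =
   (\int[@lebesgue_measure R]_s (ind 0 t s * w s)%:E) * (E x t)%:E)%E.
Proof.
move=> t0 mw w0.
have md : measurable_fun [set: TR * X] (fun z => (dom x t w z)%:E).
  by apply/measurable_EFinP; exact: measurable_dom.
rewrite /spacetime (fubini_tonelli1 (m1 := leb_time) (m2 := mu) _ md); last first.
  by move=> z; rewrite lee_fin dom_ge0.
rewrite -ge0_integralZr//=; last 3 first.
- by apply/measurable_EFinP; apply: measurable_funM => //; exact: measurable_ind.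
- by move=> s _; rewrite lee_fin mulr_ge0 ?ind_ge0.
- by rewrite lee_fin heat_maj_ge0.
apply: eq_integral => s _; rewrite /fubini_F /dom/= {1 2}/ind; case: ifPn => [/andP[s0 st]|_].
  have ts : 0 < t - s by rewrite subr_gt0.
  rewrite mul1r int0Z//; last 2 first.
  - apply: measurable_funM; first exact: measurable_hk.
    exact: measurable_heat_maj.
  - by move=> y; rewrite mulr_ge0 ?hk_ge0 ?heat_maj_ge0.
  by rewrite (heat_maj_semigroup mphi iphi x s0 ts) subrK.
rewrite !mul0r mul0e; under eq_integral do rewrite mul0r.
exact: integral0.
Qed.

(** The cut-off at t - eps is the delay: for eps > 0 the source is read only at times before t -
    eps, while eps = 0 gives the full Duhamel kernel. *)
Definition dker eps i x t z : R :=
  ind 0 (t - eps) z.1 * dheat_kernel i (tsub x z.2) (t - z.1).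

Definition duh_int eps (f : TR * X -> X) x t z : R :=
  \sum_(i < N) dker eps i x t z * tnth (f z) i.

Definition duh eps f x t : R := fine (\int[spacetime]_z (duh_int eps f x t z)%:E).

Definition adm (b : R -> R) (f : TR * X -> X) := measurable_fun [set: TR * X] f /\
  forall z i, 0 < z.1 :> R -> `|tnth (f z) i| <= b z.1 * E z.2 z.1.

Definition cN : R := N%:R * 2 `^ (N%:R / 2).

Lemma cN_ge0 : 0 <= cN.
Proof. by rewrite mulr_ge0// powR_ge0. Qed.

Lemma measurable_dker eps i x t : measurable_fun [set: TR * X] (dker eps i x t).
Proof.
apply: measurable_funM; first exact: measurable_ind.
by apply: measurable_dhk => //; exact: measurable_funB.
Qed.

Lemma measurable_duh_int eps f x t : measurable_fun [set: TR * X] f ->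
  measurable_fun [set: TR * X] (duh_int eps f x t).
Proof.
move=> mf; apply: measurable_sum => i; apply: measurable_funM; first exact: measurable_dker.
exact: (measurable_fun_tnthP _).1.
Qed.

Lemma dker_le eps i x t z : 0 <= eps -> `|dker eps i x t z| <=
  2 `^ (N%:R / 2) * (ind 0 (t - eps) z.1 * (isqrt (t - z.1) * hk x z.2 (2 * (t - z.1)))).
Proof.
move=> eps0; rewrite /dker /ind; case: ifPn => [/andP[s0 st]|_]; last by rewrite !mul0r normr0 mulr0.
rewrite !mul1r; apply: dheat_kernel_le; rewrite subr_gt0.
by rewrite (lt_le_trans st)// lerBlDr lerDl.
Qed.

Lemma dker_mul_le eps i x t z (e : R) (w : R -> R) : 0 <= eps ->
  (0 < z.1 :> R -> `|e| <= w z.1 * E z.2 z.1) ->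
  `|dker eps i x t z * e| <=
  2 `^ (N%:R / 2) * dom x t (fun s => ind 0 (t - eps) s * (isqrt (t - s) * w s)) z.
Proof.
move=> eps0 he; have [/andP[s0 st]|ns] := boolP (0 < (z.1 : R) < t - eps); last first.
  by rewrite /dker /dom /ind (negbTE ns) !(mul0r, mulr0) normr0.
have stt : z.1 < t by rewrite (lt_le_trans st)// lerBlDr lerDl.
have h := dker_le i x t z eps0; rewrite (ind1 s0 st) mul1r in h.
rewrite normrM /dom (ind1 s0 stt) (ind1 s0 st) !mul1r.
have := ler_pM (normr_ge0 _) (normr_ge0 _) h (he s0); move/le_trans; apply.
by rewrite le_eqVlt; apply/orP; left; apply/eqP; ring.
Qed.

Lemma duh_int_le eps b f x t z : 0 <= eps -> adm b f ->
  `|duh_int eps f x t z| <=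
  cN * dom x t (fun s => ind 0 (t - eps) s * (isqrt (t - s) * b s)) z.
Proof.
move=> eps0 [_ fb]; apply: (le_trans (ler_norm_sum _ _ _)).
apply: (@le_trans _ _ (\sum_(i < N) (2 `^ (N%:R / 2) *
   dom x t (fun s => ind 0 (t - eps) s * (isqrt (t - s) * b s)) z))).
  by apply: ler_sum => i _; apply: dker_mul_le => // s0; exact: fb.
by rewrite sumr_const card_ord -[leLHS]mulr_natl /cN mulrA.
Qed.

(** * Size, delay error and equicontinuity of the Duhamel term *)

Section bounded_weight.
Variables (b : R -> R) (beta : R).
Hypotheses (mb : measurable_fun [set: R] b) (b0 : forall s, 0 <= b s <= beta).

Let b_ge0 s : 0 <= b s. Proof. by case/andP: (b0 s). Qed.
Let b_le s : b s <= beta. Proof. by case/andP: (b0 s). Qed.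
Let beta0 : 0 <= beta. Proof. exact: le_trans (b_le 0). Qed.

Definition vol t : \bar R :=
  (\int[@lebesgue_measure R]_s (ind 0 t s * (isqrt (t - s) * b s))%:E)%E.

Let mis t : measurable_fun [set: R] (fun s => isqrt (t - s)).
Proof. by apply: (measurableT_comp measurable_isqrt); exact: measurable_funB. Qed.

Lemma vol_le t : 0 < t -> (vol t <= (beta * (2 * Num.sqrt t))%:E)%E.
Proof.
move=> t0.
have m1 : measurable_fun [set: R] (fun s => ind 0 t s * isqrt (t - s)).
  by apply: measurable_funM => //; exact: measurable_ind.
apply: (@le_trans _ _ (\int[@lebesgue_measure R]_s (beta * (ind 0 t s * isqrt (t - s)))%:E)%E).
  apply: le_int0.
  - exact: measurable_itv_isqrt.
  - exact: measurable_funM.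
  - by move=> s; rewrite !mulr_ge0 ?ind_ge0 ?isqrt_ge0.
  - by move=> s; rewrite mulrA mulrC ler_wpM2r ?mulr_ge0 ?ind_ge0 ?isqrt_ge0.
rewrite int0Z//; last by move=> s; rewrite mulr_ge0 ?ind_ge0 ?isqrt_ge0.
by rewrite integral_isqrt ?(ltW t0)// subr0.
Qed.

Let mw eps t (g : R -> R) : measurable_fun [set: R] g ->
  measurable_fun [set: R] (fun s => ind 0 (t - eps) s * (isqrt (t - s) * g s)).
Proof.
move=> mg; apply: measurable_funM; first exact: measurable_ind.
exact: measurable_funM.
Qed.

Let w0 eps t (g : R -> R) s : (forall s, 0 <= g s) ->
  0 <= ind 0 (t - eps) s * (isqrt (t - s) * g s).
Proof. by move=> g0; rewrite !mulr_ge0 ?ind_ge0 ?isqrt_ge0. Qed.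

Lemma integral_dom_le eps x t : 0 <= eps -> 0 < t ->
  (\int[spacetime]_z (cN * dom x t (fun s => ind 0 (t - eps) s * (isqrt (t - s) * b s)) z)%:E
   <= cN%:E * (vol t * (E x t)%:E))%E.
Proof.
move=> eps0 t0.
rewrite int0Z ?cN_ge0//; last 2 first.
- by apply: measurable_dom; exact: mw.
- by move=> z; apply: dom_ge0 => s; exact: w0.
rewrite lee_wpmul2l ?lee_fin ?cN_ge0// integral_dom//; [|exact: mw|by move=> s; exact: w0].
rewrite lee_wpmul2r ?lee_fin ?heat_maj_ge0//; apply: le_int0.
- by apply: measurable_funM; [exact: measurable_ind|exact: mw].
- exact: measurable_itv_isqrt.
- by move=> s; rewrite mulr_ge0 ?ind_ge0 ?w0.
- move=> s; rewrite ler_wpM2l ?ind_ge0// ler_piMl ?ind_le1// mulr_ge0 ?isqrt_ge0//.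
Qed.

Lemma integral_dom_fin eps x t : 0 <= eps -> 0 < t ->
  (\int[spacetime]_z (cN * dom x t (fun s => ind 0 (t - eps) s * (isqrt (t - s) * b s)) z)%:E
   < +oo)%E.
Proof.
move=> eps0 t0; apply: (le_lt_trans (integral_dom_le x eps0 t0)).
apply: (@le_lt_trans _ _ (cN%:E * ((beta * (2 * Num.sqrt t))%:E * (E x t)%:E))%E).
  by rewrite lee_wpmul2l ?lee_fin ?cN_ge0// lee_wpmul2r ?lee_fin ?heat_maj_ge0// vol_le.
by rewrite -!EFinM ltry.
Qed.

Lemma integrable_duh_int eps f x t : 0 <= eps -> 0 < t -> adm b f ->
  spacetime.-integrable [set: TR * X] (EFin \o duh_int eps f x t).
Proof.
move=> eps0 t0 fb; have [mf _] := fb.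
apply: integrable_le (fun z => duh_int_le x t z eps0 fb) (integral_dom_fin x eps0 t0).
- exact: measurable_duh_int.
- by apply: measurable_funM => //; apply: measurable_dom; exact: mw.
Qed.

Lemma duh_le eps f x t : 0 <= eps -> 0 < t -> adm b f ->
  (`|duh eps f x t|%:E <= cN%:E * (vol t * (E x t)%:E))%E.
Proof.
move=> eps0 t0 fb; have [mf _] := fb; apply: le_trans (integral_dom_le x eps0 t0).
apply: norm_fine_integral_le => //; last exact: integral_dom_fin.
- exact: measurable_duh_int.
- by apply: measurable_funM => //; apply: measurable_dom; exact: mw.
- by move=> z; exact: duh_int_le.
Qed.

(** The two integrands agree before t - eps, and the singular kernel has mass of order sqrt eps on
    what remains. *)
Lemma duh_delay_le eps f x t : 0 <= eps -> 0 < t -> adm b f ->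
  `|duh 0 f x t - duh eps f x t| <= cN * (beta * (2 * Num.sqrt (2 * eps)) * E x t).
Proof.
move=> eps0 t0 fb; have [mf fE] := fb.
rewrite -fine_integralB; [|exact: integrable_duh_int|exact: integrable_duh_int].
(* The window is twice the delay so that the open interval also contains the endpoint s = t -
   eps. *)
pose v s := ind (t - 2 * eps) t s * isqrt (t - s) * beta.
have mv : measurable_fun [set: R] v.
  apply: measurable_funM => //; apply: measurable_funM => //; exact: measurable_ind.
have v0 s : 0 <= v s by rewrite !mulr_ge0 ?ind_ge0 ?isqrt_ge0.
have mcd : measurable_fun [set: TR * X] (fun z => cN * dom x t v z).
  by apply: measurable_funM => //; exact: measurable_dom.
have le z : `|duh_int 0 f x t z - duh_int eps f x t z| <= cN * dom x t v z.
  have [/andP[s0 st]|ns] := boolP (0 < (z.1 : R) < t - eps).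
    have stt : z.1 < t - 0 by rewrite subr0 (lt_le_trans st)// lerBlDr lerDl.
    rewrite [X in _ - X](_ : _ = duh_int 0 f x t z).
      by rewrite subrr normr0 mulr_ge0 ?cN_ge0//; exact: dom_ge0.
    by apply: eq_bigr => i _; rewrite /dker (ind1 s0 st) (ind1 s0 stt).
  have -> : duh_int eps f x t z = 0.
    by apply: big1 => i _; rewrite /dker /ind (negbTE ns) !mul0r.
  rewrite subr0 (le_trans (duh_int_le x t z (lexx 0) fb))// ler_wpM2l ?cN_ge0//.
  rewrite /dom; apply: ler_wpM2r.
    by apply: mulr_ge0; [exact: hk_ge0|exact: heat_maj_ge0].
  have [/andP[s0 st]|nst] := boolP (0 < (z.1 : R) < t); last by rewrite /ind (negbTE nst) !mul0r.
  rewrite ler_wpM2l ?ind_ge0// /v subr0 (ind1 s0 st).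
  move: ns; rewrite s0/= -leNgt => ns.
  rewrite ind1//; last by move: st ns; lra.
  by rewrite !mul1r ler_wpM2l ?isqrt_ge0.
have I : (\int[spacetime]_z (cN * dom x t v z)%:E <=
   (cN * (beta * (2 * Num.sqrt (2 * eps)) * E x t))%:E)%E.
  rewrite int0Z ?cN_ge0//; [|exact: measurable_dom|by move=> z; exact: dom_ge0].
  rewrite integral_dom// [X in (_ <= X)%E]EFinM lee_wpmul2l ?lee_fin ?cN_ge0//.
  rewrite [X in (_ <= X)%E]EFinM lee_wpmul2r ?lee_fin ?heat_maj_ge0//.
  have m1 : measurable_fun [set: R] (fun s => ind (t - 2 * eps) t s * isqrt (t - s)).
    by apply: measurable_funM => //; exact: measurable_ind.
  have n1 s : 0 <= ind (t - 2 * eps) t s * isqrt (t - s).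
    by apply: mulr_ge0; [exact: ind_ge0|exact: isqrt_ge0].
  have teps : t - 2 * eps <= t by rewrite lerBlDr lerDl mulr_ge0.
  rewrite [X in (_ <= (beta * (2 * Num.sqrt X))%:E)%E](_ : _ = t - (t - 2 * eps)); last by ring.
  rewrite EFinM -integral_isqrt// -int0Z//; apply: le_int0.
  - by apply: measurable_funM => //; exact: measurable_ind.
  - exact: measurable_funM.
  - by move=> s; rewrite mulr_ge0 ?ind_ge0.
  - move=> s; rewrite /v [X in _ * X]mulrC ler_piMl ?ind_le1// mulr_ge0//.
rewrite -lee_fin; apply: (le_trans _ I); apply: norm_fine_integral_le => //.
  by apply: measurable_funB; exact: measurable_duh_int.
by apply: (le_lt_trans I); rewrite ltry.
Qed.

Lemma cvg_indM s t (t_ : nat -> R) (G_ : nat -> R) G : s != t -> t_ @ \oo --> t ->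
  (0 < s -> s < t -> G_ @ \oo --> G) ->
  ind 0 (t_ k) s * G_ k @[k --> \oo] --> ind 0 t s * G.
Proof.
move=> st tt hG; have [s0|s0] := leP s 0.
  have i0 u : ind 0 u s = 0 by rewrite /ind ltNge s0.
  by rewrite i0 mul0r; under eq_fun do rewrite i0 mul0r; exact: cvg_cst.
have [h|h] := ltP s t.
  rewrite (ind1 s0 h) mul1r; apply: cvg_trans (hG s0 h).
  apply: near_eq_cvg; apply: filterS (cvgr_gt _ tt _ h) => k tk.
  by rewrite (ind1 s0 tk) mul1r.
have h' : t < s by rewrite lt_neqAle eq_sym st.
rewrite (ind0 _ h) mul0r; apply: cvg_near_cst.
by apply: filterS (cvgr_lt _ tt _ h') => k tk; rewrite (ind0 _ (ltW tk)) mul0r.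
Qed.

(** The slice s = t, where the cut-off jumps and the kernel is singular, is null in space-time. *)
Lemma ae_time_neq t : {ae spacetime, forall z, (z.1 : R) != t}.
Proof.
have mt : measurable [set t : TR] by exact: measurable_set1.
exists ([set t : TR] `*` [set: X]); split.
- exact: measurableX.
- rewrite (_ : spacetime _ = (leb_time \x mu)%E ([set t : TR] `*` [set: X]))//.
  rewrite product_measure1E//.
  by rewrite [X in (X * _)%E](_ : _ = 0%E) ?mul0e//; exact: lebesgue_measure_set1.
- by move=> z /= /negP; rewrite negbK => /eqP zt; split.
Qed.

(** The source may change with k: the difference is bounded by the integral [dd] of |kernel_k -
    kernel| against beta E, in which no source occurs. The varying majorants [gg] have explicit
    integrals, so [gdct0] applies. *)
Lemma duh_diff_cvg0 (x_ : nat -> X) x (t_ : nat -> R) t (f_ : nat -> TR * X -> X) : 0 < t ->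
  (forall i, tnth (x_ k) i @[k --> \oo] --> tnth x i) -> t_ @ \oo --> t ->
  (forall k, t / 2 <= t_ k) -> (forall k, adm b (f_ k)) ->
  duh 0 (f_ k) (x_ k) (t_ k) - duh 0 (f_ k) x t @[k --> \oo] --> 0.
Proof.
move=> t0 xx tt tk fb; have tk0 k : 0 < t_ k by apply: lt_le_trans (tk k); rewrite divr_gt0.
pose gg x t z := cN * dom x t (fun s => isqrt (t - s) * beta) z.
pose dd k z := \sum_(i < N) `|dker 0 i (x_ k) (t_ k) z - dker 0 i x t z| * (beta * E z.2 z.1).
have mib u : measurable_fun [set: R] (fun s => isqrt (u - s) * beta) by exact: measurable_funM.
have ib0 u s : 0 <= isqrt (u - s) * beta by rewrite mulr_ge0 ?isqrt_ge0.
have mdom y u : measurable_fun [set: TR * X] (dom y u (fun s => isqrt (u - s) * beta)).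
  exact: measurable_dom.
have dom0 y u z : 0 <= dom y u (fun s => isqrt (u - s) * beta) z by exact: dom_ge0.
have mgg y u : measurable_fun [set: TR * X] (gg y u) by exact: measurable_funM.
have gg0 y u z : 0 <= gg y u z by rewrite mulr_ge0 ?cN_ge0.
have bE0 z : 0 <= beta * E z.2 z.1 by rewrite mulr_ge0 ?heat_maj_ge0.
have dd0 k z : 0 <= dd k z by apply: sumr_ge0 => i _; rewrite mulr_ge0.
have mdd k : measurable_fun [set: TR * X] (dd k).
  apply: measurable_sum => i; apply: measurable_funM.
    by apply: measurableT_comp => //; apply: measurable_funB; exact: measurable_dker.
  by apply: measurable_funM => //; exact: measurable_heat_maj.
have mi u : measurable_fun [set: R] (fun s => ind 0 u s * isqrt (u - s)).
  by apply: measurable_funM => //; exact: measurable_ind.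
have Igg y u : 0 < u -> (\int[spacetime]_z (gg y u z)%:E)%E =
    (cN * (beta * (2 * Num.sqrt u) * E y u))%:E.
  move=> u0; rewrite int0Z ?cN_ge0// integral_dom// [RHS]EFinM; congr (_ * _)%E.
  rewrite [RHS]EFinM; congr (_ * _)%E.
  rewrite -[X in Num.sqrt X]subr0 EFinM -(integral_isqrt (ltW u0)) -int0Z//.
  - by apply: eq_integral => s _; congr EFin; ring.
  - exact: mi.
  - by move=> s; rewrite mulr_ge0 ?ind_ge0 ?isqrt_ge0.
have kle i y u z : `|dker 0 i y u z| * (beta * E z.2 z.1) <= 2 `^ (N%:R / 2) *
    dom y u (fun s => isqrt (u - s) * beta) z.
  have := @dker_mul_le 0 i y u z (beta * E z.2 z.1) (fun=> beta) (lexx 0).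
  have nE := ger0_norm (bE0 z).
  rewrite nE normrM nE => /(_ (fun _ => lexx _)); move/le_trans; apply.
  rewrite ler_wpM2l ?powR_ge0// /dom; apply: ler_wpM2r.
    by apply: mulr_ge0; [exact: hk_ge0|exact: heat_maj_ge0].
  by rewrite ler_wpM2l ?ind_ge0// ler_piMl ?ind_le1.
have ddle k z : dd k z <= gg (x_ k) (t_ k) z + gg x t z.
  apply: (@le_trans _ _ (\sum_(i < N) (2 `^ (N%:R / 2) *
     dom (x_ k) (t_ k) (fun s => isqrt (t_ k - s) * beta) z + 2 `^ (N%:R / 2) *
     dom x t (fun s => isqrt (t - s) * beta) z))).
    apply: ler_sum => i _; apply: le_trans (lerD (kle i _ _ _) (kle i _ _ _)).
    by rewrite -mulrDl ler_wpM2r// ler_normB.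
  by rewrite sumr_const card_ord -mulrDr -[leLHS]mulr_natl /gg /cN -mulrDr mulrA.
have dd_cvg : fine (\int[spacetime]_z (dd k z)%:E) @[k --> \oo] --> 0.
  apply: (@gdct0 _ _ _ spacetime dd (fun k => gg (x_ k) (t_ k)) (gg x t)) => //.
  - by move=> k z; rewrite dd0 ddle.
  - by rewrite Igg// ltry.
  - by move=> k; rewrite Igg// ltry.
  - apply: filterS (ae_time_neq t) => z zt.
    rewrite [X in _ --> X](_ : 0 = \sum_(i < N) 0); last by rewrite big1.
    apply: cvg_bigsum => i.
    rewrite [X in _ --> X](_ : 0 = 0 * (beta * E z.2 z.1)); last by rewrite mul0r.
    apply: cvgM; last exact: cvg_cst.
    rewrite [X in _ --> X](_ : 0 = `|dker 0 i x t z - dker 0 i x t z|); last first.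
      by rewrite subrr normr0.
    apply: cvg_norm; apply: cvgB; last exact: cvg_cst.
    rewrite /dker subr0; under eq_fun do rewrite subr0.
    apply: cvg_indM => // s0 st; apply: cvg_dhk => //; first by rewrite subr_gt0.
    by apply: cvgB => //; exact: cvg_cst.
  - apply: filterS (ae_time_neq t) => z zt.
    apply: cvgM; first exact: cvg_cst.
    rewrite /dom -mulrA; under eq_fun do rewrite -mulrA.
    apply: cvg_indM => // s0 st.
    have ts : t_ k - z.1 @[k --> \oo] --> t - z.1 by apply: cvgB => //; exact: cvg_cst.
    apply: cvgM.
      apply: cvgM; last exact: cvg_cst.
      by apply: cvg_isqrt => //; rewrite gt_eqF// subr_gt0.
    apply: cvgM; last exact: cvg_cst.
    apply: cvg_hk => //; first by rewrite mulr_gt0// subr_gt0.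
    by apply: cvgM => //; exact: cvg_cst.
  - rewrite Igg//=; under eq_fun do rewrite Igg//=.
    apply: cvgM; first exact: cvg_cst.
    apply: cvgM; last exact: cvg_heat_maj.
    apply: cvgM; first exact: cvg_cst.
    apply: cvgM; first exact: cvg_cst.
    by apply: (cvg_comp t_ Num.sqrt tt); exact: sqrt_continuous.
have Idd k : (\int[spacetime]_z (dd k z)%:E < +oo)%E.
  apply: (@le_lt_trans _ _ (\int[spacetime]_z (gg (x_ k) (t_ k) z + gg x t z)%:E)%E).
    by apply: le_int0 => //; exact: measurable_funD.
  by rewrite int0D// !Igg// -EFinD ltry.
apply/cvgr0Pnorm_le => e e0.
apply: filterS (cvgr0_norm_le _ dd_cvg _ e0) => k; apply: le_trans.
rewrite -fine_integralB; [|exact: integrable_duh_int|exact: integrable_duh_int].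
rewrite [leRHS]ger0_norm ?fine_ge0 ?int0_ge0// -lee_fin fineK; last first.
  by rewrite ge0_fin_numE ?int0_ge0.
have [mf ff] := fb k.
apply: norm_fine_integral_le => //.
  by apply: measurable_funB; exact: measurable_duh_int.
move=> z; rewrite /duh_int -sumrB; apply: (le_trans (ler_norm_sum _ _ _)).
apply: ler_sum => i _; rewrite -mulrBl normrM.
have [z0|z0] := leP (z.1 : R) 0.
  have i0 u : ind 0 u z.1 = 0 by rewrite /ind ltNge z0.
  by rewrite /dker !i0 !mul0r subrr normr0 !mul0r.
by rewrite ler_wpM2l// (le_trans (ff z i z0))// ler_wpM2r ?heat_maj_ge0.
Qed.

Lemma measurable_duh eps f d (T : measurableType d) (a : T -> X) (c : T -> R) :
  measurable_fun [set: TR * X] f -> measurable_fun [set: T] a -> measurable_fun [set: T] c ->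
  measurable_fun [set: T] (fun w => duh eps f (a w) (c w)).
Proof.
move=> mf ma mc; apply: measurable_param_integral; apply: measurable_sum => i.
have mc1 : measurable_fun [set: T * (TR * X)] (fun w => c w.1) by exact: (measurableT_comp mc).
have ma1 : measurable_fun [set: T * (TR * X)] (fun w => a w.1) by exact: (measurableT_comp ma).
have m21 : measurable_fun [set: T * (TR * X)] (fun w => w.2.1 : R) by exact: (measurableT_comp mfst).
have m22 : measurable_fun [set: T * (TR * X)] (fun w => w.2.2) by exact: (measurableT_comp msnd).
apply: measurable_funM.
  apply: measurable_funM; first by apply: measurable_ind => //; exact: measurable_funB.
  by apply: measurable_dhk => //; exact: measurable_funB.
by apply: (measurableT_comp ((measurable_fun_tnthP _).1 mf i)).
Qed.

Definition mild f x t : R := heat_sg t phi x + duh 0 f x t.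

(** By contradiction: a failure yields points, times and admissible sources violating the estimate
    along a sequence, which [duh_diff_cvg0] excludes because it lets the sources vary. *)
Lemma mild_equicontinuous (x : X) (t e : R) : 0 < t -> 0 < e -> exists2 del, 0 < del &
  forall x' t', 0 < t' -> edist_t x x' < del -> `|t - t'| < del ->
  forall f, adm b f -> `|mild f x t - mild f x' t'| < e.
Proof.
move=> t0 e0; apply: contrapT => H.
have H' k : exists p : X * R * (TR * X -> X), [/\ edist_t x p.1.1 < k.+1%:R^-1,
    `|t - p.1.2| < k.+1%:R^-1, t / 2 <= p.1.2, adm b p.2 &
    e <= `|mild p.2 x t - mild p.2 p.1.1 p.1.2| ].
  apply: contrapT => H1; apply: H.
  (* The bound t/2 keeps the perturbed times above t/2, away from the singularity at time 0. *)
  exists (Num.min (k.+1%:R^-1) (t / 2)); first by rewrite lt_min invr_gt0 ltr0n divr_gt0.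
  move=> x' t' t'0; rewrite !lt_min => /andP[h1 h2] /andP[h3 h4] f fb.
  rewrite ltNge; apply/negP => h5; apply: H1; exists (x', t', f); split => //=.
  by move: h4; rewrite ltr_norml => /andP[]; lra.
have [p hp] := choice H'.
have inv0 : (fun k : nat => k.+1%:R^-1 : R) @ \oo --> 0 by exact: cvg_harmonic.
have xx i : tnth (p k).1.1 i @[k --> \oo] --> tnth x i.
  apply/cvgrPdist_le => d d0; apply: filterS (cvgr0_norm_le _ inv0 _ d0) => k; apply: le_trans.
  have [h _ _ _ _] := hp k; rewrite [leRHS]ger0_norm ?invr_ge0//.
  apply: le_trans (ltW h); rewrite /edist_t -sqrtr_sqr; apply: ler_wsqrtr.
  exact: (sqr_tnth_le_sqd x (p k).1.1 i).
have tt : (p k).1.2 @[k --> \oo] --> t.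
  apply/cvgrPdist_le => d d0; apply: filterS (cvgr0_norm_le _ inv0 _ d0) => k; apply: le_trans.
  by have [_ h _ _ _] := hp k; rewrite [leRHS]ger0_norm ?invr_ge0// ltW.
have tk k : t / 2 <= (p k).1.2 by have [_ _ h _ _] := hp k.
have fb k : adm b (p k).2 by have [_ _ _ h _] := hp k.
have c1 := duh_diff_cvg0 t0 xx tt tk fb.
have c2 : heat_sg (p k).1.2 phi (p k).1.1 - heat_sg t phi x @[k --> \oo] --> 0.
  rewrite -(subrr (heat_sg t phi x)); apply: cvgB; last exact: cvg_cst.
  exact: cvg_heat_sg.
have c3 : `|mild (p k).2 x t - mild (p k).2 (p k).1.1 (p k).1.2| @[k --> \oo] --> 0.
  have h : `|(heat_sg (p k).1.2 phi (p k).1.1 - heat_sg t phi x) +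
      (duh 0 (p k).2 (p k).1.1 (p k).1.2 - duh 0 (p k).2 x t)| @[k --> \oo] --> 0.
    rewrite [X in _ --> X](_ : 0 = `|0 + 0 : R|); last by rewrite addr0 normr0.
    by apply: cvg_norm; exact: cvgD.
  apply: (squeeze_cvgr _ (cvg_cst 0) h); apply: nearW => k; rewrite normr_ge0/= distrC.
  rewrite le_eqVlt; apply/orP; left; apply/eqP; congr (`|_|); rewrite /mild; ring.
have [k _ /(_ _ (leqnn _))] := cvgr0_norm_lt _ c3 _ e0.
by rewrite normr_id ltNge; have [_ _ _ _ ->] := hp k.
Qed.

End bounded_weight.

End duhamel.

(** * Compactness and the fixed point *)

Section extraction.
Context {R : realType} {N : nat}.
Notation X := (N.-tuple R).

(** Compactness of a segment gives a cluster point, and a cluster point of an ultrafilter is a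
    limit. *)
Lemma ultra_bounded_cvg (G : set_system nat) (u : nat -> R) (M : R) : UltraFilter G ->
  (forall n, `|u n| <= M) -> exists l : R, u @ G --> l.
Proof.
move=> GU uM.
have uG : (u @ G) `[- M, M]%classic.
  suff : \forall n \near G, `[- M, M]%classic (u n) by [].
  by apply: nearW => n; rewrite /= in_itv/= -ler_norml.
have [l [_ ul]] := @segment_compact R (- M) M (u @ G) _ uG.
exists l; apply/cvgrPdist_lt => e e0.
have [//|h] := in_ultra_setVsetC [set n | `|l - u n| < e] GU.
have Gc : (u @ G) [set u n | n in [set n | ~ `|l - u n| < e]].
  suff : \forall n \near G, [set u n | n in [set n | ~ `|l - u n| < e]] (u n) by [].
  by apply: filterS h => n hn /=; exists n.
have [r [[n /= hn <-]]] := ul _ (ball l e) Gc (nbhsx_ballx l e e0).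
by rewrite /ball/=.
Qed.

Lemma dense_rat_points (x : X) (t d : R) : 0 < t -> 0 < d ->
  exists q : rat * N.-tuple rat, [/\ 0 < ratr q.1 :> R,
    edist_t x [tuple ratr (tnth q.2 i) | i < N] < d & `|t - ratr q.1| < d].
Proof.
(* Coordinatewise error at most d/(N+1) gives squared distance at most N d^2/(N+1)^2 < d^2. *)
move=> t0 d0; pose e := d / N.+1%:R; have e0 : 0 < e by rewrite divr_gt0.
have [q1] : exists q, ratr q \in `]t, t + d[ by apply: rat_in_itvoo; rewrite ltrDl.
rewrite in_itv/= => /andP[tq qd].
have H i : exists q, ratr q \in `](tnth x i), (tnth x i + e)[.
  by apply: rat_in_itvoo; rewrite ltrDl.
have [q hq] := choice H.
exists (q1, [tuple q i | i < N]); split => /=.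
- exact: lt_trans tq.
- have h : sqd x [tuple ratr (tnth [tuple q i | i < N] i) | i < N] <= N%:R * e ^+ 2.
    rewrite mulr_natl -[X in _ *+ X]card_ord -sumr_const; apply: ler_sum => i _.
    rewrite !tnth_mktuple; have := hq i; rewrite in_itv/= => /andP[h1 h2].
    rewrite -sqrrN opprB -subr_ge0 subr_sqr mulr_ge0//; move: h1 h2; lra.
  rewrite -[d]ger0_norm ?ltW// -sqrtr_sqr ltr_sqrt ?exprn_gt0//.
  apply: (le_lt_trans h); rewrite /e expr_div_n mulrCA gtr_pMr ?exprn_gt0//.
  rewrite ltr_pdivrMr ?exprn_gt0// mul1r expr2 -natrM ltr_nat.
  by rewrite mulSn addSn ltnS leq_addr.
- by rewrite distrC gtr0_norm ?subr_gt0//; move: qd; lra.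
Qed.

Definition rat_point (j : nat) : X * R :=
  let q := odflt (0%Q, [tuple 0%Q | i < N]) (unpickle j) in
  ([tuple ratr (tnth q.2 i) | i < N], ratr q.1).

Variable v : nat -> X -> R -> R.
Hypothesis v_bounded : forall (x : X) (t : R), 0 < t -> exists M : R, forall k, `|v k x t| <= M.
Hypothesis v_equi : forall (x : X) (t : R), 0 < t -> forall e : R, 0 < e -> exists2 d : R, 0 < d &
  forall (x' : X) (t' : R), 0 < t' -> edist_t x x' < d -> `|t - t'| < d ->
  forall k, `|v k x t - v k x' t'| < e.

(** An ultrafilter replaces the diagonal argument: limits at all rational points exist along it
    simultaneously, and n_k is picked where the first k of them are reached up to 1/(k+1).
    Equicontinuity then makes the sequence Cauchy at every point. The bound k <= n_k suffices in
    place of strict monotonicity. *)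
Lemma arzela_extraction : exists (n_ : nat -> nat) (u : X -> R -> R),
  (forall k, (k <= n_ k)%N) /\
  forall x t, 0 < t -> v (n_ k) x t @[k --> \oo] --> u x t.
Proof.
have [G [GU GF]] := ultraFilterLemma (@eventually_filter).
(* The enumeration also meets nonpositive times, where nothing is known about [v]; there the value
   is set to 0. *)
pose w j k := if 0 < (rat_point j).2 then v k (rat_point j).1 (rat_point j).2 else 0.
have w_cvg j : exists l : R, w j @ G --> l.
  have [M hM] : exists M, forall k, `|w j k| <= M.
    have [h|h] := boolP (0 < (rat_point j).2).
      by have [M hM] := v_bounded (rat_point j).1 h; exists M => k; rewrite /w h.
    by exists 0 => k; rewrite /w (negbTE h) normr0.
  exact: ultra_bounded_cvg GU hM.
have [l hl] := choice w_cvg.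
have H k : exists n, (k <= n)%N /\ forall j : 'I_k, `|l j - w j n| < k.+1%:R^-1.
  have h1 : \forall n \near G, forall j : 'I_k, `|l j - w j n| < k.+1%:R^-1.
    apply: filter_forall => j; have := hl j; move/cvgrPdist_lt; apply.
    by rewrite invr_gt0.
  have h2 : \forall n \near G, (k <= n)%N by apply: GF; exists k.
  have [n [a1 a2]] := filter_ex (filterI h1 h2).
  by exists n.
have [n_ hn] := choice H.
have key x t : 0 < t -> exists u : R, v (n_ k) x t @[k --> \oo] --> u.
  move=> t0; apply/cvg_ex; apply: cauchy_cvg; apply/cauchy_exP => e e0.
  have e30 : 0 < e / 3 by rewrite divr_gt0.
  have [d d0 hd] := v_equi x t0 e30.
  have [q [q0 qx qt]] := dense_rat_points x t0 d0.
  pose j := pickle q.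
  have rpj : rat_point j = ([tuple ratr (tnth q.2 i) | i < N], ratr q.1).
    by rewrite /rat_point /j pickleK.
  exists (l j).
  have inv0 : (fun k : nat => k.+1%:R^-1 : R) @ \oo --> 0 by exact: cvg_harmonic.
  have inv1 := cvgr0_norm_lt _ inv0 _ e30.
  have [k0 _ hk0] := inv1.
  exists (maxn k0 j.+1) => // k; rewrite /= geq_max => /andP[/hk0 h1 h2].
  rewrite ger0_norm ?invr_ge0// in h1.
  have [_ /(_ (Ordinal h2))/= h3] := hn k.
  rewrite /ball/=; have := hd _ _ q0 qx qt (n_ k).
  move: h3 h1; rewrite /w rpj/= q0.
  set a := l j; set b := v _ _ (ratr _); set c := v _ x t; move=> h3 h1 h4.
  apply: (le_lt_trans (ler_distD b a c)); rewrite [X in _ + X]distrC.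
  have -> : e = e / 3 + (e / 3 + e / 3) by field.
  apply: ltrD; first exact: lt_trans h1.
  by apply: (lt_le_trans h4); rewrite lerDl ltW.
pose u x t := if pselect (0 < t) is left h then projT1 (cid (key x t h)) else 0.
exists n_, u; split => [k|x t t0]; first by have [] := hn k.
by rewrite /u; case: pselect => // h; exact: (projT2 (cid (key x t h))).
Qed.

End extraction.

(** * Measurability of a continuous function of measurable arguments *)

Section continuous_measurable.
Context {R : realType}.

(** The function is constant on each of countably many measurable pieces, so a preimage is a
    countable union of pieces. *)
Lemma countable_comp_measurable d (T : measurableType d) (K : countType)
    (code : T -> K -> Prop) (g : K -> R) (f : T -> R) :
  (forall k, measurable [set w | code w k]) -> (forall w, exists k, code w k) ->
  (forall w k, code w k -> f w = g k) -> measurable_fun [set: T] f.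
Proof.
move=> mc ex fg _ Y mY; rewrite setTI.
rewrite (_ : f @^-1` Y = \bigcup_n
    (if unpickle n is Some k then [set w | code w k /\ Y (g k)] else set0)).
  apply: bigcupT_measurable => n; case: unpickle => [k|]; last exact: measurable0.
  have [h|h] := pselect (Y (g k)).
    by rewrite (_ : [set _ | _] = [set w | code w k])//; apply/seteqP; split => w //= [].
  rewrite (_ : [set _ | _] = set0); first exact: measurable0.
  by apply/seteqP; split => w //= [].
apply/seteqP; split => [w Yw|w [n _]].
  have [k hk] := ex w; exists (pickle k) => //; rewrite pickleK/=; split => //.
  by rewrite -(fg _ _ hk).
by case: unpickle => [k|//] [hk Yk]; rewrite /= (fg _ _ hk).
Qed.

Definition rnd (n : nat) (r : R) : R := (Num.floor (n.+1%:R * r))%:~R / n.+1%:R.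

Lemma measurable_floor_intr : measurable_fun [set: R] (fun r : R => (Num.floor r)%:~R : R).
Proof.
apply: nondecreasing_measurable => // x y xy.
by rewrite ler_int; exact: le_floor.
Qed.

Lemma rnd_dist n r : `|r - rnd n r| <= n.+1%:R^-1.
Proof.
have n0 : 0 < n.+1%:R :> R by [].
have /andP[h1 h2] := floor_itv (n.+1%:R * r).
rewrite intrD in h2.
have -> : r - rnd n r = (n.+1%:R * r - (Num.floor (n.+1%:R * r))%:~R) / n.+1%:R.
  by rewrite /rnd mulrBl mulrAC divff ?gt_eqF// mul1r.
rewrite normrM (ger0_norm (x := n.+1%:R^-1)) ?invr_ge0// -[leRHS]mul1r ler_wpM2r ?invr_ge0//.
by rewrite ger0_norm ?subr_ge0// lerBlDl addrC ltW// addrC.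
Qed.

Lemma cvg_rnd r : rnd n r @[n --> \oo] --> r.
Proof.
have inv0 : (fun k : nat => k.+1%:R^-1 : R) @ \oo --> 0 by exact: cvg_harmonic.
apply/cvgrPdist_le => e e0; apply: filterS (cvgr0_norm_le _ inv0 _ e0) => n; apply: le_trans.
by rewrite [leRHS]ger0_norm ?invr_ge0// rnd_dist.
Qed.

Context {N : nat}.
Notation X := (N.-tuple R).

(** Continuity is given only in epsilon-delta form for [edist_t]. The arguments are rounded to a
    grid of mesh 1/(n+1), where countably many values occur, and the composition is the pointwise
    limit as n grows. *)
Lemma measurable_continuous_comp (F : X -> R -> R -> X) d (T : measurableType d)
    (a : T -> X) (c u : T -> R) :
  (forall x t p, 0 < t -> forall e, 0 < e -> exists2 d, 0 < d &
     forall x' t' p', 0 < t' -> edist_t x x' < d -> `|t - t'| < d -> `|p - p'| < d ->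
       edist_t (F x t p) (F x' t' p') < e) ->
  measurable_fun [set: T] a -> measurable_fun [set: T] c -> measurable_fun [set: T] u ->
  measurable_fun [set: T] (fun w => if 0 < c w then F (a w) (c w) (u w) else origin N).
Proof.
move=> Fc ma mc0 mu.
have mp : measurable_fun [set: T] (fun w => 0 < c w) by exact: measurable_fun_ltr.
(* Times outside the domain of continuity are replaced by the harmless value 1, so that the limit
   argument holds at every point. *)
pose c' w := if 0 < c w then c w else 1.
have mc : measurable_fun [set: T] c' by exact: measurable_fun_ifT.
have c'0 w : 0 < c' w by rewrite /c'; case: ifP.
rewrite (_ : (fun _ => _) = fun w => if 0 < c w then F (a w) (c' w) (u w) else origin N); last first.
  by apply/funext => w; rewrite /c'; case: ifP.
apply: measurable_fun_ifT => //; apply/measurable_fun_tnthP => i.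
pose ra n (x : X) : X := [tuple rnd n (tnth x j) | j < N].
pose rc n r : R := rnd n r + n.+1%:R^-1.
apply: (measurable_fun_cvg (h := fun n w => tnth (F (ra n (a w)) (rc n (c' w)) (rnd n (u w))) i)).
  move=> n.
  pose fl (r : R) := Num.floor (n.+1%:R * r).
  have mfl (g : T -> R) k : measurable_fun [set: T] g -> measurable [set w | fl (g w) = k].
    move=> mg; have h : measurable_fun [set: T] (fun w => (fl (g w))%:~R : R).
      by apply: (measurableT_comp measurable_floor_intr); exact: measurable_funM.
    rewrite (_ : [set _ | _] = setT `&` (fun w => (fl (g w))%:~R : R) @^-1` [set k%:~R]).
      by apply: h => //; exact: measurable_set1.
    rewrite setTI; apply/seteqP; split => w /= [].
      by move=> ->.
    by move/intr_inj.
  pose code w (k : N.-tuple int * int * int) :=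
    (forall j, fl (tnth (a w) j) = tnth k.1.1 j) /\ fl (c' w) = k.1.2 /\ fl (u w) = k.2.
  apply: (@countable_comp_measurable _ _ _ code (fun k =>
    tnth (F [tuple (tnth k.1.1 j)%:~R / n.+1%:R | j < N]
      (k.1.2%:~R / n.+1%:R + n.+1%:R^-1) (k.2%:~R / n.+1%:R)) i)).
  - move=> k; rewrite (_ : [set _ | _] = (\bigcap_j [set w | fl (tnth (a w) j) = tnth k.1.1 j])
        `&` ([set w | fl (c' w) = k.1.2] `&` [set w | fl (u w) = k.2])); last first.
      apply/seteqP; split => [w [h1 h2]|w [h1 h2]]; split => // j; last exact: h1.
      by move=> _; exact: h1.
    apply: measurableI; last by apply: measurableI; exact: mfl.
    apply: fin_bigcap_measurable; first exact: finite_finset.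
    by move=> j _; apply: mfl; exact: (measurable_fun_tnthP _).1.
  - move=> w; exists ([tuple fl (tnth (a w) j) | j < N], fl (c' w), fl (u w)).
    by split => // j; rewrite tnth_mktuple.
  - move=> w k [h1 [h2 h3]]; rewrite /rc /ra /rnd -/(fl (c' w)) -/(fl (u w)) h2 h3.
    congr (tnth (F _ _ _) i); apply: eq_from_tnth => j.
    by rewrite !tnth_mktuple -/(fl _) h1.
move=> w _; apply/cvgrPdist_lt => e e0.
have [dl dl0 hd] := Fc (a w) (c' w) (u w) (c'0 w) e e0.
have inv0 : (fun k : nat => k.+1%:R^-1 : R) @ \oo --> 0 by exact: cvg_harmonic.
have h1 : edist_t (a w) (ra n (a w)) @[n --> \oo] --> 0.
  rewrite [X in _ --> X](_ : 0 = edist_t (a w) (a w)); last first.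
    by rewrite /edist_t big1 ?sqrtr0// => j _; rewrite subrr expr0n.
  apply: (cvg_comp (fun n => sqd (a w) (ra n (a w))) Num.sqrt); last exact: sqrt_continuous.
  rewrite /sqd; apply: cvg_bigsum => j; rewrite !expr2.
  under eq_fun do rewrite expr2 tnth_mktuple.
  by apply: cvgM; apply: cvgB; [exact: cvg_cst|exact: cvg_rnd|exact: cvg_cst|exact: cvg_rnd].
have h2 : rc n (c' w) @[n --> \oo] --> c' w.
  by rewrite -[X in _ --> X]addr0; apply: cvgD => //; exact: cvg_rnd.
have g1 := cvgr0_norm_lt _ h1 _ dl0.
have g2 := (iffLR (cvgrPdist_lt _ _)) h2 _ dl0.
have g3 := (iffLR (cvgrPdist_lt _ _)) (@cvg_rnd (u w)) _ dl0.
have g4 := cvgr_gt _ h2 _ (c'0 w).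
have [n1 _ {}g1] := g1; have [n2 _ {}g2] := g2; have [n3 _ {}g3] := g3; have [n4 _ {}g4] := g4.
exists (maxn (maxn n1 n2) (maxn n3 n4)) => // n; rewrite /= !geq_max.
move=> /andP[/andP[/g1 k1 /g2 k2] /andP[/g3 k3 /g4 k4]].
rewrite ger0_norm ?sqrtr_ge0// in k1.
apply: le_lt_trans (hd _ _ _ k4 k1 k2 k3).
by rewrite /edist_t -sqrtr_sqr; apply: ler_wsqrtr; exact: sqr_tnth_le_sqd.
Qed.

End continuous_measurable.

(** * Delayed approximations and their limit *)

Section fixed_point.
Context {R : realType} {N : nat} (phi : N.-tuple R -> R).
Hypothesis mphi : measurable_fun [set: N.-tuple R] phi.
Hypothesis iphi : (\int[tuple_leb N]_x (`|phi x|)%:E < +oo)%E.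
Notation X := (N.-tuple R).
Notation mu := (tuple_leb N).
Notation TR := (measurableTypeR R).
Notation E := (heat_maj phi).
Notation cN := (@cN R N).
Implicit Types (x y : X) (s t eps : R) (z : TR * X) (f : TR * X -> X).

Variables (F : X -> R -> R -> X) (C gam : R).
Hypothesis F_cont : forall x t p, 0 < t -> forall e, 0 < e -> exists2 d, 0 < d &
     forall x' t' p', 0 < t' -> edist_t x x' < d -> `|t - t'| < d -> `|p - p'| < d ->
       edist_t (F x t p) (F x' t' p') < e.
Hypotheses (C0 : 0 < C) (gam_gt : 2^-1 < gam).
Hypothesis F_le : forall x t p, 0 < t -> enorm_t (F x t p) <= C * (1 + t) `^ (- gam) * `|p|.

Definition nonlin (u : X -> R -> R) z : X :=
  if 0 < z.1 :> R then F z.2 z.1 (u z.2 z.1) else origin N.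

(** Freezing the weight at nonpositive times keeps it in [0,1] on the whole line, as the
    bounded-weight estimates require. *)
Definition pweight s : R := (1 + Num.max s 0) `^ (- gam).

Lemma pweightE s : 0 < s -> pweight s = (1 + s) `^ (- gam).
Proof. by move=> s0; rewrite /pweight max_l// ltW. Qed.

Lemma pweight_ge0 s : 0 <= pweight s.
Proof. exact: powR_ge0. Qed.

Lemma pweight_le1 s : pweight s <= 1.
Proof.
have g0 : 0 <= gam by rewrite (le_trans _ (ltW gam_gt))// invr_ge0.
rewrite /pweight -[leRHS](powRr0 (1 + Num.max s 0)) ler_powR ?oppr_le0//.
by rewrite lerDl le_max lexx orbT.
Qed.

Lemma measurable_pweight : measurable_fun [set: R] pweight.
Proof.
apply: (measurableT_comp (measurable_powR _)); apply: measurable_funD => //.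
exact: measurable_maxr.
Qed.

Lemma F_tnth_le x t p (B : R) i : 0 < t -> `|p| <= B ->
  `|tnth (F x t p) i| <= C * pweight t * B.
Proof.
move=> t0 pB; apply: (@le_trans _ _ (enorm_t (F x t p))).
  rewrite /enorm_t -sqrtr_sqr; apply: ler_wsqrtr.
  by rewrite (bigD1 i)//= lerDl sumr_ge0// => j _; exact: sqr_ge0.
rewrite (le_trans (F_le _ _ t0))// -pweightE// ler_wpM2l// mulr_ge0 ?pweight_ge0//.
exact: ltW.
Qed.

(** Agrees with [heat_sg] for t > 0; as a single parametric integral it is measurable in (x,t) for
    all real t. *)
Definition heat_ext x t : R := fine (\int[mu]_y (hk x y t * phi y)%:E).

Lemma measurable_heat_ext d (T : measurableType d) (a : T -> X) (c : T -> R) :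
  measurable_fun [set: T] a -> measurable_fun [set: T] c ->
  measurable_fun [set: T] (fun w => heat_ext (a w) (c w)).
Proof.
move=> ma mc; apply: measurable_param_integral; apply: measurable_funM.
  by apply: measurable_hk => //; [exact: (measurableT_comp ma)|exact: (measurableT_comp mc)].
exact: (measurableT_comp mphi).
Qed.

Definition picard eps f z : X :=
  if 0 < z.1 :> R then F z.2 z.1 (heat_ext z.2 z.1 + duh eps f z.2 z.1) else origin N.

Lemma measurable_picard eps f : measurable_fun [set: TR * X] f ->
  measurable_fun [set: TR * X] (picard eps f).
Proof.
move=> mf.
have m1 : measurable_fun [set: TR * X] (fun z => z.1 : R) by exact: measurable_fst_TR.
have m2 : measurable_fun [set: TR * X] (fun z => z.2) by exact: measurable_snd.
apply: (@measurable_continuous_comp _ _ F _ _ (fun z => z.2) (fun z => z.1 : R)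
  (fun z => heat_ext z.2 z.1 + duh eps f z.2 z.1)) => //.
apply: measurable_funD; first exact: measurable_heat_ext.
exact: measurable_duh.
Qed.

Fixpoint picard_iter eps n : TR * X -> X :=
  if n is m.+1 then picard eps (picard_iter eps m) else cst (origin N).

(* The delay [eps] makes [picard eps] depend on the past only, so the iterates stabilise. *)
Lemma picard_iter_stable eps n z : z.1 <= n%:R * eps ->
  picard_iter eps n.+1 z = picard_iter eps n z.
Proof.
elim: n z => [|n IH] z hz.
  by rewrite /= /picard ltNge; rewrite mul0r in hz; rewrite hz.
rewrite [LHS]/= [RHS]/= /picard; case: ifPn => // z0; congr (F _ _ (_ + _)).
congr fine; apply: eq_integral => w _; congr EFin; apply: eq_bigr => i _.
have [/andP[w0 wt]|nw] := boolP (0 < (w.1 : R) < z.1 - eps); last first.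
  by rewrite /dker /ind (negbTE nw) !mul0r.
congr (_ * tnth _ _); apply: IH; move: hz wt; rewrite -natr1 mulrDl mul1r; lra.
Qed.

Let c0 : R := 2 `^ (N%:R / 2).

Section with_majorant.
Variables (h : R -> R) (H : R).
Hypotheses (mh : measurable_fun [set: R] h) (hH : forall s, 0 <= h s <= H).
Hypothesis h_maj : forall t, 0 < t -> (c0%:E + (cN * C)%:E *
  \int[@lebesgue_measure R]_s
     (ind 0 t s * (isqrt (t - s) * ((1 + s) `^ (- gam) * h s)))%:E <= (h t)%:E)%E.

Let b s : R := C * (pweight s * h s).

Let h_ge0 s : 0 <= h s. Proof. by case/andP: (hH s). Qed.
Let h_le s : h s <= H. Proof. by case/andP: (hH s). Qed.

Let mb : measurable_fun [set: R] b.
Proof.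
by apply: measurable_funM => //; apply: measurable_funM => //; exact: measurable_pweight.
Qed.

Let b_bnd s : 0 <= b s <= C * H.
Proof.
apply/andP; split; first by rewrite mulr_ge0 ?(ltW C0)// mulr_ge0 ?pweight_ge0.
rewrite ler_wpM2l ?(ltW C0)// (le_trans _ (h_le s))// ler_piMl//; exact: pweight_le1.
Qed.

Let volE t : (cN%:E * vol b t = (cN * C)%:E *
  \int[@lebesgue_measure R]_s
     (ind 0 t s * (isqrt (t - s) * ((1 + s) `^ (- gam) * h s)))%:E)%E.
Proof.
have mg : measurable_fun [set: R]
    (fun s => ind 0 t s * (isqrt (t - s) * ((1 + s) `^ (- gam) * h s))).
  by apply: measurable_itv_isqrt; apply: measurable_funM => //; exact: measurable_1DpowR.
have g0 s : 0 <= ind 0 t s * (isqrt (t - s) * ((1 + s) `^ (- gam) * h s)).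
  by rewrite !mulr_ge0 ?ind_ge0 ?isqrt_ge0 ?powR_ge0.
have -> : vol b t = (C%:E * \int[@lebesgue_measure R]_s
     (ind 0 t s * (isqrt (t - s) * ((1 + s) `^ (- gam) * h s)))%:E)%E.
  rewrite -int0Z; [|exact: mg|exact: g0|exact: ltW].
  apply: eq_integral => s _; congr EFin; rewrite /b /ind; case: ifPn => [/andP[s0 _]|_].
    by rewrite pweightE// !mul1r mulrCA.
  by rewrite !mul0r mulr0.
by rewrite muleA.
Qed.

Lemma picard_arg_le eps f x t : 0 <= eps -> 0 < t -> adm phi b f ->
  `|heat_ext x t + duh eps f x t| <= h t * E x t.
Proof.
move=> eps0 t0 fb; rewrite -lee_fin.
apply: (@le_trans _ _ ((c0%:E + cN%:E * vol b t) * (E x t)%:E)%E); last first.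
  by rewrite [X in (_ <= X)%E]EFinM lee_wpmul2r ?lee_fin ?heat_maj_ge0// volE h_maj.
rewrite ge0_muleDl ?lee_fin ?powR_ge0//; last first.
  rewrite mule_ge0 ?lee_fin ?cN_ge0//; apply: int0_ge0 => s.
  have /andP[b0 _] := b_bnd s; apply: mulr_ge0; first exact: ind_ge0.
  by apply: mulr_ge0; first exact: isqrt_ge0.
apply: (le_trans (y := (`|heat_ext x t|%:E + `|duh eps f x t|%:E)%E)).
  by rewrite -EFinD lee_fin ler_normD.
rewrite -muleA; apply: leeD; last exact: (duh_le mphi iphi mb b_bnd).
by rewrite -EFinM lee_fin /heat_ext -heat_sgE//; exact: heat_sg_le.
Qed.

Lemma adm_picard eps f : 0 <= eps -> adm phi b f -> adm phi b (picard eps f).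
Proof.
move=> eps0 fb; split; first by apply: measurable_picard; case: fb.
move=> z i z0; rewrite /picard z0.
apply: (le_trans (F_tnth_le _ _ z0 (picard_arg_le _ eps0 z0 fb))).
by rewrite /b !mulrA.
Qed.

Lemma adm_picard_iter eps n : 0 <= eps -> adm phi b (picard_iter eps n).
Proof.
move=> eps0; elim: n => [|n IH]; last exact: adm_picard.
split; first exact: measurable_cst.
move=> z i _; rewrite tnth_mktuple normr0.
by have /andP[b0 _] := b_bnd z.1; rewrite mulr_ge0 ?heat_maj_ge0.
Qed.

(** With delay 1/(k+1), the iterate of index (k+1)^2 is stable up to time k + 1, so [f_ k] solves
    the delayed equation exactly for times up to k. *)
Let f_ k := picard_iter k.+1%:R^-1 (k.+1 * k.+1).

Let inv_ge0 (k : nat) : 0 <= k.+1%:R^-1 :> R. Proof. by rewrite invr_ge0. Qed.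

Let f_adm k : adm phi b (f_ k). Proof. exact: adm_picard_iter. Qed.

Let f_fix k z : z.1 <= k%:R -> f_ k z = picard k.+1%:R^-1 (f_ k) z.
Proof.
move=> zk; rewrite -[RHS]/(picard_iter _ (k.+1 * k.+1).+1 z) picard_iter_stable//.
rewrite natrM mulfK ?pnatr_eq0//; apply: (le_trans zk); rewrite ler_nat; exact: leqnSn.
Qed.

Lemma mildE f x t : 0 < t -> mild phi f x t = heat_ext x t + duh 0 f x t.
Proof. by move=> t0; rewrite /mild heat_sgE. Qed.

(** Extraction is applied to the undelayed formula with source [f_ k], while [f_ k] itself is [F] of
    the delayed one. The delay error vanishes, so both have the limit u; continuity of [F] gives
    convergence of the sources, and dominated convergence passes to the limit in the Duhamel
    term. *)
Lemma mild_fixed_point : exists u : X -> R -> R,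
  (forall x t, 0 < t -> `|u x t| <= H * E x t) /\
  adm phi (fun s => C * H * pweight s) (nonlin u) /\
  forall x t, 0 < t -> u x t = mild phi (nonlin u) x t.
Proof.
have vb x t : 0 < t -> forall k, `|mild phi (f_ k) x t| <= h t * E x t.
  by move=> t0 k; rewrite mildE//; exact: picard_arg_le.
have [||n_ [u [nk uv]]] := @arzela_extraction R N (fun k => mild phi (f_ k)).
- by move=> x t t0; exists (h t * E x t); exact: vb.
- move=> x t t0 e e0; have [d d0 hd] := mild_equicontinuous mphi iphi mb b_bnd x t0 e0.
  by exists d => // x' t' t'0 h1 h2 k; exact: (hd _ _ t'0 h1 h2).
have uh x t : 0 < t -> `|u x t| <= h t * E x t.
  move=> t0; have c : `|mild phi (f_ (n_ k)) x t| @[k --> \oo] --> `|u x t|.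
    by apply: cvg_norm; exact: uv.
  rewrite -(cvg_lim _ c)//; apply: limr_le; first by apply/cvg_ex; exists `|u x t|.
  by apply: nearW => k; exact: vb.
have uH x t : 0 < t -> `|u x t| <= H * E x t.
  by move=> t0; rewrite (le_trans (uh x t t0))// ler_wpM2r ?heat_maj_ge0.
exists u; split => //; set f := nonlin u.
have inv0 : (fun k : nat => k.+1%:R^-1 : R) @ \oo --> 0 by exact: cvg_harmonic.
have delay x t : 0 < t ->
    heat_ext x t + duh (n_ k).+1%:R^-1 (f_ (n_ k)) x t @[k --> \oo] --> u x t.
  move=> t0; have c := uv x t t0.
  have dc : duh 0 (f_ (n_ k)) x t - duh (n_ k).+1%:R^-1 (f_ (n_ k)) x t @[k --> \oo] --> 0.
    have g0 : cN * (C * H * (2 * Num.sqrt (2 * k.+1%:R^-1)) * E x t) @[k --> \oo] --> 0.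
      rewrite [X in _ --> X](_ : 0 = cN * (C * H * (2 * Num.sqrt (2 * 0)) * E x t)); last first.
        by rewrite mulr0 sqrtr0 !(mulr0, mul0r).
      apply: cvgM; first exact: cvg_cst.
      apply: cvgM; last exact: cvg_cst.
      apply: cvgM; first exact: cvg_cst.
      apply: cvgM; first exact: cvg_cst.
      apply: (cvg_comp (fun k : nat => 2 * k.+1%:R^-1 : R) Num.sqrt); last exact: sqrt_continuous.
      by apply: cvgM => //; exact: cvg_cst.
    apply/cvgr0Pnorm_le => e e0; apply: filterS (cvgr0_norm_le _ g0 _ e0) => k.
    apply: le_trans; apply: le_trans (ler_norm _).
    apply: (le_trans (duh_delay_le mphi iphi mb b_bnd x (inv_ge0 _) t0 (f_adm _))).
    rewrite ler_wpM2l ?cN_ge0// ler_wpM2r ?heat_maj_ge0// ler_wpM2l//.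
      by have /andP[a1 a2] := b_bnd 0; exact: le_trans a2.
    rewrite ler_wpM2l//; apply: ler_wsqrtr; rewrite ler_wpM2l// lef_pV2 ?posrE//.
    by rewrite ler_nat ltnS.
  rewrite -[u x t]subr0 (_ : (fun k => _) = (fun k => mild phi (f_ (n_ k)) x t -
      (duh 0 (f_ (n_ k)) x t - duh (n_ k).+1%:R^-1 (f_ (n_ k)) x t))).
    exact: cvgB.
  by apply/funext => k; rewrite mildE//; ring.
have f_cvg z i : tnth (f_ (n_ k) z) i @[k --> \oo] --> tnth (f z) i.
  have [z0|z0] := leP (z.1 : R) 0.
    (* The iterate has successor index, so at nonpositive times it takes the default value of
       [picard]. *)
    have E0 k : f_ k z = origin N by rewrite /f_ mulSn addSn /= /picard ltNge z0.
    under eq_fun do rewrite E0.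
    by rewrite /f /nonlin ltNge z0; exact: cvg_cst.
  rewrite /f /nonlin z0; apply/cvgrPdist_lt => e e0.
  have [d d0 hd] := F_cont z.2 (u z.2 z.1) z0 e0.
  have := (iffLR (cvgrPdist_lt _ _)) (delay z.2 z.1 z0) _ d0.
  have [k0 hk0] : exists k0 : nat, (z.1 : R) <= k0%:R.
    by exists (Num.truncn (z.1 : R)).+1; rewrite ltW// truncnS_gt.
  move=> [k1 _ hk1]; exists (maxn k0 k1) => // k; rewrite /= geq_max => /andP[h0 /hk1 h1].
  rewrite f_fix; last first.
    by apply: (le_trans hk0); rewrite ler_nat (leq_trans h0).
  rewrite /picard z0.
  have dd x : edist_t x x = 0.
    by rewrite /edist_t big1 ?sqrtr0// => j _; rewrite subrr expr0n.
  have := hd z.2 z.1 _ z0; rewrite dd subrr normr0 => /(_ _ d0 d0 h1).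
  apply: le_lt_trans.
  by rewrite /edist_t -sqrtr_sqr; apply: ler_wsqrtr; exact: sqr_tnth_le_sqd.
have mf : measurable_fun [set: TR * X] f.
  apply/measurable_fun_tnthP => i.
  apply: (measurable_fun_cvg (h := fun k z => tnth (f_ (n_ k) z) i)).
    by move=> k; have [mk _] := f_adm (n_ k); exact: (measurable_fun_tnthP _).1.
  by move=> z _; exact: f_cvg.
(* Here h is replaced by its bound H, so that the exported weight is an explicit multiple of
   [pweight]; the limit passage below keeps the finer weight b. *)
split.
  split => // z i z0; rewrite /f /nonlin z0 [leRHS](_ : _ = C * pweight z.1 * (H * E z.2 z.1)); last by ring.
  by apply: F_tnth_le => //; exact: uH.
move=> x t t0.
have fb : adm phi b f.
  split=> // z i z0; rewrite /f /nonlin z0 /b [leRHS](_ : _ = C * pweight z.1 * (h z.1 * E z.2 z.1)).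
    by apply: F_tnth_le => //; exact: uh.
  by rewrite !mulrA.
have c1 : mild phi (f_ (n_ k)) x t @[k --> \oo] --> mild phi f x t.
  apply: cvgD; first exact: cvg_cst.
  apply: (dct (g := fun z => cN * dom phi x t (fun s => ind 0 (t - 0) s * (isqrt (t - s) * b s)) z)).
  - by move=> k; apply: measurable_duh_int; case: (f_adm (n_ k)).
  - exact: measurable_duh_int.
  - apply: measurable_funM => //; apply: measurable_dom => //.
    by rewrite subr0; exact: measurable_itv_isqrt.
  - by move=> k z; exact: duh_int_le.
  - exact: (integral_dom_fin mphi iphi mb b_bnd).
  - apply: aeW => z; apply: cvg_bigsum => i; apply: cvgM; first exact: cvg_cst.
    exact: f_cvg.
exact: (cvg_unique _ (uv x t t0) c1).
Qed.

End with_majorant.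

Lemma mild_solution : exists (u : X -> R -> R) (H : R), 0 <= H /\
  (forall x t, 0 < t -> `|u x t| <= H * E x t) /\
  adm phi (fun s => C * H * pweight s) (nonlin u) /\
  forall x t, 0 < t -> u x t = mild phi (nonlin u) x t.
Proof.
have c00 : 0 <= c0 by exact: powR_ge0.
have cC : 0 <= cN * C by rewrite mulr_ge0 ?cN_ge0// ltW.
have [h [H [mh hH hm]]] := volterra_majorant c00 cC gam_gt.
have [u hu] := mild_fixed_point mh hH hm.
exists u, H; split => //; have /andP[a1 a2] := hH 0; exact: le_trans a2.
Qed.

End fixed_point.

(** * Decay and asymptotics *)

Section interpolation.
Context {R : realType} {N : nat}.
Notation X := (N.-tuple R).

Lemma leb_negligible0 n : leb_negligible (@set0 (n.-tuple R)).
Proof.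
exists set0; split; first exact: measurable0.
split => //; rewrite lebintE; last 2 first.
- by apply/measurable_EFinP; exact: measurable_indic.
- by move=> x; rewrite lee_fin.
by rewrite integral_indic//= set0I measure0.
Qed.

(** For q = +oo the infimum runs over all extended reals: a negative candidate would make the whole
    space negligible, contradicting the unit mass of a Gaussian. *)
Lemma Lq_norm_ge0 (q : \bar R) (v : X -> R) : measurable_fun [set: X] v -> (1 <= q)%E ->
  (0 <= Lq_norm q v)%E.
Proof.
case: q => [r||] mv q1 //=; first exact: poweR_ge0.
apply: le_ereal_inf_tmp => M /= [B [mB [MB B0]]]; rewrite leNgt; apply/negP => M0.
have BT x : \1_B x = 1 :> R.
  by rewrite indicE mem_set//; apply: MB => /=; rewrite (lt_le_trans M0)// lee_fin.
pose c : R := (4 * pi * 1) `^ (- (N%:R / 2)).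
have mi : measurable_fun [set: X] (fun x => \1_B x : R) by exact: measurable_indic.
have i0 x : 0 <= \1_B x :> R by rewrite BT.
move: B0; rewrite lebintE//; last exact/measurable_EFinP.
have : (\int[tuple_leb N]_x (hk x (origin N) 1)%:E <= \int[tuple_leb N]_x (c * \1_B x)%:E)%E.
  apply: le_int0.
  - exact: measurable_hk.
  - exact: measurable_funM.
  - by move=> x; exact: hk_ge0.
  - by move=> x; rewrite BT mulr1; exact: hk_le.
rewrite integral_hk// int0Z ?powR_ge0// => h h0.
by move: h; rewrite h0 mule0 lee_fin ler10.
Qed.

(** Uses |v|^r <= (sup |v|)^(r-1) |v|; the powers of t cancel exactly and the same constant eta
    comes out. *)
Lemma Lq_norm_interpolation (v : X -> R) (t eta : R) (q : \bar R) : measurable_fun [set: X] v ->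
  0 < t -> 0 <= eta ->
  (\int[tuple_leb N]_x `|v x|%:E <= eta%:E)%E -> (forall x, t `^ (N%:R / 2) * `|v x| <= eta) ->
  (1 <= q)%E -> ((t `^ decay_exp N q)%:E * Lq_norm q v <= eta%:E)%E.
Proof.
move=> mv t0 eta0 v1 voo; pose m := t `^ (- (N%:R / 2)).
have m0 : 0 < m by exact: powR_gt0.
have tm : t `^ (N%:R / 2) * m = 1.
  by rewrite -powRD ?subrr ?powRr0// (gt_eqF t0) implybT.
have vm x : `|v x| <= m * eta.
  have := ler_wpM2l (ltW m0) (voo x); by rewrite mulrA [X in X * _ <= _]mulrC tm mul1r.
case: q => [r| |] //=.
  rewrite lee_fin => r1; have r0 : 0 < r by exact: lt_le_trans r1.
  have rr : r \is a GRing.unit by rewrite unitfE gt_eqF.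
  have mv' : measurable_fun [set: X] (fun x => `|v x|) by exact: measurableT_comp.
  have mp : measurable_fun [set: X] (fun x => `|v x| `^ r).
    exact: (measurableT_comp (measurable_powR r)).
  have r10 : 0 <= r - 1 by rewrite subr_ge0.
  have I : (\int[tuple_leb N]_x (`|v x| `^ r)%:E <= (m `^ (r - 1) * eta `^ r)%:E)%E.
    have -> : m `^ (r - 1) * eta `^ r = (m * eta) `^ (r - 1) * eta.
      by rewrite powRM ?(ltW m0)// -(mulr_powRB1 eta0 r0) -mulrA [eta * _]mulrC.
    apply: (@le_trans _ _ (\int[tuple_leb N]_x ((m * eta) `^ (r - 1) * `|v x|)%:E)%E).
      apply: le_int0 => //; first exact: measurable_funM.
      move=> x; rewrite -(mulr_powRB1 (normr_ge0 (v x)) r0) mulrC ler_wpM2r//.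
      by apply: ge0_ler_powR => //; rewrite nnegrE ?mulr_ge0 ?(ltW m0).
    by rewrite int0Z ?powR_ge0// EFinM lee_wpmul2l ?lee_fin ?powR_ge0.
  rewrite lebintE; last 2 first.
  - exact/measurable_EFinP.
  - by move=> x; rewrite lee_fin powR_ge0.
  apply: (@le_trans _ _ ((t `^ (N%:R / 2 * (1 - r^-1)))%:E *
     ((m `^ (r - 1) * eta `^ r)%:E `^ r^-1))%E).
    rewrite lee_wpmul2l ?lee_fin ?powR_ge0//.
    apply: gt0_ler_poweR => //; first by rewrite invr_ge0 ltW.
    - rewrite in_itv/= leey andbT; apply: int0_ge0 => x; exact: powR_ge0.
    - by rewrite in_itv/= leey andbT lee_fin mulr_ge0 ?powR_ge0.
  rewrite poweR_EFin -EFinM lee_fin powRM ?powR_ge0//.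
  rewrite /m -!powRrM [r * _]mulrV// powRr1// [leLHS]mulrA -powRD; last by rewrite (gt_eqF t0) implybT.
  rewrite (_ : _ + _ = 0) ?powRr0 ?mul1r//.
  by field; rewrite gt_eqF.
move=> _; apply: (@le_trans _ _ ((t `^ (N%:R / 2))%:E * (m * eta)%:E)%E); last first.
  by rewrite -EFinM lee_fin mulrA tm mul1r.
rewrite lee_wpmul2l ?lee_fin ?powR_ge0//; apply: ereal_inf_lbound => /=.
rewrite (_ : [set _ | _] = set0); first exact: leb_negligible0.
apply/seteqP; split => x //=; rewrite lte_fin ltNge.
by rewrite vm.
Qed.

End interpolation.

(** * Vanishing of [theta] for large times *)

Section theta_limit.
Context {R : realType} {N : nat}.
Notation X := (N.-tuple R).

(** In terms of r = t^(-1/2), the ratio is 1/(1 + r + r^2) and 1/(sqrt t + 1) is r/(1 + r), so the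
    limit is an evaluation at r = 0. *)
Lemma cvg_theta (y : X) (t_ : nat -> R) : (forall n, n.+1%:R <= t_ n) ->
  theta y (t_ n) @[n --> \oo] --> 0.
Proof.
move=> ht; have t0 n : 0 < t_ n by apply: lt_le_trans (ht n).
pose r n := isqrt (t_ n).
have r_cvg : r @ \oo --> 0.
  rewrite -[X in _ --> X](@sqrtr0 R) (_ : r = Num.sqrt \o (fun n => (t_ n)^-1)).
    apply: (cvg_comp (fun n => (t_ n)^-1) Num.sqrt); last exact: sqrt_continuous.
    apply: (squeeze_cvgr _ (cvg_cst 0) (@cvg_harmonic R)); apply: nearW => n.
    by rewrite invr_ge0 (ltW (t0 n))/= lef_pV2 ?posrE.
  by apply/funext => n /=; rewrite sqrtrV ?(ltW (t0 n)).
pose q := sqd y (origin N).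
have -> : (fun n => theta y (t_ n)) = (fun n => 4 - 4 * (((1 + r n + r n * r n)^-1) `^ (N%:R / 2) *
    expR (- (q / 4 * (r n / (1 + r n)))))).
  apply/funext => n; rewrite /theta -/q /r /isqrt.
  have s0 : 0 < Num.sqrt (t_ n) by rewrite sqrtr_gt0.
  have tE : t_ n = Num.sqrt (t_ n) * Num.sqrt (t_ n) by rewrite -expr2 sqr_sqrtr ?ltW.
  rewrite {1 2}tE; set w := Num.sqrt _ in s0 *.
  have w1 : w + 1 != 0 by rewrite gt_eqF ?addr_gt0.
  have ww : w * w + w + 1 != 0 by rewrite gt_eqF// !addr_gt0// mulr_gt0.
  have wn : w != 0 by rewrite gt_eqF.
  congr (4 - 4 * (_ `^ _ * expR (- _))); field; rewrite ?wn ?w1 ?ww //=.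
  by rewrite mulrDl mul1r ww.
have r1 : 1 + r n @[n --> \oo] --> (1 + 0 : R) by apply: cvgD => //; exact: cvg_cst.
rewrite [X in _ --> X](_ : 0 = 4 - 4 * (((1 + 0 + 0 * 0)^-1) `^ (N%:R / 2) *
    expR (- (q / 4 * (0 / (1 + 0)))))); last first.
  by rewrite mulr0 mul0r mulr0 oppr0 expR0 !addr0 invr1 powR1 !mulr1 subrr.
apply: cvgB; first exact: cvg_cst.
apply: cvgM; first exact: cvg_cst.
apply: cvgM.
  apply: cvg_powR; first by rewrite !addr0 mulr0 addr0 invr1.
  apply: cvgV; first by rewrite addr0 mulr0 addr0 oner_eq0.
  by apply: cvgD => //; exact: cvgM.
apply: (cvg_comp (fun n => - (q / 4 * (r n / (1 + r n)))) expR); last exact: continuous_expR.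
apply: cvgN; apply: cvgM; first exact: cvg_cst.
by apply: cvgM => //; apply: cvgV => //; rewrite addr0 oner_eq0.
Qed.

Lemma measurable_theta t : measurable_fun [set: X] (fun y => theta y t).
Proof.
apply: measurable_funB => //; apply: measurable_funM => //; apply: measurable_funM => //.
apply: measurableT_comp => //; apply: measurableT_comp => //.
by apply: measurable_funM => //; exact: measurable_sqd.
Qed.

(** By contradiction, the continuous limit is reduced to a sequence t_n >= n + 1, to which dominated
    convergence applies with majorant 4|phi|. *)
Lemma integral_theta_small (phi : X -> R) (e : R) : measurable_fun [set: X] phi ->
  (\int[tuple_leb N]_x (`|phi x|)%:E < +oo)%E -> 0 < e ->
  exists2 T : R, 0 < T & forall t : R, T <= t ->
    (\int[tuple_leb N]_y (theta y t * `|phi y|)%:E <= e%:E)%E.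
Proof.
move=> mphi iphi e0; apply: contrapT => H.
have H' n : exists t : R, n.+1%:R <= t /\
    (e%:E < \int[tuple_leb N]_y (theta y t * `|phi y|)%:E)%E.
  apply: contrapT => H1; apply: H; exists n.+1%:R => // t nt.
  by rewrite leNgt; apply/negP => h; apply: H1; exists t.
have [t_ ht] := choice H'.
have mn : measurable_fun [set: X] (fun x => `|phi x|) by exact: measurableT_comp.
have t0 n : 0 < t_ n by have [h _] := ht n; apply: lt_le_trans h.
have c : (\int[tuple_leb N]_y (theta y (t_ n) * `|phi y|)%:E @[n --> \oo] --> 0)%E.
  apply: (dct0 (g := fun y => 4 * `|phi y|)).
  - by move=> n; apply: measurable_funM => //; exact: measurable_theta.
  - exact: measurable_funM.
  - by move=> n y; rewrite mulr_ge0 ?theta_ge0//= ler_wpM2r// theta_le.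
  - by rewrite int0Z// lte_mul_pinfty.
  - apply: aeW => y; rewrite [X in _ --> X](_ : 0 = 0 * `|phi y|); last by rewrite mul0r.
    by apply: cvgM; [apply: cvg_theta => n; case: (ht n)|exact: cvg_cst].
have /fine_cvgP[[n0 _ h1] /(cvgr0_norm_lt)/(_ _ e0)[n1 _ h2]] := c.
have := h1 (maxn n0 n1) (leq_maxl _ _); have := h2 (maxn n0 n1) (leq_maxr _ _).
have [_ /=] := ht (maxn n0 n1).
case: (\int[tuple_leb N]_y _)%E => [z||]//=; rewrite lte_fin => h3 h4 _.
by have := lt_trans h3 (le_lt_trans (ler_norm _) h4); rewrite ltxx.
Qed.

End theta_limit.

(** * Weighted bounds and convergence of the heat flow to the Gaussian *)

Section conclusions.
Context {R : realType} {N : nat} (phi : N.-tuple R -> R).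
Hypothesis mphi : measurable_fun [set: N.-tuple R] phi.
Hypothesis iphi : (\int[tuple_leb N]_x (`|phi x|)%:E < +oo)%E.
Notation X := (N.-tuple R).
Notation mu := (tuple_leb N).
Notation TR := (measurableTypeR R).
Notation E := (heat_maj phi).
Notation cN := (@cN R N).
Implicit Types (x y : X) (s t eps : R) (z : TR * X).

Let mnphi : measurable_fun [set: X] (fun x => `|phi x|).
Proof. exact: measurableT_comp. Qed.

Let mE t : measurable_fun [set: X] (fun x => E x t).
Proof. exact: measurable_heat_maj. Qed.

(** After Tonelli, [weighted_hk_le] moves the weight onto y and the remaining kernel G(., 4t)
    integrates to 1. *)
Lemma weighted_heat_maj_le (l : R) : 0 <= l ->
  exists B : R, 0 <= B /\ forall t, 0 < t ->
   (\int[mu]_x ((1 + enorm_t x) `^ l * E x t)%:E <=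
    (B * (1 + t) `^ (l / 2))%:E * \int[mu]_y ((1 + enorm_t y) `^ l * `|phi y|)%:E)%E.
Proof.
move=> l0; have [B [B0 hB]] := weighted_hk_le N l0; exists B; split => // t t0.
have t4 : 0 < 4 * t by rewrite mulr_gt0.
have mw : measurable_fun [set: X] (fun x : X => (1 + enorm_t x) `^ l).
  apply: (measurableT_comp (measurable_powR l)); apply: measurable_funD => //.
  exact: measurable_enorm.
have w0 x : 0 <= (1 + enorm_t x) `^ l by exact: powR_ge0.
have Bt : 0 <= B * (1 + t) `^ (l / 2) by rewrite mulr_ge0 ?powR_ge0.
have mwp : measurable_fun [set: X] (fun y => (1 + enorm_t y) `^ l * `|phi y|).
  exact: measurable_funM.
have mhp x (r : R) : measurable_fun [set: X] (fun y => hk x y r * `|phi y|).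
  by apply: measurable_funM => //; exact: measurable_hk.
have hp0 x (r : R) y : 0 <= hk x y r * `|phi y| by apply: mulr_ge0 => //; exact: hk_ge0.
under eq_integral do rewrite EFinM -heat_majE// -int0Z//.
rewrite (fubini_tonelli (fun z : X * X =>
   ((1 + enorm_t z.1) `^ l * (hk z.1 z.2 (2 * t) * `|phi z.2|))%:E)); last 2 first.
- apply/measurable_EFinP; apply: measurable_funM; first exact: (measurableT_comp mw).
  apply: measurable_funM; first exact: measurable_hk.
  exact: (measurableT_comp mnphi).
- by move=> z; rewrite lee_fin mulr_ge0.
rewrite -int0Z//; last by move=> y; rewrite mulr_ge0.
apply: ge0_le_integral => //=.
- by move=> y _; apply: int0_ge0 => x; rewrite mulr_ge0.
- apply: (@measurable_fun_fubini_tonelli_G _ _ X X R mu (fun z : X * X =>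
   ((1 + enorm_t z.1) `^ l * (hk z.1 z.2 (2 * t) * `|phi z.2|))%:E)).
    apply/measurable_EFinP; apply: measurable_funM; first exact: (measurableT_comp mw).
    apply: measurable_funM; first exact: measurable_hk.
    exact: (measurableT_comp mnphi).
  by move=> z; rewrite lee_fin mulr_ge0.
- by apply/measurable_EFinP; exact: measurable_funM.
move=> y _.
apply: (@le_trans _ _ (\int[mu]_x ((B * (1 + t) `^ (l / 2) *
    ((1 + enorm_t y) `^ l * `|phi y|)) * hk x y (4 * t))%:E)%E).
  apply: le_int0.
  - apply: measurable_funM => //; apply: measurable_funM => //; exact: measurable_hk.
  - by apply: measurable_funM => //; exact: measurable_hk.
  - by move=> x; rewrite mulr_ge0.
  - move=> x; rewrite mulrA.
    have := ler_wpM2r (normr_ge0 (phi y)) (hB x y t t0); move/le_trans; apply.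
    by rewrite le_eqVlt; apply/orP; left; apply/eqP; ring.
rewrite int0Z ?integral_hk ?mule1//; first exact: measurable_hk.
  by move=> x; exact: hk_ge0.
by rewrite mulr_ge0// mulr_ge0.
Qed.

Lemma integrable_phi : mu.-integrable [set: X] (EFin \o phi).
Proof. exact: (integrable_le _ mnphi). Qed.

Definition heat_diff x t y : R := (hk x y t - hk x (origin N) (1 + t)) * phi y.

(** The term M g(x,t) is itself an integral against phi, with a kernel constant in y. *)
Lemma heat_diffE x t : 0 < t ->
  heat_sg t phi x - lebintR phi * gauss_g x t = fine (\int[mu]_y (heat_diff x t y)%:E).
Proof.
move=> t0; have ip := integrable_phi; rewrite heat_sgE// lebintRE// /gauss_g hk_origin.
have ig : mu.-integrable [set: X] (EFin \o (fun y => hk x (origin N) (1 + t) * phi y)).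
  by have := integrableZl measurableT (hk x (origin N) (1 + t)) ip.
have -> : fine (\int[mu]_y (phi y)%:E) * hk x (origin N) (1 + t) =
    fine (\int[mu]_y (hk x (origin N) (1 + t) * phi y)%:E).
  under [in RHS]eq_integral do rewrite EFinM.
  rewrite integralZl// fineM//=; first by rewrite mulrC.
  exact: (integrable_fin_num measurableT ip).
rewrite -fine_integralB//; last exact: integrable_heat.
by congr fine; apply: eq_integral => y _; rewrite /heat_diff mulrBl.
Qed.

Let mthp t : measurable_fun [set: X] (fun y => theta y t * `|phi y|).
Proof. by apply: measurable_funM => //; exact: measurable_theta. Qed.

Let thp0 t y : 0 < t -> 0 <= theta y t * `|phi y|.
Proof. by move=> t0; rewrite mulr_ge0// theta_ge0. Qed.

Let mdiff t : measurable_fun [set: X * X] (fun z : X * X => heat_diff z.1 t z.2).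
Proof.
apply: measurable_funM; last exact: (measurableT_comp mphi).
by apply: measurable_funB; exact: measurable_hk.
Qed.

Let mdiffr x t : measurable_fun [set: X] (heat_diff x t).
Proof. by apply: measurable_funM => //; apply: measurable_funB => //; exact: measurable_hk. Qed.

Let thp_fin t : 0 < t -> (\int[mu]_y (theta y t * `|phi y|)%:E < +oo)%E.
Proof.
move=> t0; apply: (@le_lt_trans _ _ (\int[mu]_y (4 * `|phi y|)%:E)%E).
  apply: le_int0 => //; first exact: measurable_funM.
    by move=> y; exact: thp0.
  by move=> y; rewrite ler_wpM2r// theta_le.
by rewrite int0Z// lte_mul_pinfty.
Qed.

Lemma heat_diff_sup x t : 0 < t ->
  ((t `^ (N%:R / 2) * `|heat_sg t phi x - lebintR phi * gauss_g x t|)%:E <=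
   \int[mu]_y (theta y (t / 2) * `|phi y|)%:E)%E.
Proof.
move=> t0; have t2 : 0 < t / 2 by rewrite divr_gt0.
have T0 : 0 < t `^ (N%:R / 2) by exact: powR_gt0.
have mc : measurable_fun [set: X] (fun y => (t `^ (N%:R / 2))^-1 * (theta y (t / 2) * `|phi y|)).
  exact: measurable_funM.
have I : (\int[mu]_y ((t `^ (N%:R / 2))^-1 * (theta y (t / 2) * `|phi y|))%:E =
    ((t `^ (N%:R / 2))^-1)%:E * \int[mu]_y (theta y (t / 2) * `|phi y|)%:E)%E.
  by rewrite int0Z// ?invr_ge0 ?(ltW T0)// => y; exact: thp0.
rewrite heat_diffE// EFinM -lee_pdivlMl// -I; apply: norm_fine_integral_le => //.
- move=> y; rewrite /heat_diff normrM mulrA ler_wpM2r// ler_pdivlMl//.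
  exact: hk_diff_le.
- by rewrite I lte_mul_pinfty ?thp_fin// lee_fin invr_ge0 ltW.
Qed.

Lemma heat_diff_L1 t : 0 < t ->
  (\int[mu]_x `|heat_sg t phi x - lebintR phi * gauss_g x t|%:E <=
   \int[mu]_y (theta y t * `|phi y|)%:E)%E.
Proof.
move=> t0; under eq_integral do rewrite heat_diffE//.
have mD : measurable_fun [set: X * X] (fun z : X * X => (`|heat_diff z.1 t z.2|)%:E).
  by apply/measurable_EFinP; apply: measurableT_comp => //; exact: mdiff.
apply: (@le_trans _ _ (\int[mu]_x \int[mu]_y (`|heat_diff x t y|)%:E)%E).
  apply: ge0_le_integral => //=.
  - apply/measurable_EFinP; apply: measurableT_comp => //.
    exact: (measurable_param_integral mu (f := fun x y => heat_diff x t y)).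
  - exact: (@measurable_fun_fubini_tonelli_F _ _ X X R mu
      (fun z : X * X => (`|heat_diff z.1 t z.2|)%:E)).
  move=> x _.
  have mn : measurable_fun [set: X] (fun y => `|heat_diff x t y|) by exact: measurableT_comp.
  (* If the inner integral is infinite the bound is trivial. *)
  have [foo|] := ltP (\int[mu]_y (`|heat_diff x t y|)%:E)%E +oo%E.
    exact: norm_fine_integral_le.
  by move=> h; apply: le_trans h; rewrite leey.
rewrite (fubini_tonelli (fun z : X * X => (`|heat_diff z.1 t z.2|)%:E))//.
apply: ge0_le_integral => //=.
- by move=> y _; apply: int0_ge0.
- exact: (@measurable_fun_fubini_tonelli_G _ _ X X R mu
    (fun z : X * X => (`|heat_diff z.1 t z.2|)%:E)).
- exact/measurable_EFinP.
move=> y _.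
have -> : (\int[mu]_x (`|heat_diff x t y|)%:E =
   `|phi y|%:E * \int[mu]_x `|hk x y t - hk x (origin N) (1 + t)|%:E)%E.
  rewrite -int0Z//; last first.
    by apply: measurableT_comp => //; apply: measurable_funB; exact: measurable_hk.
  by apply: eq_integral => x _; rewrite /heat_diff normrM mulrC.
by rewrite mulrC EFinM lee_wpmul2l ?lee_fin// integral_hk_diff.
Qed.

(** * From the space-time integral to the iterated Duhamel formula *)

Section mild_formula.
Variables (b : R -> R) (beta : R).
Hypotheses (mb : measurable_fun [set: R] b) (b0 : forall s, 0 <= b s <= beta).
Variables (F : X -> R -> R -> X) (u : X -> R -> R).

Hypothesis fb : adm phi b (nonlin F u).

Let D i x t z : R := dker 0 i x t z * tnth (nonlin F u z) i.

Let mD i x t : measurable_fun [set: TR * X] (D i x t).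
Proof.
have [mf _] := fb; apply: measurable_funM; first exact: measurable_dker.
exact: (measurable_fun_tnthP _).1.
Qed.

Let mDs i x t s : measurable_fun [set: X] (fun y => D i x t (s, y)).
Proof. exact: (measurableT_comp (mD i x t) (measurable_pair1 (s : TR))). Qed.

Let D_le i x t z : `|D i x t z| <=
  2 `^ (N%:R / 2) * dom phi x t (fun s => ind 0 (t - 0) s * (isqrt (t - s) * b s)) z.
Proof. by have [_ fE] := fb; apply: dker_mul_le => // z0; exact: fE. Qed.

Let DE i x t s y : 0 < s -> s < t -> duhamel_integrand F u i x t s y = D i x t (s, y).
Proof. by move=> s0 st; rewrite /D /dker /nonlin/= subr0 ind1// s0 mul1r. Qed.

Let D0 i x t s y : ~~ (0 < s < t) -> D i x t (s, y) = 0.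
Proof. by move=> h; rewrite /D /dker/= subr0 /ind (negbTE h) !mul0r. Qed.

(** Holds on every slice, not just almost every one, since the semigroup law evaluates the majorant
    at each s. *)
Let integrable_Ds i x t s : 0 < s -> s < t ->
  mu.-integrable [set: X] (EFin \o (fun y => D i x t (s, y))).
Proof.
move=> s0 st; have ts : 0 < t - s by rewrite subr_gt0.
pose c : R := 2 `^ (N%:R / 2) * (ind 0 t s * (ind 0 (t - 0) s * (isqrt (t - s) * b s))).
have mh : measurable_fun [set: X] (fun y => hk x y (2 * (t - s)) * E y s).
  by apply: measurable_funM => //; exact: measurable_hk.
have c0 : 0 <= c.
  apply: mulr_ge0; first exact: powR_ge0.
  apply: mulr_ge0; first exact: ind_ge0.
  apply: mulr_ge0; first exact: ind_ge0.
  by apply: mulr_ge0; [exact: isqrt_ge0|case/andP: (b0 s)].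
apply: (@integrable_le _ _ _ mu _ (fun y => c * (hk x y (2 * (t - s)) * E y s))) => //.
- exact: measurable_funM.
- by move=> y; have := D_le i x t (s, y); rewrite /dom/= /c !mulrA.
rewrite int0Z//; last by move=> y; apply: mulr_ge0; [exact: hk_ge0|exact: heat_maj_ge0].
by rewrite heat_maj_semigroup// -EFinM ltry.
Qed.

Lemma duhamel_integrable i x t : 0 < t ->
  (\int[@lebesgue_measure R]_(s in `]0%R, t[)
     lebint (fun xi => (`|duhamel_integrand F u i x t s xi|)%:E) < +oo)%E.
Proof.
move=> t0; have mnD : measurable_fun [set: TR * X] (fun z => `|D i x t z|).
  by apply: measurableT_comp => //; exact: mD.
have -> : (\int[@lebesgue_measure R]_(s in `]0%R, t[)
     lebint (fun xi => (`|duhamel_integrand F u i x t s xi|)%:E) =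
     \int[spacetime]_z (`|D i x t z|)%:E)%E.
  rewrite /spacetime (fubini_tonelli1 (m1 := leb_time) (m2 := mu)
    (fun z => (`|D i x t z|)%:E)); [|exact/measurable_EFinP|by move=> z; rewrite lee_fin].
  rewrite integral_mkcond; apply: eq_integral => s _; rewrite patchE /fubini_F.
  case: ifPn => [|].
    rewrite inE/= in_itv/= => /andP[s0 st].
    rewrite (_ : (fun xi => _) = (fun y => (`|D i x t (s, y)|)%:E)); last first.
      by apply/funext => y; rewrite DE.
    apply: lebintE => [|y]; last by rewrite lee_fin.
    by apply/measurable_EFinP; apply: measurableT_comp => //; exact: mDs.
  rewrite notin_setE/= in_itv/= => /negP h.
  rewrite (_ : (fun y => _) = cst 0%E); last by apply/funext => y; rewrite D0// normr0.
  by rewrite integral0.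
have mdom : measurable_fun [set: TR * X] (fun z =>
    cN * dom phi x t (fun s => ind 0 (t - 0) s * (isqrt (t - s) * b s)) z).
  apply: measurable_funM => //; apply: measurable_dom => //.
  by rewrite subr0; exact: measurable_itv_isqrt.
apply: le_lt_trans (integral_dom_fin mphi iphi mb b0 x (lexx 0) t0).
apply: le_int0 => // z; apply: (le_trans (D_le i x t z)); apply: ler_wpM2r.
  apply: dom_ge0 => s; apply: mulr_ge0; first exact: ind_ge0.
  by apply: mulr_ge0; [exact: isqrt_ge0|case/andP: (b0 s)].
(* The index i witnesses N >= 1, hence 2^(N/2) <= [cN]. *)
rewrite ler_peMl ?powR_ge0// ler1n.
exact: leq_ltn_trans (ltn_ord i).
Qed.

Lemma duh_Rintegral x t : 0 < t ->
  duh 0 (nonlin F u) x t = Rintegral (@lebesgue_measure R) `]0, t[ (fun s => div_heat F u x t s).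
Proof.
move=> t0; have iD := integrable_duh_int mphi iphi mb b0 x (lexx 0) t0 fb.
rewrite /duh /Rintegral -integral_ind; congr fine.
have := integral12_prod_meas1 (m1 := leb_time) (m2 := mu) iD.
move=> h; apply: (etrans (esym h)); apply: eq_integral => s _; rewrite /fubini_F.
have [/andP[s0 st]|h0] := boolP (0 < s < t); last first.
  rewrite /ind (negbTE h0) mul0r (_ : (fun y => _) = cst 0%E) ?integral0//.
  apply/funext => y /=; congr EFin; apply: big1 => i _; exact: D0.
rewrite ind1// mul1r /div_heat.
rewrite (_ : (fun y => _) = (fun y => \sum_(i < N) (D i x t (s, y))%:E)%E); last first.
  by apply/funext => y /=; rewrite sumEFin.
rewrite (integral_sum measurableT (f := fun i y => (D i x t (s, y))%:E)); last first.
  by move=> i; exact: integrable_Ds.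
rewrite -sumEFin; apply: eq_bigr => i _.
rewrite (_ : duhamel_integrand F u i x t s = (fun y => D i x t (s, y))); last first.
  by apply/funext => y; rewrite DE.
rewrite lebintRE; last exact: integrable_Ds.
by rewrite fineK//; exact: (integrable_fin_num measurableT (integrable_Ds i x s0 st)).
Qed.

End mild_formula.

(** * Large-time behaviour of the mild formula *)

Section asymptotics.
Variables (b : R -> R) (beta : R).
Hypotheses (mb : measurable_fun [set: R] b) (b0 : forall s, 0 <= b s <= beta).
Variable f : TR * X -> X.
Hypothesis fb : adm phi b f.
Hypothesis vol_small : forall e : R, 0 < e ->
  exists2 T : R, 0 < T & forall t : R, T <= t -> (vol b t <= e%:E)%E.

Lemma measurable_mild t : 0 < t -> measurable_fun [set: X] (fun x => mild phi f x t).
Proof.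
move=> t0; have [mf _] := fb.
rewrite (_ : (fun x => _) = (fun x => heat_ext phi x t + duh 0 f x t)); last first.
  by apply/funext => x; rewrite mildE.
apply: measurable_funD; first exact: measurable_heat_ext.
exact: measurable_duh.
Qed.

Lemma measurable_gauss t : measurable_fun [set: X] (fun x => gauss_g x t).
Proof.
rewrite (_ : (fun x => _) = (fun x => hk x (origin N) (1 + t))); last first.
  by apply/funext => x; rewrite /gauss_g hk_origin.
exact: measurable_hk.
Qed.

Lemma mild_asymptotics (e : R) : 0 < e -> exists2 T : R, 0 < T & forall t : R, T <= t ->
  (\int[mu]_x `|mild phi f x t - lebintR phi * gauss_g x t|%:E <= e%:E)%E /\
  forall x, t `^ (N%:R / 2) * `|mild phi f x t - lebintR phi * gauss_g x t| <= e.
Proof.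
move=> e0; have e20 : 0 < e / 2 by rewrite divr_gt0.
have p0 : 0 <= cN * phi1 phi by apply: mulr_ge0; [exact: cN_ge0|exact: phi1_ge0].
(* E has mass [phi1 phi], which also bounds t^(N/2) E, so this choice keeps the Duhamel term below
   e/2 in both estimates; the added 1 avoids a zero denominator. *)
pose e' := e / 2 / (cN * phi1 phi + 1).
have e'0 : 0 < e' by rewrite divr_gt0// ltr_wpDl.
have e'e : cN * phi1 phi * e' <= e / 2.
  rewrite /e' mulrCA ger_pMr// ler_pdivrMr ?mul1r ?lerDl//.
  by rewrite ltr_wpDl.
have [T1 T10 h1] := integral_theta_small mphi iphi e20.
have [T2 T20 h2] := vol_small e'0.
(* The factor 2 is there because the supremum estimate involves [theta] at time t/2. *)
exists (Num.max (2 * T1) T2); first by rewrite lt_max T20 orbT.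
move=> t; rewrite ge_max => /andP[tT1 tT2].
have t0 : 0 < t by exact: lt_le_trans tT2.
have dE x : `|duh 0 f x t| <= cN * e' * E x t.
  rewrite -lee_fin; apply: (le_trans (duh_le mphi iphi mb b0 x (lexx 0) t0 fb)).
  rewrite -mulrA [X in (_ <= X)%E]EFinM lee_wpmul2l ?lee_fin ?cN_ge0//.
  by rewrite [X in (_ <= X)%E]EFinM lee_wpmul2r ?lee_fin ?heat_maj_ge0//; exact: h2.
have ce : 0 <= cN * e' by apply: mulr_ge0; [exact: cN_ge0|exact: ltW].
pose g x := heat_sg t phi x - lebintR phi * gauss_g x t.
have vE x : `|mild phi f x t - lebintR phi * gauss_g x t| <= `|g x| + cN * e' * E x t.
  rewrite /mild addrAC; apply: (le_trans (ler_normD _ _)); rewrite lerD2l; exact: dE.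
have mg : measurable_fun [set: X] (fun x => `|g x|).
  apply: measurableT_comp => //; apply: measurable_funB.
    rewrite (_ : heat_sg t phi = (fun x => heat_ext phi x t)); last first.
      by apply/funext => x; rewrite heat_sgE.
    exact: measurable_heat_ext.
  by apply: measurable_funM => //; exact: measurable_gauss.
split.
  apply: (@le_trans _ _ (\int[mu]_x (`|g x| + cN * e' * E x t)%:E)%E).
    apply: le_int0 => //.
      apply: measurableT_comp => //; apply: measurable_funB; first exact: measurable_mild.
      by apply: measurable_funM => //; exact: measurable_gauss.
    by apply: measurable_funD => //; exact: measurable_funM.
  rewrite int0D//; last 2 first.
  - exact: measurable_funM.
  - by move=> x; apply: mulr_ge0 => //; exact: heat_maj_ge0.
  rewrite (splitr e) EFinD; apply: leeD.
    by apply: (le_trans (heat_diff_L1 t0)); apply: h1; move: tT1; lra.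
  rewrite int0Z// ?integral_heat_maj//; last by move=> x; exact: heat_maj_ge0.
  by rewrite -EFinM lee_fin mulrAC.
move=> x; apply: (le_trans (ler_wpM2l (powR_ge0 _ _) (vE x))).
rewrite mulrDr (splitr e); apply: lerD.
  rewrite -lee_fin; apply: (le_trans (heat_diff_sup x t0)); apply: h1.
  by rewrite ler_pdivlMr// mulrC.
rewrite mulrCA; apply: (le_trans _ e'e); rewrite [leRHS]mulrAC ler_wpM2l//.
exact: heat_maj_le.
Qed.

End asymptotics.

End conclusions.

(** * Limits at infinity and assembly of the conclusions *)

Lemma cvge0_pinfty (R : realType) (f : R -> \bar R) :
  (forall e : R, 0 < e -> exists2 T : R, 0 < T & forall t, T <= t -> (0 <= f t <= e%:E)%E) ->
  f t @[t --> +oo] --> 0%E.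
Proof.
move=> h; have near0 (e : R) : 0 < e -> \forall t \near +oo, (0 <= f t <= e%:E)%E.
  by move=> e0; have [T _ hT] := h e e0; exists T; split => [|t /ltW]; [exact: num_real|exact: hT].
apply/fine_cvgP; split.
  apply: filterS (near0 1 ltr01) => t /andP[f0 f1].
  by rewrite ge0_fin_numE// (le_lt_trans f1)// ltry.
apply/cvgr0Pnorm_le => e e0; apply: filterS (near0 e e0) => t /andP[f0 fe] /=.
by rewrite ger0_norm ?fine_ge0// -lee_fin fineK// ge0_fin_numE// (le_lt_trans fe)// ltry.
Qed.

Theorem theorem3p2 (R : realType) (N : nat) (K : R)
  (phi : N.-tuple R -> R) (F : N.-tuple R -> R -> R -> N.-tuple R) (C A : R) :
  (1 <= N)%N -> 0 <= K ->
  (* phi in L^1_K *)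
  measurable_fun [set: N.-tuple R] phi ->
  (wL1_norm K phi < +oo)%E ->
  (* F continuous on R^N x (0,oo) x R *)
  (forall x t p, 0 < t -> forall e, 0 < e -> exists2 d, 0 < d &
     forall x' t' p', 0 < t' -> edist_t x x' < d -> `|t - t'| < d -> `|p - p'| < d ->
       edist_t (F x t p) (F x' t' p') < e) ->
  0 < C -> 1 < A ->
  (forall x t p, 0 < t ->
     enorm_t (F x t p) <= C * (1 + t) `^ (- A + 2^-1) * `|p|) ->
  exists u : N.-tuple R -> R -> R,
    (* u continuous on R^N x (0,oo) *)
    (forall x t, 0 < t -> forall e, 0 < e -> exists2 d, 0 < d &
       forall x' t', 0 < t' -> edist_t x x' < d -> `|t - t'| < d ->
         `|u x t - u x' t'| < e) /\
    (* (i) *)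
    (forall q : \bar R, (1 <= q)%E ->
       exists B : R, forall t, 0 < t ->
         ((t `^ decay_exp N q)%:E * Lq_norm q (u ^~ t) <= B%:E)%E) /\
    (forall l : R, 0 <= l -> l <= K ->
       exists B : R, forall t, 0 < t ->
         (((1 + t) `^ (- (l / 2)))%:E * wL1_norm l (u ^~ t) <= B%:E)%E) /\
    (* (ii) mild solution, for almost all (x,t) in R^N x (0,oo)
       (the point (t,x) is encoded as the (N+1)-tuple t :: x) *)
    leb_negligible [set y : N.+1.-tuple R |
      let t := thead y in let x : N.-tuple R := [tuple of behead y] in
      0 < t /\
      ~ ((forall i : 'I_N,
            (\int[@lebesgue_measure R]_(s in `]0%R, t[)
               lebint (fun xi => (`|duhamel_integrand F u i x t s xi|)%:E) < +oo)%E) /\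
         u x t = heat_sg t phi x +
                 Rintegral (@lebesgue_measure R) `]0, t[ (fun s => div_heat F u x t s))] /\
    (* (iii) *)
    (forall q : \bar R, (1 <= q)%E ->
       ((t `^ decay_exp N q)%:E *
          Lq_norm q (fun x => (u x t - lebintR phi * gauss_g x t)%R))%E
         @[t --> +oo] --> 0%E).
Proof.
move=> N1 K0 mphi wphi Fc C0 A1 Fb.
have mnphi : measurable_fun [set: N.-tuple R] (fun x => `|phi x|) by exact: measurableT_comp.
have mw (l : R) : measurable_fun [set: N.-tuple R]
    (fun x : N.-tuple R => (1 + enorm_t x) `^ l).
  apply: (measurableT_comp (measurable_powR l)); apply: measurable_funD => //.
  exact: measurable_enorm.
have w_le (l x : R) (n : nat) (y : n.-tuple R) : l <= x -> (1 + enorm_t y) `^ l <= (1 + enorm_t y) `^ x.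
  by move=> lx; apply: ler_powR => //; rewrite lerDl enorm_t_ge0.
have wlE l (v : N.-tuple R -> R) : measurable_fun [set: N.-tuple R] v ->
    wL1_norm l v = (\int[tuple_leb N]_x ((1 + enorm_t x) `^ l * `|v x|)%:E)%E.
  move=> mv; apply: lebintE => [|x]; last by rewrite lee_fin mulr_ge0 ?powR_ge0.
  by apply/measurable_EFinP; apply: measurable_funM => //; exact: measurableT_comp.
have wl_fin (l : R) : l <= K ->
    (\int[tuple_leb N]_x ((1 + enorm_t x) `^ l * `|phi x|)%:E < +oo)%E.
  move=> lK; move: wphi; rewrite wlE//; apply: le_lt_trans; apply: le_int0.
  - exact: measurable_funM.
  - exact: measurable_funM.
  - by move=> x; rewrite mulr_ge0 ?powR_ge0.
  - by move=> x; rewrite ler_wpM2r// w_le.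
have iphi : (\int[tuple_leb N]_x (`|phi x|)%:E < +oo)%E.
  have := wl_fin 0 K0; under eq_integral do rewrite powRr0 mul1r.
  by [].
(* A > 1 is exactly gam > 1/2, the threshold in [wkappa_small]. *)
pose gam := A - 2^-1.
have gam_gt : 2^-1 < gam by rewrite /gam; lra.
have F_le x t p : 0 < t -> enorm_t (F x t p) <= C * (1 + t) `^ (- gam) * `|p|.
  by rewrite (_ : - gam = - A + 2^-1); [exact: Fb|rewrite /gam opprB addrC].
have [u [H [H0 [uH [fadm um]]]]] := mild_solution mphi iphi Fc C0 gam_gt F_le.
pose b s := C * H * pweight gam s.
have CH : 0 <= C * H by rewrite mulr_ge0// ltW.
have mb : measurable_fun [set: R] b.
  by apply: measurable_funM => //; exact: measurable_pweight.
have b_bnd s : 0 <= b s <= C * H.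
  by rewrite mulr_ge0 ?pweight_ge0//= ler_piMr ?pweight_le1.
have mut t : 0 < t -> measurable_fun [set: N.-tuple R] (u^~ t).
  move=> t0; rewrite (_ : u^~ t = mild phi (nonlin F u) ^~ t); last first.
    by apply/funext => x; exact: um.
  exact: (measurable_mild mphi iphi fadm).
have mE t : measurable_fun [set: N.-tuple R] (fun x => heat_maj phi x t).
  exact: measurable_heat_maj.
exists u; split; [|split; [|split; [|split]]].
- move=> x t t0 e e0; have [d d0 hd] := mild_equicontinuous mphi iphi mb b_bnd x t0 e0.
  by exists d => // x' t' t'0 xx tt; rewrite um// um//; exact: hd.
- move=> q q1; exists (H * phi1 phi) => t t0; apply: Lq_norm_interpolation => //.
  + exact: mut.
  + by rewrite mulr_ge0 ?phi1_ge0.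
  + rewrite EFinM -(integral_heat_maj mphi iphi t0) -int0Z//; last first.
      by move=> x; exact: heat_maj_ge0.
    apply: le_int0 => //; [by apply: measurableT_comp => //; exact: mut|exact: measurable_funM|].
    by move=> x; exact: uH.
  + move=> x; apply: (le_trans (ler_wpM2l (powR_ge0 _ _) (uH x t t0))).
    by rewrite mulrCA ler_wpM2l// heat_maj_le.
- move=> l l0 lK; have [B [B0 hB]] := weighted_heat_maj_le mphi iphi l0.
  set W := (\int[tuple_leb N]_x ((1 + enorm_t x) `^ l * `|phi x|)%:E)%E in hB.
  have W0 : (0 <= W)%E by apply: int0_ge0 => x; rewrite mulr_ge0 ?powR_ge0.
  have WE : W = (fine W)%:E by rewrite fineK// ge0_fin_numE// wl_fin.
  exists (H * (B * fine W)) => t t0; rewrite wlE; last exact: mut.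
  apply: (@le_trans _ _ (((1 + t) `^ (- (l / 2)))%:E *
      (H%:E * ((B * (1 + t) `^ (l / 2))%:E * W)))%E).
    rewrite lee_wpmul2l ?lee_fin ?powR_ge0//.
    apply: (@le_trans _ _ (\int[tuple_leb N]_x
        (H * ((1 + enorm_t x) `^ l * heat_maj phi x t))%:E)%E).
      apply: le_int0.
      * by apply: measurable_funM => //; apply: measurableT_comp => //; exact: mut.
      * by apply: measurable_funM => //; exact: measurable_funM.
      * by move=> x; rewrite mulr_ge0 ?powR_ge0.
      * by move=> x; rewrite mulrCA ler_wpM2l ?powR_ge0// uH.
    rewrite int0Z//; last 2 first.
    * exact: measurable_funM.
    * by move=> x; rewrite mulr_ge0 ?powR_ge0 ?heat_maj_ge0.
    by rewrite lee_wpmul2l ?lee_fin//; exact: hB.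
  rewrite WE -!EFinM lee_fin.
  have t1 : 0 < 1 + t by rewrite addr_gt0.
  rewrite [leLHS](_ : _ = ((1 + t) `^ (- (l / 2)) * (1 + t) `^ (l / 2)) * (H * (B * fine W))); last by ring.
  by rewrite -powRD ?addNr ?powRr0 ?mul1r// (gt_eqF t1) implybT.
(* The mild formula holds at every point with t > 0, so the exceptional set is empty. *)
- rewrite (_ : [set _ | _] = set0); first exact: leb_negligible0.
  apply/seteqP; split => y //= [t0]; apply; split.
    by move=> i; exact: (duhamel_integrable mphi iphi mb b_bnd fadm).
  by rewrite {1}um// /mild (duh_Rintegral mphi iphi mb b_bnd fadm).
- move=> q q1; apply: cvge0_pinfty => e e0.
  have vs (e' : R) : 0 < e' -> exists2 T : R, 0 < T & forall t : R, T <= t -> (vol b t <= e'%:E)%E.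
    move=> e'0; pose d := e' / (C * H + 1).
    have d0 : 0 < d by rewrite divr_gt0// ltr_wpDl.
    have [T T0 hT] := wkappa_small gam_gt d0; exists T => // t /hT h.
    have -> : vol b t = ((C * H)%:E * wkappa gam t)%E.
      rewrite /wkappa -int0Z.
      + apply: eq_integral => s _; congr EFin; rewrite /b /ind; case: ifPn => [/andP[s0 _]|_].
          by rewrite pweightE// !mul1r mulrCA.
        by rewrite !mul0r mulr0.
      + by apply: measurable_itv_isqrt; exact: measurable_1DpowR.
      + by move=> s; rewrite !mulr_ge0 ?ind_ge0 ?isqrt_ge0 ?powR_ge0.
      + exact: CH.
    apply: (le_trans (lee_wpmul2l _ h)); first by rewrite lee_fin.
    rewrite -EFinM lee_fin /d mulrCA ger_pMr// ler_pdivrMr ?mul1r ?lerDl//.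
    by rewrite ltr_wpDl.
  have [T T0 hT] := mild_asymptotics mphi iphi mb b_bnd fadm vs e0.
  exists T => // t Tt; have t0 : 0 < t by exact: lt_le_trans Tt.
  have [h1 h2] := hT t Tt.
  rewrite (_ : (fun x => _) = (fun x => mild phi (nonlin F u) x t - lebintR phi * gauss_g x t)); last first.
    by apply/funext => x; rewrite um.
  have mv : measurable_fun [set: N.-tuple R]
      (fun x => mild phi (nonlin F u) x t - lebintR phi * gauss_g x t).
    apply: measurable_funB; first exact: (measurable_mild mphi iphi fadm).
    by apply: measurable_funM => //; exact: measurable_gauss.
  rewrite mule_ge0 ?lee_fin ?powR_ge0 ?Lq_norm_ge0//=.
  by apply: Lq_norm_interpolation => //; exact: ltW.
Qed.
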